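(* Let $n\ge1$, let $\boldsymbol{a}$ be a weak composition of $r$ of length $m$ and $\boldsymbol{b}$ a weak composition of $s$ of length $m'$. As a $GL_n$-module, $$\mathbb{C}[X_{n\times m};\Theta_{n\times m'}]^{\boldsymbol{a},\boldsymbol{b}}\cong\bigoplus_{\substack{\lambda\vdash r+s\\ \ell(\lambda)\leq n}}\left(GL_n^\lambda\right)^{\oplus|\mathcal{SSMT}'(\lambda,\boldsymbol{a},\boldsymbol{b})|}.$$
   Context: A weak composition of $r$ of length $m$ is a sequence of $m$ non-negative integers with sum $r$. $\mathbb{C}[X_{n\times m};\Theta_{n\times m'}]$ is the $\mathbb{C}$-algebra generated by variables $x_{i,j}$ ($1\le i\le n$, $1\le j\le m$) and $\theta_{i,j}$ ($1\le i\le n$, $1\le j\le m'$), where the $x_{i,j}$ commute with all variables, $\theta_{i,j}\theta_{a,b}=-\theta_{a,b}\theta_{i,j}$ if $(i,j)\ne(a,b)$, and $\theta_{i,j}^2=0$. The superscript $\boldsymbol a,\boldsymbol b$ denotes the subspace spanned by monomials of total degree $\boldsymbol a_t$ in the variables $x_{1,t},\dots,x_{n,t}$ for each $1\le t\le m$ and total degree $\boldsymbol b_t$ in the variables $\theta_{1,t},\dots,\theta_{n,t}$ for each $1\le t\le m'$. $GL_n=GL_n(\mathbb{C})$ acts by algebra automorphisms, each column of variables $x_{1,t},\dots,x_{n,t}$ or $\theta_{1,t},\dots,\theta_{n,t}$ being identified with the standard basis of the defining representation $\mathbb{C}^n$; thus the subspace is $\mathrm{Sym}^{\boldsymbol a_1}(\mathbb{C}^n)\otimes\cdots\otimes\mathrm{Sym}^{\boldsymbol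 a_m}(\mathbb{C}^n)\otimes\bigwedge^{\boldsymbol b_1}(\mathbb{C}^n)\otimes\cdots\otimes\bigwedge^{\boldsymbol b_{m'}}(\mathbb{C}^n)$. $GL_n^\lambda$ is the simple polynomial representation of $GL_n$ whose character is the Schur polynomial $s_\lambda(x_1,\dots,x_n)$; $\ell(\lambda)$ is the number of parts of $\lambda$. $\mathcal{SSMT}'(\lambda,\boldsymbol a,\boldsymbol b)$ is the set of semistandard tableaux of shape $\lambda\vdash r+s$ with all boxes filled with single symbols (blocks of size one, no empty boxes) from $1<2<\dots<m<\overline1<\overline2<\dots<\overline{m'}$, where $i$ occurs $\boldsymbol a_i$ times and $\overline j$ occurs $\boldsymbol b_j$ times, such that (diagrams in French convention) rows weakly increase from left to right, columns weakly increase from bottom to top, no unbarred symbol is repeated in a column, and no barred symbol is repeated in a row. *)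

(* Defs.v *)
From HB Require Import structures.
From mathcomp Require Import all_boot all_order all_algebra.
From mathcomp Require Import mpoly.
From mathcomp Require Import ring.

Set Implicit Arguments.
Unset Strict Implicit.
Unset Printing Implicit Defensive.

Import Order.TTheory GRing.Theory Num.Theory.
Local Open Scope ring_scope.

(* Superpolynomials in k commuting variables x_p (p : 'I_k) and N             *)
(* anticommuting variables theta_q (q : 'I_N).  The value f S is the          *)
(* coefficient, a polynomial in the x_p, of the monomial                      *)
(* theta_(q1) * ... * theta_(ql), where S = {q1 < ... < ql}.                  *)
Definition superpoly (K : numFieldType) (k N : nat) : Type :=
  {ffun {set 'I_N} -> {mpoly K[k]}}.

HB.instance Definition _ (K : numFieldType) (k N : nat) :=
  GRing.Lmodule.copy (superpoly K k N) {ffun {set 'I_N} -> {mpoly K[k]}}.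

Section SuperpolyRing.
Variables (K : numFieldType) (k N : nat).
Local Notation A := {mpoly K[k]}.
Local Notation E := (superpoly K k N).
Implicit Types (S T U V W : {set 'I_N}) (f g h : E) (p q : A).

(* theta_S * theta_T = (-1) ^ ninv S T * theta_(S :|: T) for disjoint S, T. *)
Definition ninv S T : nat := (\sum_(i in S) \sum_(j in T) (j < i))%N.

Definition spmul f g : E :=
  [ffun U : {set 'I_N} => \sum_(S : {set 'I_N} | S \subset U)
     (-1) ^+ ninv S (U :\: S) * (f S * g (U :\: S))].

Definition spmon p S : E := [ffun U : {set 'I_N} => if U == S then p else 0].

Definition spsgn S T : A := if [disjoint S & T] then (-1) ^+ ninv S T else 0.

Lemma ninvUl S T U : [disjoint S & T] ->
  ninv (S :|: T) U = (ninv S U + ninv T U)%N.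
Proof. by move=> dST; rewrite /ninv -bigU //; apply: eq_bigl => i; rewrite !inE. Qed.

Lemma ninvUr S T U : [disjoint S & T] ->
  ninv U (S :|: T) = (ninv U S + ninv U T)%N.
Proof.
move=> dST; rewrite /ninv -big_split /=.
by apply: eq_bigr => i _; rewrite -bigU //; apply: eq_bigl => j; rewrite !inE.
Qed.

Lemma spsgnA S T U :
  spsgn S T * spsgn (S :|: T) U = spsgn T U * spsgn S (T :|: U).
Proof.
rewrite /spsgn; case dST: [disjoint S & T]; last first.
  rewrite mul0r; case dSTU: [disjoint S & T :|: U]; rewrite ?mulr0 //.
  by move: (disjointWr (subsetUl T U) dSTU); rewrite dST.
case dTU: [disjoint T & U]; last first.
  rewrite mul0r; case dSTU: [disjoint S :|: T & U]; rewrite ?mulr0 //.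
  by move: (disjointWl (subsetUr S T) dSTU); rewrite dTU.
have -> : [disjoint S :|: T & U] = [disjoint S & U].
  by rewrite -!setI_eq0 setIUl setU_eq0 !setI_eq0 dTU andbT.
have -> : [disjoint S & T :|: U] = [disjoint S & U].
  by rewrite -!setI_eq0 setIUr setU_eq0 !setI_eq0 dST.
case: ifP => _; rewrite ?mulr0 // -!exprD ninvUl // ninvUr //.
by rewrite addnA addnC.
Qed.

Lemma spmulE f g U : spmul f g U =
  \sum_S \sum_T (S :|: T == U)%:R * (spsgn S T * (f S * g T)).
Proof.
rewrite ffunE big_mkcond; apply: eq_bigr => S _; case: ifPn => [sSU|nsSU].
  rewrite (bigD1 (U :\: S)) //= [X in _ + X]big1 ?addr0 => [|T neT].
    rewrite setDE setUIr setUCr setIT (setUidPr sSU) eqxx mul1r.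
    by rewrite /spsgn -setI_eq0 setICA setICr setI0 eqxx.
  case: eqP; rewrite ?mul0r // mul1r /spsgn => STU; case: ifP; rewrite ?mul0r //.
  move=> dST; case/eqP: neT; rewrite -STU setDUl setDv set0U.
  by apply/esym/setDidPl; rewrite disjoint_sym.
rewrite big1 // => T _; case: eqP; rewrite ?mul0r // => STU.
by case/negP: nsSU; rewrite -STU subsetUl.
Qed.

Lemma sum_delta (I : finType) (j : I) (F : I -> A) :
  \sum_i (j == i)%:R * F i = F j.
Proof.
rewrite (bigD1 j) //= eqxx mul1r big1 ?addr0 // => i /negPf.
by rewrite eq_sym => ->; rewrite mul0r.
Qed.

Lemma spmulA : associative spmul.
Proof.
move=> f g h; apply/ffunP => U; rewrite !spmulE.
pose R S T W := (S :|: T :|: W == U)%:R * (spsgn S T * spsgn (S :|: T) W *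
   (f S * g T * h W)) : A.
transitivity (\sum_S \sum_T \sum_W R S T W).
  apply: eq_bigr => S _.
  transitivity (\sum_V \sum_T \sum_W (T :|: W == V)%:R *
     ((S :|: V == U)%:R * (spsgn T W * spsgn S V * (f S * g T * h W)))).
    apply: eq_bigr => V _; rewrite spmulE !mulr_sumr.
    apply: eq_bigr => T _; rewrite !mulr_sumr.
    by apply: eq_bigr => W _; ring.
  rewrite exchange_big; apply: eq_bigr => T _ /=.
  rewrite exchange_big; apply: eq_bigr => W _ /=.
  by rewrite sum_delta /R setUA spsgnA.
symmetry.
transitivity (\sum_V \sum_W \sum_S \sum_T (S :|: T == V)%:R *
   ((V :|: W == U)%:R * (spsgn S T * spsgn V W * (f S * g T * h W)))).
  apply: eq_bigr => V _; apply: eq_bigr => W _.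
  rewrite spmulE !mulr_suml !mulr_sumr.
  apply: eq_bigr => S _; rewrite !mulr_suml !mulr_sumr.
  by apply: eq_bigr => T _; ring.
rewrite exchange_big /=.
transitivity (\sum_W \sum_S \sum_T R S T W); last first.
  by rewrite exchange_big; apply: eq_bigr => S _; exact: exchange_big.
apply: eq_bigr => W _; rewrite exchange_big; apply: eq_bigr => S _ /=.
by rewrite exchange_big; apply: eq_bigr => T _ /=; rewrite sum_delta.
Qed.

Lemma ninv0l S : ninv set0 S = 0%N. Proof. by rewrite /ninv big_set0. Qed.
Lemma ninv0r S : ninv S set0 = 0%N.
Proof. by rewrite /ninv big1 // => i _; rewrite big_set0. Qed.

Lemma spsgn0l S : spsgn set0 S = 1.
Proof. by rewrite /spsgn -setI_eq0 set0I eqxx ninv0l expr0. Qed.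
Lemma spsgn0r S : spsgn S set0 = 1.
Proof. by rewrite /spsgn -setI_eq0 setI0 eqxx ninv0r expr0. Qed.

Lemma spmul_spmon p q S T :
  spmul (spmon p S) (spmon q T) = spmon (spsgn S T * (p * q)) (S :|: T).
Proof.
apply/ffunP => U; rewrite spmulE ffunE.
rewrite (bigD1 S) //= [X in _ + X]big1 ?addr0 => [|S' neS]; last first.
  by rewrite big1 // => T' _; rewrite !ffunE (negPf neS) mul0r !mulr0.
rewrite (bigD1 T) //= big1 ?addr0 => [|T' neT]; last first.
  by rewrite !ffunE (negPf neT) !mulr0.
by rewrite !ffunE !eqxx eq_sym; case: eqP => _; rewrite ?mul1r ?mul0r.
Qed.

Lemma spmon_sum f : f = \sum_S spmon (f S) S.
Proof.
apply/ffunP => U; rewrite sum_ffunE (bigD1 U) //= ffunE eqxx.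
by rewrite big1 ?addr0 // => S /negPf; rewrite ffunE eq_sym => ->.
Qed.

Lemma spmulDl : left_distributive spmul +%R.
Proof.
move=> f g h; apply/ffunP => U; rewrite !ffunE -big_split /=.
by apply: eq_bigr => S _; rewrite !ffunE mulrDl mulrDr.
Qed.

Lemma spmulDr : right_distributive spmul +%R.
Proof.
move=> f g h; apply/ffunP => U; rewrite !ffunE -big_split /=.
by apply: eq_bigr => S _; rewrite !ffunE !mulrDr.
Qed.

Lemma spmul1l : left_id (spmon 1 set0) spmul.
Proof.
move=> f; rewrite [in LHS](spmon_sum f) [RHS](spmon_sum f).
have spmulr0 : right_zero 0 spmul.
  move=> u; apply/ffunP => U; rewrite !ffunE big1 // => S _.
  by rewrite ffunE !mulr0.
rewrite (big_morph (spmul (spmon 1 set0)) (spmulDr _) (spmulr0 _)).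
by apply: eq_bigr => S _; rewrite spmul_spmon spsgn0l !mul1r set0U.
Qed.

Lemma spmul1r : right_id (spmon 1 set0) spmul.
Proof.
move=> f; rewrite [in LHS](spmon_sum f) [RHS](spmon_sum f).
have spmul0r : left_zero 0 spmul.
  move=> u; apply/ffunP => U; rewrite !ffunE big1 // => S _.
  by rewrite ffunE mul0r mulr0.
rewrite (big_morph (spmul^~ (spmon 1 set0))
          (fun g h => spmulDl g h _) (spmul0r _)).
by apply: eq_bigr => S _; rewrite spmul_spmon spsgn0r mul1r mulr1 setU0.
Qed.

Lemma spone_neq0 : spmon 1 set0 != 0.
Proof.
by apply/eqP => /ffunP/(_ set0)/eqP; rewrite !ffunE eqxx oner_eq0.
Qed.

HB.instance Definition _ := GRing.Zmodule_isNzRing.Build (superpoly K k N)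
  spmulA spmul1l spmul1r spmulDl spmulDr spone_neq0.

Fact sp_scalerAl (c : K) f g : c *: (f * g) = (c *: f) * g.
Proof.
apply/ffunP => U; rewrite !ffunE scaler_sumr; apply: eq_bigr => S _.
by rewrite !ffunE -!scalerAl -scalerAr.
Qed.

Fact sp_scalerAr (c : K) f g : c *: (f * g) = f * (c *: g).
Proof.
apply/ffunP => U; rewrite !ffunE scaler_sumr; apply: eq_bigr => S _.
by rewrite !ffunE -!scalerAr.
Qed.

HB.instance Definition _ :=
  GRing.Lmodule_isLalgebra.Build K (superpoly K k N) sp_scalerAl.
HB.instance Definition _ :=
  GRing.Lalgebra_isAlgebra.Build K (superpoly K k N) sp_scalerAr.

Definition spC p : E := spmon p set0.
Definition spX (i : 'I_k) : E := spC 'X_i.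
Definition spTheta (i : 'I_N) : E := spmon 1 [set i].

Lemma spmonM p q S T :
  spmon p S * spmon q T = spmon (spsgn S T * (p * q)) (S :|: T).
Proof. exact: spmul_spmon. Qed.

Lemma spmonD p q S : spmon (p + q) S = spmon p S + spmon q S.
Proof. by apply/ffunP => U; rewrite !ffunE; case: ifP; rewrite ?addr0. Qed.

Lemma spmonZ c p S : spmon (c *: p) S = c *: spmon p S.
Proof. by apply/ffunP => U; rewrite !ffunE; case: ifP; rewrite ?scaler0. Qed.

Lemma spmon0 S : spmon 0 S = 0.
Proof. by apply/ffunP => U; rewrite !ffunE if_same. Qed.

Lemma spmonE p S : spmon p S = spC p * spmon 1 S.
Proof. by rewrite spmonM spsgn0l mul1r mulr1 set0U. Qed.

Fact spC_is_linear : linear spC.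
Proof. by move=> c p q; rewrite /spC spmonD spmonZ. Qed.

Fact spC_is_monoid_morphism : monoid_morphism spC.
Proof. by split=> // p q; rewrite /spC spmonM setU0 spsgn0l mul1r. Qed.

HB.instance Definition _ := GRing.isLinear.Build K A E *:%R spC spC_is_linear.
HB.instance Definition _ := GRing.isMonoidMorphism.Build A E spC
  spC_is_monoid_morphism.

Lemma spC_central p f : spC p * f = f * spC p.
Proof.
rewrite (spmon_sum f) mulr_sumr mulr_suml; apply: eq_bigr => S _.
by rewrite !spmonM spsgn0l spsgn0r set0U setU0 !mul1r mulrC.
Qed.

Lemma spX_central i f : spX i * f = f * spX i.
Proof. exact: spC_central. Qed.

Lemma ninv11 (i j : 'I_N) : ninv [set i] [set j] = (j < i)%N.
Proof. by rewrite /ninv !big_set1. Qed.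

Lemma spmonN p S : spmon (- p) S = - spmon p S.
Proof. by rewrite -scaleN1r spmonZ scaleN1r. Qed.

Lemma spTheta_anticomm i j : i != j ->
  spTheta i * spTheta j = - (spTheta j * spTheta i).
Proof.
move=> ne_ij; rewrite !spmonM setUC -spmonN -mulNr; congr (spmon (_ * _) _).
rewrite /spsgn !disjoints1 !inE (eq_sym j i) ne_ij !ninv11.
move: ne_ij; rewrite -val_eqE neq_ltn.
by case: ltngtP => //= _ _; rewrite ?expr0 ?expr1 ?opprK.
Qed.

Lemma spTheta_sq i : spTheta i * spTheta i = 0.
Proof.
by rewrite spmonM /spsgn disjoints1 inE eqxx mul0r spmon0.
Qed.

End SuperpolyRing.
Section Substitution.
Variables (K : numFieldType) (k N : nat).
Local Notation A := {mpoly K[k]}.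
Local Notation E := (superpoly K k N).
Implicit Types (S T U V : {set 'I_N}) (p q : A).

Lemma set_min_ind (P : {set 'I_N} -> Prop) :
    P set0 ->
    (forall (j : 'I_N) V, (forall i, i \in V -> j < i)%N -> P V -> P (j |: V)) ->
  forall S, P S.
Proof.
move=> P0 PU S; have [c leSc] := ubnP #|S|; elim: c S leSc => // c IHc S.
have [->//|[j0 Sj0]] := set_0Vmem S.
have [j Sj minj] := @arg_minnP _ j0 (mem S) (@nat_of_ord N) Sj0.
rewrite -(setD1K Sj) cardsU1 !inE eqxx /= add1n ltnS => leVc.
apply: PU (IHc _ leVc) => i; rewrite !inE => /andP[neij Si].
by rewrite ltn_neqAle minj // andbT eq_sym.
Qed.

Lemma enum_setU1_min (j : 'I_N) V : (forall i, i \in V -> j < i)%N ->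
  enum (j |: V) = j :: enum V.
Proof.
move=> ltj; pose r : rel 'I_N := fun x y => (x < y)%N.
have r_tr : transitive r by move=> y x z; apply: ltn_trans.
have r_irr : irreflexive r by move=> x; apply: ltnn.
have r_enum S : sorted r (enum S).
  rewrite {1}/enum_mem -enumT; apply: sorted_filter => //.
  by have := iota_ltn_sorted 0 N; rewrite -val_enum_ord sorted_map.
apply: (irr_sorted_eq r_tr r_irr) => //= [|x].
  rewrite path_min_sorted ?r_enum //; apply/allP => i.
  by rewrite mem_enum => /ltj.
by rewrite in_cons !mem_enum !inE.
Qed.

Definition wprod (w : 'I_N -> E) S : E := \prod_(i <- enum S) w i.

Lemma wprod0 w : wprod w set0 = 1.
Proof. by rewrite /wprod enum_set0 big_nil. Qed.

Lemma wprodU1 w (j : 'I_N) V : (forall i, i \in V -> j < i)%N ->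
  wprod w (j |: V) = w j * wprod w V.
Proof. by move=> ltj; rewrite /wprod enum_setU1_min // big_cons. Qed.

Lemma min_notin (j : 'I_N) V : (forall i, i \in V -> j < i)%N -> j \notin V.
Proof. by move=> ltj; apply/negP => /ltj; rewrite ltnn. Qed.

Lemma ninv_min (j : 'I_N) V : (forall i, i \in V -> j < i)%N -> ninv [set j] V = 0%N.
Proof.
move=> ltj; rewrite /ninv big_set1 big1 // => i /ltj ltji.
by rewrite ltnNge ltnW.
Qed.

Lemma spsgn_min (j : 'I_N) V : (forall i, i \in V -> j < i)%N ->
  spsgn K k [set j] V = 1.
Proof.
move=> ltj; rewrite /spsgn disjoints1 (min_notin ltj) ninv_min //.
Qed.

Lemma spmon_wprod S : spmon 1 S = wprod (@spTheta K k N) S.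
Proof.
elim/set_min_ind: S => [|j V ltj IH]; first by rewrite wprod0.
by rewrite wprodU1 // -IH /spTheta spmonM spsgn_min // !mul1r.
Qed.

Variables (x : k.-tuple A) (w : 'I_N -> E).
Hypothesis w_anticomm : forall i j, w i * w j = - (w j * w i).

Lemma w_sq i : w i * w i = 0.
Proof.
apply/eqP; have := w_anticomm i i => /eqP.
rewrite -addr_eq0 -mulr2n -scaler_nat scaler_eq0.
by rewrite pnatr_eq0.
Qed.

Lemma wprod_cons i V : w i * wprod w V = spC N (spsgn K k [set i] V) * wprod w (i |: V).
Proof.
elim/set_min_ind: V => [|j V ltj IH].
  by rewrite spsgn0r rmorph1 mul1r wprodU1 // => i'; rewrite inE.
have ltjs : [disjoint [set j] & V] by rewrite disjoints1 min_notin.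
case: (ltngtP i j) => [ltij|ltji|/val_inj eqij].
- have lti i' : i' \in j |: V -> (i < i')%N.
    by rewrite !inE => /predU1P[->//|/ltj]; apply: ltn_trans.
  by rewrite [in RHS](wprodU1 _ lti) (spsgn_min lti) rmorph1 mul1r.
- rewrite wprodU1 // mulrA w_anticomm mulNr -mulrA IH mulrA -spC_central -mulrA.
  rewrite setUCA.
  have [Vi|nVi] := boolP (i \in V).
    rewrite /spsgn !disjoints1 !inE Vi orbT /=.
    by rewrite raddf0 !mul0r oppr0.
  rewrite -wprodU1; last by move=> i'; rewrite !inE => /predU1P[->//|/ltj].
  rewrite -mulNr -rmorphN; congr (spC _ _ * _).
  have nij : i != j by rewrite -val_eqE neq_ltn ltji orbT.
  rewrite /spsgn !disjoints1 !inE (negPf nij) /= nVi ninvUr // ninv11 ltji.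
  by rewrite exprS mulN1r.
rewrite eqij wprodU1 // mulrA w_sq mul0r setUA setUid.
by rewrite /spsgn disjoints1 !inE eqxx raddf0 mul0r.
Qed.

Lemma wprodM S T :
  wprod w S * wprod w T = spC N (spsgn K k S T) * wprod w (S :|: T).
Proof.
elim/set_min_ind: S => [|j V ltj IH].
  by rewrite wprod0 mul1r spsgn0l rmorph1 mul1r set0U.
rewrite wprodU1 // -mulrA IH mulrA -spC_central -mulrA wprod_cons.
rewrite mulrA -rmorphM setUA; congr (spC _ _ * _).
by rewrite -spsgnA spsgn_min // mul1r.
Qed.

(* Image of f under the substitution x_p := x`_p, theta_q := w q. *)
Definition spsubst (f : E) : E :=
  \sum_S spC N (f S \mPo x) * wprod w S.

Fact spsubst_is_linear : linear spsubst.
Proof.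
move=> c f g; rewrite /spsubst scaler_sumr -big_split; apply: eq_bigr => S _ /=.
by rewrite !ffunE comp_mpolyD comp_mpolyZ linearP mulrDl -scalerAl.
Qed.

Lemma spsubst_mon p S : spsubst (spmon p S) = spC N (p \mPo x) * wprod w S.
Proof.
rewrite /spsubst (bigD1 S) //= ffunE eqxx big1 ?addr0 // => T /negPf neT.
by rewrite ffunE neT comp_mpoly0 raddf0 mul0r.
Qed.

HB.instance Definition _ := GRing.isLinear.Build K E E *:%R spsubst
  spsubst_is_linear.

Lemma comp_spsgn S T : spsgn K k S T \mPo x = spsgn K k S T.
Proof.
rewrite /spsgn; case: ifP => _; last exact: comp_mpoly0.
by rewrite rmorphXn rmorphN1.
Qed.

Fact spsubst_is_monoid_morphism : monoid_morphism spsubst.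
Proof.
split=> [|f g].
  apply: etrans (spsubst_mon 1 set0) _.
  by rewrite comp_mpoly1 rmorph1 mul1r wprod0.
rewrite (spmon_sum f) (spmon_sum g) mulr_suml !linear_sum mulr_suml.
apply: eq_bigr => S _; rewrite mulr_sumr mulr_sumr linear_sum.
apply: eq_bigr => T _; rewrite /= spmonM !spsubst_mon.
rewrite rmorphM /= comp_spsgn rmorphM.
rewrite -[RHS]mulrA [in RHS](mulrA (wprod w S)) -(spC_central _ (wprod w S)).
rewrite -!mulrA wprodM !mulrA -!rmorphM; congr (spC _ _ * _).
by rewrite rmorphM; ring.
Qed.

HB.instance Definition _ := GRing.isMonoidMorphism.Build E E spsubst
  spsubst_is_monoid_morphism.

Lemma spsubst_X i : spsubst (spX K N i) = spC N (tnth x i).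
Proof. by rewrite spsubst_mon wprod0 mulr1 comp_mpolyXU -tnth_nth. Qed.

Lemma spsubst_Theta i : spsubst (spTheta K k i) = w i.
Proof.
by rewrite spsubst_mon comp_mpoly1 rmorph1 mul1r /wprod enum_set1 big_seq1.
Qed.

End Substitution.
Section SubstComp.
Variables (K : numFieldType) (k N : nat).
Local Notation A := {mpoly K[k]}.
Local Notation E := (superpoly K k N).

Lemma spTheta_acomm (i j : 'I_N) :
  spTheta K k i * spTheta K k j = - (spTheta K k j * spTheta K k i).
Proof.
have [->|] := eqVneq i j; last exact: spTheta_anticomm.
by rewrite spTheta_sq oppr0.
Qed.

Lemma comp_mpolyA (x y : k.-tuple A) p :
  (p \mPo x) \mPo y = p \mPo [tuple tnth x i \mPo y | i < k].
Proof.
rewrite (comp_mpolyEX p x) (comp_mpolyEX p) rmorph_sum; apply: eq_bigr => mu _.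
rewrite /= comp_mpolyZ !comp_mpolyX rmorph_prod; congr (_ *: _).
by apply: eq_bigr => i _; rewrite rmorphXn tnth_mktuple.
Qed.

Lemma eq_spsubst (x y : k.-tuple A) (w v : 'I_N -> E) :
  (forall i, tnth x i = tnth y i) -> w =1 v -> spsubst x w =1 spsubst y v.
Proof.
move=> /eq_from_tnth -> eq_wv f; apply: eq_bigr => S _; congr (_ * _).
by apply: eq_bigr => i _.
Qed.

Lemma spsubst_comp (x y : k.-tuple A) (w v : 'I_N -> E) f :
    (forall i j, v i * v j = - (v j * v i)) ->
  spsubst y v (spsubst x w f) =
  spsubst [tuple tnth x i \mPo y | i < k] (fun q => spsubst y v (w q)) f.
Proof.
move=> vC; pose h : E -> E := spsubst y v.
have hM : monoid_morphism h by exact: spsubst_is_monoid_morphism.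
pose hR : {rmorphism E -> E} := HB.pack h
  (GRing.isMonoidMorphism.Build E E h hM)
  (GRing.isLinear.Build K E E *:%R h (spsubst_is_linear y v)).
rewrite -/(h _) -[h]/(hR : E -> E) rmorph_sum; apply: eq_bigr => S _.
rewrite rmorphM rmorph_prod; congr (_ * _) => /=.
by rewrite /h spsubst_mon wprod0 mulr1 comp_mpolyA.
Qed.

Lemma spsubst_id f :
  spsubst [tuple 'X_i | i < k] (@spTheta K k N) f = f.
Proof.
rewrite [RHS]spmon_sum; apply: eq_bigr => S _.
by rewrite comp_mpoly_id -spmon_wprod -spmonE.
Qed.

End SubstComp.

(* The variables x_(i,j), i < n, j < m, are numbered by mxvec_index i j, and  *)
(* likewise for the theta_(i,j), i < n, j < m'.                               *)
Section GLAction.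
Variables (K : numFieldType) (n m m' : nat).
Local Notation E := (superpoly K (n * m) (n * m')).
Implicit Types (g h : 'M[K]_n) (f : E).

(* g sends the i-th basis vector of K^n to the i-th column of g. *)
Definition gl_x g : (n * m).-tuple {mpoly K[n * m]} :=
  [tuple mxvec (\matrix_(i < n, j < m)
                  \sum_(l < n) g l i *: 'X_(mxvec_index l j)) 0 p | p < n * m].

Definition gl_theta g (q : 'I_(n * m')) : E :=
  mxvec (\matrix_(i < n, j < m')
           \sum_(l < n) g l i *: spTheta K (n * m) (mxvec_index l j)) 0 q.

Definition sp_act g : E -> E := spsubst (gl_x g) (gl_theta g).

Lemma gl_xE g i j : tnth (gl_x g) (mxvec_index i j) =
  \sum_(l < n) g l i *: 'X_(mxvec_index l j).
Proof. by rewrite tnth_mktuple mxvecE mxE. Qed.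

Lemma gl_thetaE g i j : gl_theta g (mxvec_index i j) =
  \sum_(l < n) g l i *: spTheta K (n * m) (mxvec_index l j).
Proof. by rewrite /gl_theta mxvecE mxE. Qed.

Lemma gl_theta_acomm g q r :
  gl_theta g q * gl_theta g r = - (gl_theta g r * gl_theta g q).
Proof.
case/mxvec_indexP: q => i j; case/mxvec_indexP: r => i' j'.
rewrite !gl_thetaE !mulr_suml -sumrN.
under eq_bigr do rewrite mulr_sumr.
under [RHS]eq_bigr do rewrite mulr_sumr -sumrN.
rewrite exchange_big; apply: eq_bigr => l _; apply: eq_bigr => l' _ /=.
rewrite -!scalerAl -!scalerAr spTheta_acomm !scalerN scalerA mulrC.
by rewrite scalerA.
Qed.

Fact sp_act_is_linear g : linear (sp_act g).
Proof. exact: spsubst_is_linear. Qed.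

HB.instance Definition _ g := GRing.isLinear.Build K E E *:%R (sp_act g)
  (sp_act_is_linear g).

Fact sp_act_is_monoid_morphism g : monoid_morphism (sp_act g).
Proof. exact/spsubst_is_monoid_morphism/gl_theta_acomm. Qed.

HB.instance Definition _ g := GRing.isMonoidMorphism.Build E E (sp_act g)
  (sp_act_is_monoid_morphism g).

Lemma sp_act_X g i j :
  sp_act g (spX K (n * m') (mxvec_index i j)) =
  \sum_(l < n) g l i *: spX K (n * m') (mxvec_index l j).
Proof.
rewrite /sp_act spsubst_X gl_xE linear_sum.
by apply: eq_bigr => l _; rewrite linearZ.
Qed.

Lemma sp_act_Theta g i j :
  sp_act g (spTheta K (n * m) (mxvec_index i j)) =
  \sum_(l < n) g l i *: spTheta K (n * m) (mxvec_index l j).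
Proof. by rewrite /sp_act spsubst_Theta gl_thetaE. Qed.

Lemma sp_act1 f : sp_act 1%:M f = f.
Proof.
rewrite -[RHS]spsubst_id; apply: eq_spsubst => [p|q].
  case/mxvec_indexP: p => i j; rewrite gl_xE tnth_mktuple (bigD1 i) //= mxE eqxx.
  by rewrite scale1r big1 ?addr0 // => l /negPf nli; rewrite mxE nli scale0r.
case/mxvec_indexP: q => i j; rewrite gl_thetaE (bigD1 i) //= mxE eqxx.
by rewrite scale1r big1 ?addr0 // => l /negPf nli; rewrite mxE nli scale0r.
Qed.

Lemma sp_actM g h f : sp_act (g *m h) f = sp_act g (sp_act h f).
Proof.
rewrite [RHS]spsubst_comp; last exact: gl_theta_acomm.
apply: eq_spsubst => [p|q].
  case/mxvec_indexP: p => i j; rewrite gl_xE tnth_mktuple gl_xE.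
  rewrite linear_sum; under [RHS]eq_bigr => l _.
    rewrite /= comp_mpolyZ comp_mpolyXU -tnth_nth gl_xE scaler_sumr; over.
  rewrite exchange_big; apply: eq_bigr => l _ /=; rewrite mxE scaler_suml.
  by apply: eq_bigr => l' _; rewrite scalerA mulrC.
case/mxvec_indexP: q => i j; rewrite !gl_thetaE -/(sp_act g _) linear_sum.
under [RHS]eq_bigr do rewrite linearZ /= sp_act_Theta scaler_sumr.
rewrite exchange_big; apply: eq_bigr => l _ /=; rewrite mxE scaler_suml.
by apply: eq_bigr => l' _; rewrite scalerA mulrC.
Qed.

End GLAction.
Lemma mxvec_index_eq (n m : nat) (i l : 'I_n) (j t : 'I_m) :
  (mxvec_index i j == mxvec_index l t) = (i == l) && (j == t).
Proof.
by rewrite (inj_eq (@cast_ord_inj _ _ _)) (inj_eq enum_rank_inj) xpair_eqE.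
Qed.

Section Multidegree.
Variables (K : numFieldType) (n m m' : nat).
Local Notation E := (superpoly K (n * m) (n * m')).
Implicit Types (g : 'M[K]_n) (f : E) (a : 'I_m -> nat) (b : 'I_m' -> nat).

(* x^mu * theta_S has total degree a t in the x_(1,t), ..., x_(n,t) and       *)
(* total degree b t in the theta_(1,t), ..., theta_(n,t), for all t.          *)
Definition has_mdeg a b (mu : 'X_{1..n * m}) (S : {set 'I_(n * m')}) : bool :=
  [forall t, \sum_(i < n) mu (mxvec_index i t) == a t]%N &&
  [forall t, \sum_(i < n) (mxvec_index i t \in S) == b t]%N.

Definition spgrade a b : {pred E} :=
  [pred f : E | [forall S, all (has_mdeg a b ^~ S) (msupp (f S))]].

Lemma spgradeP a b f :
  reflect (forall S mu, (f S)@_mu != 0 -> has_mdeg a b mu S) (f \in spgrade a b).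
Proof.
apply: (iffP forallP) => [fP S mu fS|fP S].
  by have /allP := fP S; apply; rewrite mcoeff_msupp.
by apply/allP => mu; rewrite mcoeff_msupp; apply: fP.
Qed.

Fact spgrade_submod_closed a b : submod_closed (spgrade a b).
Proof.
split=> [|c f h /spgradeP fP /spgradeP hP]; apply/spgradeP => S mu.
  by rewrite ffunE mcoeff0 eqxx.
rewrite !ffunE mcoeffD mcoeffZ => nz.
have [f0|/fP//] := eqVneq (f S)@_mu 0.
by apply: hP; apply: contraNneq nz => ->; rewrite f0 mulr0 addr0.
Qed.

HB.instance Definition _ a b :=
  GRing.isSubmodClosed.Build K E (spgrade a b) (spgrade_submod_closed a b).

Lemma eq_spgrade a a' b b' :
  a =1 a' -> b =1 b' -> spgrade a b =i spgrade a' b'.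
Proof.
move=> eqa eqb f; apply: eq_forallb => S; apply: eq_all => mu; rewrite /has_mdeg.
by congr (_ && _); apply: eq_forallb => t; rewrite ?eqa ?eqb.
Qed.

Lemma spgradeM a a' b b' f (h : E) :
    f \in spgrade a b -> h \in spgrade a' b' ->
  f * h \in spgrade (fun t => a t + a' t)%N (fun t => b t + b' t)%N.
Proof.
move=> /spgradeP fP /spgradeP hP; rewrite (spmon_sum f) (spmon_sum h) mulr_suml.
apply: rpred_sum => S _; rewrite mulr_sumr; apply: rpred_sum => T _.
rewrite spmonM /spsgn; case: ifP => dST; last by rewrite mul0r spmon0 rpred0.
suff fhP : spmon (f S * h T) (S :|: T) \in
    spgrade (fun t => a t + a' t)%N (fun t => b t + b' t)%N.
  rewrite -signr_odd; case: odd; rewrite ?expr0 ?mul1r //.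
  by rewrite expr1 mulN1r spmonN rpredN.
apply/spgradeP => U mu; rewrite ffunE; case: (U =P _) => [->|_]; last first.
  by rewrite mcoeff0 eqxx.
rewrite -mcoeff_msupp => /msuppM_le /allpairsP[[mu1 mu2] /= [mu1P mu2P ->]].
rewrite !mcoeff_msupp in mu1P mu2P.
have /andP[/forallP a1 /forallP b1] := fP _ _ mu1P.
have /andP[/forallP a2 /forallP b2] := hP _ _ mu2P.
apply/andP; split; apply/forallP => t.
  rewrite -(eqP (a1 t)) -(eqP (a2 t)) -big_split; apply/eqP.
  by apply: eq_bigr => i _; rewrite mnmDE.
rewrite -(eqP (b1 t)) -(eqP (b2 t)) -big_split; apply/eqP.
apply: eq_bigr => i _ /=; rewrite inE.
have [Si|] := boolP (_ \in S) => //=.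
by rewrite (disjointFr dST Si).
Qed.

Lemma spgrade1 : 1 \in spgrade (fun=> 0%N) (fun=> 0%N).
Proof.
apply/spgradeP => S mu; rewrite ffunE; case: (S =P _) => [->|_]; last first.
  by rewrite mcoeff0 eqxx.
rewrite mcoeff1; case: (mu =P _) => [->|_]; last by rewrite eqxx.
move=> _; apply/andP; split; apply/forallP => t; apply/eqP.
  by rewrite big1 // => i _; rewrite mnm0E.
by rewrite big1 // => i _; rewrite inE.
Qed.

Lemma spgrade_prod (I : Type) (r : seq I) (F : I -> E)
    (a : I -> 'I_m -> nat) (b : I -> 'I_m' -> nat) :
    (forall i, F i \in spgrade (a i) (b i)) ->
  \prod_(i <- r) F i \in
    spgrade (fun t => \sum_(i <- r) a i t)%N (fun t => \sum_(i <- r) b i t)%N.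
Proof.
move=> FP; elim: r => [|i r IH].
  by rewrite big_nil (@eq_spgrade _ (fun=> 0%N) _ (fun=> 0%N)) ?spgrade1 // => t;
    rewrite big_nil.
rewrite big_cons (@eq_spgrade _ (fun t => a i t + \sum_(i <- r) a i t)%N
  _ (fun t => b i t + \sum_(i <- r) b i t)%N) ?spgradeM // => t;
  by rewrite big_cons.
Qed.

Lemma spgradeX i j :
  spX K (n * m') (mxvec_index i j) \in spgrade (fun t => (j == t) : nat) (fun=> 0%N).
Proof.
apply/spgradeP => S mu; rewrite ffunE; case: (S =P _) => [->|_]; last first.
  by rewrite mcoeff0 eqxx.
rewrite mcoeffX; case: (_ =P mu) => [<-|_]; last by rewrite eqxx.
move=> _; apply/andP; split; apply/forallP => t; apply/eqP; last first.
  by rewrite big1 // => l _; rewrite inE.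
have idxE l : (mxvec_index i j == mxvec_index l t) = (i == l) && (j == t).
  by rewrite mxvec_index_eq.
rewrite (bigD1 i) //= mnm1E idxE eqxx big1 ?addn0 // => l nli.
by rewrite mnm1E idxE eq_sym (negPf nli).
Qed.

Lemma spgradeTheta i j :
  spTheta K (n * m) (mxvec_index i j) \in
    spgrade (fun=> 0%N) (fun t => (j == t) : nat).
Proof.
apply/spgradeP => S mu; rewrite ffunE; case: (S =P _) => [->|_]; last first.
  by rewrite mcoeff0 eqxx.
rewrite mcoeff1; case: (mu =P _) => [->|_]; last by rewrite eqxx.
move=> _; apply/andP; split; apply/forallP => t; apply/eqP.
  by rewrite big1 // => l _; rewrite mnm0E.
have idxE l : (mxvec_index l t == mxvec_index i j) = (l == i) && (t == j).
  by rewrite mxvec_index_eq.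
rewrite (bigD1 i) //= inE idxE eqxx eq_sym big1 ?addn0 // => l nli.
by rewrite inE idxE (negPf nli).
Qed.

Lemma sp_act_grade g a b f :
  f \in spgrade a b -> sp_act g f \in spgrade a b.
Proof.
pose dx (p : 'I_(n * m)) t := (\sum_(i < n) (p == mxvec_index i t))%N.
pose dth (q : 'I_(n * m')) t := (\sum_(i < n) (q == mxvec_index i t))%N.
have dxE i j t : dx (mxvec_index i j) t = (j == t).
  rewrite /dx (bigD1 i) //= big1 => [|l /negPf nli];
    rewrite mxvec_index_eq ?eqxx ?addn0 //.
  by rewrite eq_sym nli.
have dthE i j t : dth (mxvec_index i j) t = (j == t).
  rewrite /dth (bigD1 i) //= big1 => [|l /negPf nli];
    rewrite mxvec_index_eq ?eqxx ?addn0 //.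
  by rewrite eq_sym nli.
have xP p : spC (n * m') (tnth (gl_x m g) p) \in spgrade (dx p) (fun=> 0%N).
  case/mxvec_indexP: p => i j; rewrite gl_xE linear_sum rpred_sum // => l _.
  rewrite linearZ rpredZ //= (@eq_spgrade _ (fun t => (j == t) : nat) _ (fun=> 0%N)) //.
  exact: spgradeX.
have thP q : gl_theta m g q \in spgrade (fun=> 0%N) (dth q).
  case/mxvec_indexP: q => i j; rewrite gl_thetaE rpred_sum // => l _.
  rewrite rpredZ //= (@eq_spgrade _ (fun=> 0%N) _ (fun t => (j == t) : nat)) //.
  exact: spgradeTheta.
move=> /spgradeP fP; apply: rpred_sum => S _.
rewrite comp_mpolyEX linear_sum mulr_suml big_seq; apply: rpred_sum => mu muP.
rewrite linearZ -scalerAl rpredZ //= comp_mpolyX rmorph_prod.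
rewrite mcoeff_msupp in muP.
have /andP[/forallP aP /forallP bP] := fP _ _ muP.
have := @spgradeM _ _ _ _ _ _
  (@spgrade_prod _ (index_enum 'I_(n * m)) _ _ _ (fun p => @spgrade_prod _
      (nseq (mu p) p) _ _ _ xP)) (@spgrade_prod _ (enum S) _ _ _ thP).
rewrite (@eq_spgrade _ a _ b) => [H|t|t].
- rewrite (_ : _ * _ = \prod_p \prod_(i <- nseq (mu p) p) spC (n * m') (tnth (gl_x m g) i) * \prod_(q <- enum S) gl_theta m g q) //; congr (_ * _); apply: eq_bigr => p _.
  by rewrite big_nseq -Monoid.iteropE rmorphXn.
- rewrite /= [X in (_ + X)%N]big1 ?addn0 //.
  rewrite -(eqP (aP t)); under eq_bigr do rewrite big_nseq iter_addn_0.
  under eq_bigr do rewrite big_distrl; rewrite exchange_big; apply: eq_bigr => i _.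
  rewrite (bigD1 (mxvec_index i t)) //= eqxx mul1n big1 ?addn0 // => p.
  by move=> /negPf->.
- rewrite /= [X in (X + _)%N]big1 ?add0n => [|p _]; last by rewrite big1.
  rewrite -(eqP (bP t)) exchange_big; apply: eq_bigr => i _ /=.
  rewrite big_enum /=; have [Si|nSi] := boolP (_ \in S).
    rewrite (bigD1 (mxvec_index i t)) //= eqxx big1 // => q /andP[_].
    by move/negPf->.
  by rewrite big1 // => q Sq; case: eqP Sq nSi => // -> ->.
Qed.

End Multidegree.
(* GL_n(K) is the set of g : 'M[K]_n with g \in unitmx; the values of an      *)
(* action at singular matrices are irrelevant.                                *)
Record glmod (K : numFieldType) (n : nat) := GLMod {
  glmod_car :> lmodType K;
  glact : 'M[K]_n -> glmod_car -> glmod_car;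
  glact_linear : forall g, g \in unitmx -> linear (glact g);
  glact1 : forall v, glact 1%:M v = v;
  glactM : forall g h, g \in unitmx -> h \in unitmx ->
    forall v, glact (g *m h) v = glact g (glact h v)
}.

Definition gl_iso (K : numFieldType) (n : nat) (V W : glmod K n) : Prop :=
  exists f : {linear V -> W}, bijective f /\
    forall g, g \in unitmx -> forall v, f (glact g v) = glact g (f v).

Section SuperpolyModule.
Variables (K : numFieldType) (n m m' : nat).
Variables (a : 'I_m -> nat) (b : 'I_m' -> nat).

Record sppiece := Sppiece {
  sppiece_val : superpoly K (n * m) (n * m');
  sppieceP : sppiece_val \in spgrade a b
}.

HB.instance Definition _ := [isSub for sppiece_val].
HB.instance Definition _ := [Choice of sppiece by <:].
HB.instance Definition _ := [SubChoice_isSubLmodule of sppiece by <:].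

Definition sppiece_act (g : 'M[K]_n) (v : sppiece) : sppiece :=
  Sppiece (sp_act_grade g (sppieceP v)).

Fact sppiece_act_linear g : linear (sppiece_act g).
Proof. by move=> c u v; apply/val_inj; rewrite /= linearP. Qed.

Fact sppiece_act1 v : sppiece_act 1%:M v = v.
Proof. by apply/val_inj/sp_act1. Qed.

Fact sppiece_actM g h v :
  sppiece_act (g *m h) v = sppiece_act g (sppiece_act h v).
Proof. exact/val_inj/sp_actM. Qed.

Definition sppiece_glmod : glmod K n :=
  GLMod (fun g _ => sppiece_act_linear g) sppiece_act1
    (fun g h _ _ => sppiece_actM g h).

End SuperpolyModule.

Definition dirsum (K : numFieldType) (I : finType) (V : I -> lmodType K) : Type :=
  {dffun forall i, V i}.

Section DirectSum.
Variables (K : numFieldType) (I : finType) (V : I -> lmodType K).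
Local Notation D := (dirsum V).

HB.instance Definition _ := Choice.copy (dirsum V) {dffun forall i, V i}.

Definition ds0 : D := [ffun i => 0].
Definition dsopp (u : D) : D := [ffun i => - u i].
Definition dsadd (u v : D) : D := [ffun i => u i + v i].
Definition dsscale (c : K) (u : D) : D := [ffun i => c *: u i].

Fact dsaddA : associative dsadd.
Proof. by move=> u v w; apply/ffunP => i; rewrite !ffunE addrA. Qed.
Fact dsaddC : commutative dsadd.
Proof. by move=> u v; apply/ffunP => i; rewrite !ffunE addrC. Qed.
Fact dsadd0 : left_id ds0 dsadd.
Proof. by move=> u; apply/ffunP => i; rewrite !ffunE add0r. Qed.
Fact dsaddN : left_inverse ds0 dsopp dsadd.
Proof. by move=> u; apply/ffunP => i; rewrite !ffunE addNr. Qed.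

HB.instance Definition _ := GRing.isZmodule.Build (dirsum V)
  dsaddA dsaddC dsadd0 dsaddN.

Fact dsscaleA c d u : dsscale c (dsscale d u) = dsscale (c * d) u.
Proof. by apply/ffunP => i; rewrite !ffunE scalerA. Qed.
Fact dsscale1 : left_id 1 dsscale.
Proof. by move=> u; apply/ffunP => i; rewrite ffunE scale1r. Qed.
Fact dsscaleDr : right_distributive dsscale +%R.
Proof. by move=> c u v; apply/ffunP => i; rewrite !ffunE scalerDr. Qed.
Fact dsscaleDl u : {morph dsscale^~ u : c d / c + d}.
Proof. by move=> c d; apply/ffunP => i; rewrite !ffunE scalerDl. Qed.

HB.instance Definition _ := GRing.Zmodule_isLmodule.Build K (dirsum V)
  dsscaleA dsscale1 dsscaleDr dsscaleDl.

End DirectSum.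

Section GLSum.
Variables (K : numFieldType) (n : nat) (I : finType) (V : I -> glmod K n).

Definition glsum_act (g : 'M[K]_n) (u : dirsum V) : dirsum V :=
  [ffun i => glact g (u i)].

Fact glsum_act_linear g : g \in unitmx -> linear (glsum_act g).
Proof.
by move=> gU c u v; apply/ffunP => i; rewrite !ffunE (glact_linear gU).
Qed.

Fact glsum_act1 u : glsum_act 1%:M u = u.
Proof. by apply/ffunP => i; rewrite ffunE glact1. Qed.

Fact glsum_actM g h : g \in unitmx -> h \in unitmx ->
  forall u, glsum_act (g *m h) u = glsum_act g (glsum_act h u).
Proof. by move=> gU hU u; apply/ffunP => i; rewrite !ffunE glactM. Qed.

Definition glsum : glmod K n := GLMod glsum_act_linear glsum_act1 glsum_actM.

End GLSum.

Record glrep (K : numFieldType) (n : nat) := GLRep {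
  glrep_car :> vectType K;
  glrep_act : 'M[K]_n -> 'End(glrep_car);
  glrep_act1 : glrep_act 1%:M = \1%VF;
  glrep_actM : forall g h, g \in unitmx -> h \in unitmx ->
    glrep_act (g *m h) = (glrep_act g \o glrep_act h)%VF
}.

Section GLRep.
Variables (K : numFieldType) (n : nat) (V : glrep K n).

Fact glrep_linear (g : 'M[K]_n) : g \in unitmx -> linear (glrep_act V g).
Proof. by move=> _ c u v; rewrite linearP. Qed.

Fact glrep_fun1 v : glrep_act V 1%:M v = v.
Proof. by rewrite glrep_act1 lfunE. Qed.

Fact glrep_funM g h : g \in unitmx -> h \in unitmx ->
  forall v, glrep_act V (g *m h) v = glrep_act V g (glrep_act V h v).
Proof. by move=> gU hU v; rewrite glrep_actM // lfunE. Qed.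

Definition glmod_of_glrep : glmod K n :=
  GLMod glrep_linear glrep_fun1 glrep_funM.

(* This is the transpose of the usual matrix: mxof acts on row vectors.      *)
Definition glrep_mx (g : 'M[K]_n) : 'M[K]_(\dim {:V}) :=
  passmx.mxof (vbasis {:V}) (vbasis {:V}) (glrep_act V g).

Definition gl_simple : Prop :=
  (0 < \dim {:V})%N /\
  forall U : {vspace V},
    (forall g, g \in unitmx -> (glrep_act V g @: U <= U)%VS) ->
    U = 0%VS \/ U = {:V}%VS.

Definition gl_polynomial : Prop :=
  exists P : 'I_(\dim {:V}) -> 'I_(\dim {:V}) -> {mpoly K[n * n]},
    forall g, g \in unitmx ->
      forall i j, glrep_mx g i j = (P i j).@[fun q => mxvec g 0 q].

(* The trace of diag(t_1, ..., t_n) is s(t_1, ..., t_n).                      *)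
Definition gl_character (s : {mpoly K[n]}) : Prop :=
  forall t : 'rV[K]_n, (forall i, t 0 i != 0) ->
    \tr (glrep_mx (diag_mx t)) = s.@[fun i => t 0 i].

End GLRep.

Coercion glmod_of_glrep : glrep >-> glmod.

Definition is_intpart (d : nat) (l : d.-bseq 'I_d.+1) : bool :=
  [&& sorted geq (map val l), 0%N \notin map val l & sumn (map val l) == d].

(* A partition of d has at most d parts, each at most d. *)
Definition intpart (d : nat) : finType := {l : d.-bseq 'I_d.+1 | is_intpart l}.

Definition parts (d : nat) (lam : intpart d) : seq nat := map val (val lam).

Lemma parts_inj (d : nat) : injective (@parts d).
Proof.
by move=> lam mu /(inj_map val_inj) eq_lm; apply/val_inj/val_inj.
Qed.

Lemma intpartP (d : nat) (s : seq nat) :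
  [&& sorted geq s, 0%N \notin s & sumn s == d] <->
  exists lam : intpart d, parts lam = s.
Proof.
split=> [/and3P[s_sorted s_pos /eqP s_sum]|[[l lP] <-]]; last exact: lP.
have s_le i : i \in s -> (i < d.+1)%N.
  by move=> si; rewrite ltnS -s_sum sumnE (big_rem i) //= leq_addr.
have s_size : (size (map (@inord d) s) <= d)%N.
  rewrite size_map -s_sum sumnE -sum1_size big_seq [leqRHS]big_seq.
  by apply: leq_sum => i si; rewrite lt0n; apply: contraNneq s_pos => <-.
have lE : map val (Bseq s_size) = s.
  rewrite /= -map_comp -[RHS]map_id; apply/eq_in_map => i si /=.
  by rewrite inordK // s_le.
have lP : is_intpart (Bseq s_size).
  by rewrite /is_intpart lE s_sorted s_pos s_sum eqxx.
by exists (exist (fun l => is_true (is_intpart l)) _ lP).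
Qed.

(* Box (i, j) is in row i, column j; in French convention row 0 is the        *)
(* bottom row.                                                                *)
Definition box (sh : seq nat) : finType :=
  {i : 'I_(size sh) & 'I_(nth 0%N sh i)}.

Definition brow (sh : seq nat) (x : box sh) : nat := tag x.
Definition bcol (sh : seq nat) (x : box sh) : nat := tagged x.

Definition ssyt (sh : seq nat) (n : nat) : {set {ffun box sh -> 'I_n}} :=
  [set T : {ffun box sh -> 'I_n} |
    [forall x, forall y,
       ((brow x == brow y) && (bcol x < bcol y)%N ==> (T x <= T y)%N) &&
       ((bcol x == bcol y) && (brow x < brow y)%N ==> (T x < T y)%N)]].

Definition schur (K : numFieldType) (n : nat) (sh : seq nat) : {mpoly K[n]} :=
  \sum_(T in ssyt sh n) \prod_(x : box sh) 'X_(T x).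

Definition is_GL_lambda (K : numFieldType) (n : nat) (sh : seq nat)
    (V : glrep K n) : Prop :=
  [/\ gl_polynomial V, gl_simple V & gl_character V (schur K n sh)].

(* The symbols 1 < ... < m < \bar 1 < ... < \bar m': inl i is the unbarred    *)
(* symbol i and inr j the barred symbol j.                                    *)
Definition letter (m m' : nat) : finType := ('I_m + 'I_m')%type.

Definition le_letter (m m' : nat) (u v : letter m m') : bool :=
  match u, v with
  | inl i, inl j => (i <= j)%N
  | inl _, inr _ => true
  | inr _, inl _ => false
  | inr i, inr j => (i <= j)%N
  end.

Definition barred (m m' : nat) (u : letter m m') : bool :=
  if u is inr _ then true else false.

Definition SSMT' (sh : seq nat) (m m' : nat) (a : 'I_m -> nat)
    (b : 'I_m' -> nat) : {set {ffun box sh -> letter m m'}} :=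
  [set T : {ffun box sh -> letter m m'} |
    [&& [forall x, forall y,
           (brow x == brow y) && (bcol x < bcol y)%N ==>
             le_letter (T x) (T y) && ~~ (barred (T x) && (T x == T y))],
        [forall x, forall y,
           (bcol x == bcol y) && (brow x < brow y)%N ==>
             le_letter (T x) (T y) && ~~ (~~ barred (T x) && (T x == T y))],
        [forall i, #|[set x | T x == inl i]| == a i] &
        [forall j, #|[set x | T x == inr j]| == b j]]].

(* Main.v *)
(* The graded piece is the image of a tensor space (C^n)^(tensor d) summed    *)
(* over column labels, on which the adjoint g^# of a matrix g acts as the     *)
(* adjoint of g; it is therefore isomorphic to a representation rho by        *)
(* matrices with rho(g^#) = rho(g)^#. For such a rho, equality of tr rho with *)
(* a sum of traces of simple representations S_i already gives that rho is    *)
(* the direct sum of the S_i: an element a of the group algebra killing all   *)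
(* S_i satisfies tr rho(a a^#) = 0, hence rho(a) = 0; by a density argument   *)
(* every simple submodule of rho is then one of the S_i, and one splits it    *)
(* off with its orthogonal complement.                                        *)
(*                                                                            *)
(* Both traces are polynomial class functions, so they need only be compared  *)
(* on the torus (triangularize, then perturb the eigenvalues). There the      *)
(* piece has trace prod_t h_(a_t) prod_t e_(b_t), and reading a tableau of    *)
(* SSMT' as a chain of partitions growing by horizontal strips (unbarred      *)
(* letters), then by vertical strips (barred letters), the Pieri rules give   *)
(* prod h prod e = sum_lambda |SSMT'(lambda, a, b)| s_lambda. A Pieri rule is *)
(* proved by induction on the number of variables: the branching rule of      *)
(* Schur polynomials reduces it to a count of the partitions above,           *)
(* respectively below, two given partitions.                                  *)

Require Import Defs.
From HB Require Import structures.
From mathcomp Require Import all_boot all_order all_algebra.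
From mathcomp Require Import mpoly spectral zify ring.
From mathcomp Require boolp.
From mathcomp Require Import reals complex.

Set Implicit Arguments.
Unset Strict Implicit.
Unset Printing Implicit Defensive.

Import Order.TTheory GRing.Theory Num.Theory.

(** * Strips of partitions and the Pieri rules *)

(** The two modules are compared through their traces. A representation whose trace is a sum of
    traces of simple representations is isomorphic to their direct sum as soon as it is closed under
    adjoints, that is, as soon as the adjoint of g acts by the adjoint matrix; this is
    [starrep_decomposition]. Adjoints supply complete reducibility: the orthogonal complement of an
    invariant subspace is invariant, and A = 0 as soon as A times its adjoint has trace 0. The group
    algebra and the density argument of [density_step] then identify a minimal submodule with one of
    the given simple ones.

    The graded piece acquires such a structure from tensor space. Words of length r + s in the
    variables span a tensor power on which adjoints act as adjoints ([tensor_rep_star]); multiplying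
    out a word is equivariant ([tensor_valM]) and reaches every superpolynomial of the given
    multidegree ([tensor_val_onto]); [starrep_quotient] realizes the image on the orthogonal
    complement of the kernel.

    It remains to compare traces. Both are class functions that are polynomial along lines, so by
    [class_fun_unit_eq0] the torus suffices. There monomials are eigenvectors, and each column of
    variables contributes a complete polynomial h or an elementary polynomial e ([sum_expo_weight]).
    The product of these is expanded in Schur polynomials by [sum_SSMT'_schur]: a tableau is a chain
    of partitions with one strip per letter ([tableau_transfer]), and each letter is one application
    of [pieri]. The Pieri rules rest on the local counts [local_hstrip] and [local_vstrip], which
    exchange going up along a strip with going down along one. *)

Lemma big_bij (R : Type) (idx : R) (op : Monoid.com_law idx) (I J : finType)
    (P : pred I) (Q : pred J) (h : I -> J) (h' : J -> I) (F : J -> R) :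
    (forall i, P i -> Q (h i)) -> (forall j, Q j -> P (h' j)) ->
    (forall i, P i -> h' (h i) = i) -> (forall j, Q j -> h (h' j) = j) ->
  \big[op/idx]_(j | Q j) F j = \big[op/idx]_(i | P i) F (h i).
Proof.
move=> PQ QP hK h'K; rewrite (reindex_onto h h') //; apply: eq_bigl => i.
apply/andP/idP => [[Qh /eqP <-]|Pi]; first exact: QP.
by rewrite PQ // hK.
Qed.

Section Shapes.
Variables (L B : nat).
Local Notation shape := {ffun 'I_L -> 'I_B.+1}.
Implicit Types (kap lam mu nu rho : shape).

(* Row lengths, extended by 0 to all natural indices. *)
Definition srow lam (i : nat) : nat := oapp (fun j : 'I_L => lam j : nat) 0 (insub i).

(** [inord] turns a value above [B] into 0, so the uses below come with a bound on [f]. *)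
Definition mkshape (f : nat -> nat) : shape := [ffun i : 'I_L => inord (f i)].

Definition ssize lam : nat := \sum_(i < L) srow lam i.

Definition shape0 : shape := [ffun=> ord0].

Lemma srow_ord lam (i : 'I_L) : srow lam i = lam i.
Proof. by rewrite /srow valK. Qed.

Lemma srow_out lam i : L <= i -> srow lam i = 0.
Proof. by move=> Li; rewrite /srow insubF // ltnNge Li. Qed.

Lemma srow_le lam i : srow lam i <= B.
Proof.
have [iL|/srow_out-> //] := ltnP i L.
by have /= -> := srow_ord lam (Ordinal iL); rewrite -ltnS.
Qed.

Lemma srow_inj lam mu : (forall i, i < L -> srow lam i = srow mu i) -> lam = mu.
Proof. by move=> E; apply/ffunP => i; apply/val_inj; rewrite /= -!srow_ord E. Qed.

Lemma srow_mk f i : i < L -> f i <= B -> srow (mkshape f) i = f i.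
Proof.
by move=> iL fB; have := srow_ord (mkshape f) (Ordinal iL); rewrite ffunE inordK.
Qed.

Lemma srow0 i : srow shape0 i = 0.
Proof.
have [iL|/srow_out-> //] := ltnP i L.
by have /= -> := srow_ord shape0 (Ordinal iL); rewrite ffunE.
Qed.

Lemma ssize0 : ssize shape0 = 0.
Proof. by rewrite /ssize big1 // => i _; rewrite srow0. Qed.

Lemma srow_le_size lam i : srow lam i <= ssize lam.
Proof.
have [iL|/srow_out-> //] := ltnP i L.
by rewrite /ssize (bigD1 (Ordinal iL)) //= leq_addr.
Qed.

Lemma ssize_eq0 lam : (ssize lam == 0) = (lam == shape0).
Proof.
apply/idP/eqP => [/eqP l0|->]; last by rewrite ssize0.
apply: srow_inj => i _; rewrite srow0; apply/eqP.
by rewrite -leqn0 -l0 srow_le_size.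
Qed.

Definition hstrip mu lam : bool :=
  [forall i : 'I_L, (srow lam i.+1 <= srow mu i) && (srow mu i <= srow lam i)].

Definition vstrip mu lam : bool :=
  [forall i : 'I_L, [&& srow mu i <= srow lam i, srow lam i <= (srow mu i).+1,
    srow mu i.+1 <= srow mu i & srow lam i.+1 <= srow lam i]].

Definition strip (b : bool) := if b then vstrip else hstrip.

Lemma hstripP mu lam :
  reflect (forall i, srow lam i.+1 <= srow mu i <= srow lam i) (hstrip mu lam).
Proof.
apply: (iffP forallP) => H i; last exact: H.
have [iL|Li] := ltnP i L; first exact: (H (Ordinal iL)).
by rewrite !srow_out // ltnW.
Qed.

Lemma vstripP mu lam :
  reflect (forall i, [/\ srow mu i <= srow lam i, srow lam i <= (srow mu i).+1,
    srow mu i.+1 <= srow mu i & srow lam i.+1 <= srow lam i]) (vstrip mu lam).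
Proof.
apply: (iffP forallP) => H i; last by apply/and4P.
have [iL|Li] := ltnP i L; first exact/and4P/(H (Ordinal iL)).
by rewrite !srow_out // ltnW.
Qed.

Lemma strip_le b mu lam i : strip b mu lam -> srow mu i <= srow lam i.
Proof. by case: b => [/vstripP/(_ i)[]|/hstripP/(_ i)/andP[]]. Qed.

Lemma strip_size b mu lam : strip b mu lam -> ssize mu <= ssize lam.
Proof. by move=> H; apply: leq_sum => i _; apply: strip_le H. Qed.

End Shapes.

(** * Partitions above and below two given ones: horizontal strips *)

Section LocalH.
Variables (L' B : nat).
Local Notation L := L'.+1.
Local Notation shape := {ffun 'I_L -> 'I_B.+1}.
Variables (lam nu : shape) (k : nat).
Hypotheses (nuL : srow nu L' = 0) (lamB : ssize lam + k <= B).

Let mx i := maxn (srow lam i) (srow nu i).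
Let mn i := minn (srow lam i) (srow nu i).

Let A (kap : shape) := [&& hstrip lam kap, hstrip nu kap & ssize kap == ssize lam + k].
Let D (rho : shape) := [&& hstrip rho lam, hstrip rho nu & ssize nu <= ssize rho + k].

Let fk (rho : shape) : nat -> nat := fun i =>
  if i is i'.+1 then mx i + mn i' - srow rho i' else mx 0 + (ssize rho + k - ssize nu).
Let fr (kap : shape) : nat -> nat := fun i => mx i.+1 + mn i - srow kap i.+1.

Let mxE i : mx i + mn i = srow lam i + srow nu i.
Proof. by rewrite /mx /mn; lia. Qed.

Let sum_mx : mx 0 + \sum_(i < L') mx i.+1 + \sum_(i < L') mn i = ssize lam + ssize nu.
Proof.
have -> : mx 0 + \sum_(i < L') mx i.+1 = \sum_(i < L) mx i by rewrite big_ord_recl.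
have -> : \sum_(i < L') mn i = \sum_(i < L) mn i.
  by rewrite big_ord_recr /= [mn L']/mn nuL minn0 addn0.
by rewrite /ssize -!big_split; apply: eq_bigr => i _; apply: mxE.
Qed.

Let A_bounds kap : A kap -> forall i, mx i.+1 <= srow kap i.+1 <= mn i.
Proof.
move=> /and3P[/hstripP H1 /hstripP H2 _] i.
have := H1 i; have := H2 i; have := H1 i.+1; have := H2 i.+1.
by rewrite /mx /mn; lia.
Qed.

Let D_bounds rho : D rho -> forall i, mx i.+1 <= srow rho i <= mn i.
Proof.
by move=> /and3P[/hstripP H1 /hstripP H2 _] i; have := H1 i; have := H2 i; rewrite /mx /mn; lia.
Qed.

Let fr_le kap i : A kap -> fr kap i <= B.
Proof.
move=> /A_bounds/(_ i); rewrite /fr => H.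
by apply: leq_trans (srow_le lam i); move: H; rewrite /mn; lia.
Qed.

Let sizeD rho : D rho -> fk rho 0 + \sum_(i < L') fk rho i.+1 = ssize lam + k.
Proof.
move=> Drho; have := D_bounds Drho => bd; have /and3P[_ _ le_nu] := Drho.
(* [nuL] collapses the interval of the last row of [rho], the only one that has no row of [kap] as
   its partner. *)
have rL : srow rho L' = 0 by have := bd L'; rewrite /mn nuL; lia.
have rhoE : ssize rho = \sum_(i < L') srow rho i.
  by rewrite /ssize big_ord_recr /= rL addn0.
have E : \sum_(i < L') fk rho i.+1 + ssize rho = \sum_(i < L') mx i.+1 + \sum_(i < L') mn i.
  rewrite rhoE -!big_split; apply: eq_bigr => i _ /=; have := bd i; lia.
by rewrite /= ; move: sum_mx E le_nu; rewrite /=; lia.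
Qed.

Let fk_le rho i : D rho -> i < L -> fk rho i <= B.
Proof.
move=> Drho; have := sizeD Drho; case: i => [|i] E iL.
  by apply: leq_trans lamB; rewrite -E leq_addr.
apply: leq_trans lamB; rewrite -E (bigD1 (Ordinal (iL : i < L'))) //=; lia.
Qed.

Let frE kap i : A kap -> srow (mkshape L B (fr kap)) i = fr kap i.
Proof.
move=> Ak; have [iL|Li] := ltnP i L; first by rewrite srow_mk // fr_le.
by rewrite srow_out // /fr /mx /mn !srow_out // ltnW // ltnW.
Qed.

Let fkE rho i : D rho -> i < L -> srow (mkshape L B (fk rho)) i = fk rho i.
Proof. by move=> Dr iL; rewrite srow_mk // fk_le. Qed.

Let sizeE (kap : shape) : ssize kap = srow kap 0 + \sum_(i < L') srow kap i.+1.
Proof. by rewrite /ssize big_ord_recl. Qed.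

Let D_to_A rho : D rho -> A (mkshape L B (fk rho)).
Proof.
move=> Dr; have bd := D_bounds Dr; have /and3P[_ _ le_nu] := Dr; apply/and3P; split.
+ apply/hstripP => i; have [iL|Li] := ltnP i L; last by rewrite !srow_out // ltnW.
  apply/andP; split.
    have [iL1|Li] := ltnP i.+1 L; last by rewrite srow_out.
    by rewrite fkE //=; have := bd i; rewrite /mx /mn; lia.
  rewrite fkE //; case: i iL => [|i] iL /=; first by rewrite /mx; lia.
  by have := bd i; rewrite /mx /mn; lia.
+ apply/hstripP => i; have [iL|Li] := ltnP i L; last by rewrite !srow_out // ltnW.
  apply/andP; split.
    have [iL1|Li] := ltnP i.+1 L; last by rewrite srow_out.
    by rewrite fkE //=; have := bd i; rewrite /mx /mn; lia.
  rewrite fkE //; case: i iL => [|i] iL /=; first by rewrite /mx; lia.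
  by have := bd i; rewrite /mx /mn; lia.
+ rewrite -(sizeD Dr) sizeE fkE //; apply/eqP; congr (_ + _).
  by apply: eq_bigr => i _; rewrite fkE // ltnS ltn_ord.
Qed.

Let A_to_D kap : A kap -> D (mkshape L B (fr kap)).
Proof.
move=> Ak; have bd := A_bounds Ak; have /and3P[/hstripP H1 /hstripP H2 /eqP sk] := Ak.
apply/and3P; split.
+ by apply/hstripP => i; rewrite frE //; have := bd i; rewrite /fr /mx /mn; lia.
+ by apply/hstripP => i; rewrite frE //; have := bd i; rewrite /fr /mx /mn; lia.
+ have frL : fr kap L' = 0.
    by rewrite /fr /mx /mn !(srow_out _ (leqnn L)) nuL minn0.
  have E : ssize (mkshape L B (fr kap)) + \sum_(i < L') srow kap i.+1 =
      \sum_(i < L') mx i.+1 + \sum_(i < L') mn i.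
    rewrite /ssize big_ord_recr /= frE // frL addn0 -!big_split.
    by apply: eq_bigr => i _ /=; rewrite frE //; have := bd i; rewrite /fr; lia.
  have m0 : mx 0 <= srow kap 0 by have := H1 0; have := H2 0; rewrite /mx; lia.
  by have := sum_mx; have := sizeE kap; lia.
Qed.

(* kap and rho have the same interval [mx i.+1, mn i] available for row i.+1  *)
(* of kap and row i of rho; reflecting it gives the bijection, and the first  *)
(* row of kap is fixed by its size.                                           *)
Lemma local_hstrip : \sum_(kap | A kap) 1 = \sum_(rho | D rho) 1.
Proof.
apply: (@big_bij _ _ _ _ _ D A (fun rho => mkshape L B (fk rho))
  (fun kap => mkshape L B (fr kap)) (fun=> 1)) => // [rho Dr|kap Ak].
- apply: srow_inj => i iL; have bd := D_bounds Dr.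
  rewrite frE ?D_to_A // /fr.
  have [iL1|Li] := ltnP i.+1 L; first by rewrite fkE //=; have := bd i; lia.
  have E : i = L' by lia.
  have -> : srow rho i = 0 by have := bd i; rewrite E /mn nuL; lia.
  by rewrite srow_out // /mx /mn !(srow_out _ Li) E nuL; lia.
- apply: srow_inj => i iL; have bd := A_bounds Ak.
  have Dr := A_to_D Ak; rewrite fkE //.
  have fkS i' : fk (mkshape L B (fr kap)) i'.+1 = srow kap i'.+1.
    by rewrite /= frE // /fr; have := bd i'; lia.
  case: i iL => // _; have := sizeD Dr; under eq_bigr do rewrite fkS.
  have /and3P[_ _ /eqP <-] := Ak; rewrite [X in _ = X -> _]sizeE.
  exact: addIn.
Qed.

End LocalH.

(** * Partitions above and below two given ones: vertical against horizontal strips *)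

Section BoolCount.
Local Open Scope ring_scope.
Variables (L : nat).
Implicit Type g : nat -> bool -> bool.

(** Generating polynomial of a single row: X marks a box added to or removed from it, and [g i]
    tells which of the two choices are allowed. *)
Definition bool_factor g i : {poly int} := (g i false)%:R + (g i true)%:R * 'X.

Lemma coef_prod_bool g k :
  (\prod_(i < L) bool_factor g i)`_k =
  (\sum_(c : {ffun 'I_L -> bool} | [forall i : 'I_L, g i (c i)] && (\sum_(i < L) c i == k)%N)
    1)%N%:R.
Proof.
rewrite (eq_bigr (fun i : 'I_L => \sum_(c : bool) (g i c)%:R * 'X^c)); last first.
  by move=> i _; rewrite big_bool /= expr1 expr0 mulr1 addrC.
rewrite bigA_distr_bigA coef_sum natr_sum [RHS]big_mkcond; apply: eq_bigr => c _ /=.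
rewrite big_split /= -expr_sum (_ : \prod_i _ = ([forall i : 'I_L, g i (c i)])%:R :> {poly int}).
  rewrite mulr_natl coefMn coefXn eq_sym; case: forallP => _ /=; last by rewrite mulr0n.
  by case: (_ == k).
have [H|] := boolP [forall i : 'I_L, g i (c i)].
  by rewrite big1 // => i _; rewrite (forallP H).
by rewrite negb_forall => /existsP[i /negPf H]; rewrite (bigD1 i) //= H mul0r.
Qed.
End BoolCount.

Section LocalV.
Variables (L' B : nat).
Local Notation L := L'.+1.
Local Notation shape := {ffun 'I_L -> 'I_B.+1}.
Variables (lam nu : shape) (k : nat).
Hypotheses (nuL : srow nu L' = 0) (lamB : ssize lam + k <= B).

Let A (kap : shape) := [&& vstrip lam kap, hstrip nu kap & ssize kap == ssize lam + k].
Let D j (rho : shape) := [&& hstrip rho lam, vstrip rho nu & ssize nu == ssize rho + j].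

Section Parts.
Hypotheses (lam_part : forall i, srow lam i.+1 <= srow lam i)
  (nu_part : forall i, srow nu i.+1 <= srow nu i).

(** With kap_i = lam_i + c_i, the condition [hstrip nu kap] says [a i c_i] and [s i c_i] for all i;
    with rho_i = nu_i - c_i, the condition [hstrip rho lam] says [a i c_i] and [s i.+1 c_i]. *)
Let a i (c : bool) := srow nu i <= srow lam i + c.
Let s i (c : bool) := if i is i'.+1 then srow lam i + c <= srow nu i' else true.

(* Adding vertical strips is a transfer-matrix product over the rows: moving  *)
(* one factor of s past a row turns the weight of kap into that of rho.       *)
Let factor_step i :
  (bool_factor (fun i c => a i c && s i c) i * bool_factor s i.+1 =
   bool_factor s i * bool_factor (fun i c => s i.+1 c && a i c) i)%R.
Proof.
rewrite /bool_factor.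
have a01 : a i false -> a i true by rewrite /a; lia.
have s01 : s i true -> s i false by rewrite /s; case: i {a01} => // i; lia.
have t01 : s i.+1 true -> s i.+1 false by rewrite /s; lia.
(* The one case where [lam] and [nu] have to be partitions: here nu_i = lam_i + 1, and both sides
   become X (1 + X). *)
have st : ~~ a i false -> a i true -> [/\ s i true, s i false, s i.+1 true & s i.+1 false].
  have := lam_part i; rewrite /a /s; case: i {a01 s01 t01} => [|i]; last have := nu_part i.
    by move=> *; split => //; lia.
  by move=> *; split; lia.
move: (a i false) (a i true) (s i false) (s i true) (s i.+1 false) (s i.+1 true) a01 s01 t01 st.
do 6!case; move=> a01 s01 t01 st /=;
  try (by have := a01 isT); try (by have := s01 isT); try (by have := t01 isT);
  try (by case: (st isT isT)); ring.
Qed.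

Let prod_step m :
  (\prod_(i < m) bool_factor (fun i c => a i c && s i c) i * bool_factor s m =
   (1 + 'X) * \prod_(i < m) bool_factor (fun i c => s i.+1 c && a i c) i)%R.
Proof.
elim: m => [|m IH]; first by rewrite !big_ord0 mul1r mulr1 /bool_factor /= mul1r.
by rewrite !big_ord_recr /= -mulrA factor_step mulrA IH mulrA.
Qed.

(** Nothing bounds row 0 from above, so its factor of [s] is 1 + X, whereas [nuL] turns the factor
    at [L] into 1. The two terms of 1 + X are the two terms on the right. *)
Let count_step :
  \sum_(c : {ffun 'I_L -> bool} | [forall i : 'I_L, a i (c i) && s i (c i)] && (\sum_(i < L) c i
    == k)) 1 =
  \sum_(c : {ffun 'I_L -> bool} | [forall i : 'I_L, s i.+1 (c i) && a i (c i)] && (\sum_(i < L)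
    c i == k)) 1 +
  (if k is k'.+1 then \sum_(c : {ffun 'I_L -> bool} | [forall i : 'I_L, s i.+1 (c i) && a i (c
    i)] && (\sum_(i < L) c i == k')) 1 else 0).
Proof.
have sL : bool_factor s L = 1%R.
  rewrite /bool_factor /s nuL !(srow_out _ (leqnn L)) /=; ring.
have := prod_step L; rewrite sL mulr1 => /(congr1 (fun p : {poly int} => p`_k))%R.
rewrite mulrDl mul1r coefD mulrC coefMX (coef_prod_bool _ (fun i c => a i c && s i c)).
rewrite !(coef_prod_bool _ (fun i c => s i.+1 c && a i c)).
by case: k => [|k'] /=; rewrite -?natrD => /eqP; rewrite ?addr0 eqr_nat => /eqP->; rewrite ?addn0.
Qed.

Let count_A : \sum_(kap | A kap) 1 =
  \sum_(c : {ffun 'I_L -> bool} | [forall i : 'I_L, a i (c i) && s i (c i)] && (\sum_(i < L) c i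
    == k)) 1.
Proof.
pose cn (c : {ffun 'I_L -> bool}) i : nat := oapp (fun j : 'I_L => c j : nat) 0 (insub i).
have cnE c (i : 'I_L) : cn c i = c i by rewrite /cn valK.
have cn1 c i : cn c i <= 1 by rewrite /cn; case: insub => //= j; case: (c j).
pose h c : shape := mkshape L B (fun i => srow lam i + cn c i).
have hE (c : {ffun 'I_L -> bool}) : [forall i : 'I_L, a i (c i) && s i (c i)] && (\sum_(i < L) c
  i == k) ->
    forall i, srow (h c) i = srow lam i + cn c i.
  case/andP => _ /eqP ck i; have [iL|Li] := ltnP i L; last first.
    by rewrite !srow_out // /cn insubF // ltnNge Li.
  rewrite srow_mk // (leq_trans _ lamB) // leq_add ?srow_le_size // -ck.
  by rewrite (bigD1 (Ordinal iL)) //= -(cnE c (Ordinal iL)) leq_addr.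
apply: (@big_bij _ _ _ _ _ (fun c : {ffun 'I_L -> bool} => [forall i : 'I_L, a i (c i) && s i (c
  i)] && (\sum_(i < L) c i == k)) A
  h (fun kap => [ffun i : 'I_L => srow lam i < srow kap i]) (fun=> 1)) => [c Pc|kap Ak|c Pc|kap
    Ak].
- have hc := hE _ Pc; case/andP: Pc => /forallP Pc /eqP ck.
  have bd i : srow nu i <= srow lam i + cn c i /\ (if i is i'.+1 then srow lam i + cn c i <=
    srow nu i' else true).
    have [iL|Li] := ltnP i L.
      by have := Pc (Ordinal iL); rewrite /a /s -cnE /= => /andP[-> ]; case: i iL.
    have -> : cn c i = 0 by rewrite /cn insubF // ltnNge Li.
    by split; [|case: i Li => // i Li]; rewrite !(srow_out _ Li).
  apply/and3P; split.
  + apply/vstripP => i; rewrite !hc; have := cn1 c i; have [b1 _] := bd i;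
    have [b2 b3] := bd i.+1.
    have := lam_part i; split; lia.
  + by apply/hstripP => i; rewrite !hc; have [b1 _] := bd i; have [b2 b3] := bd i.+1; lia.
  + rewrite -ck /ssize -big_split; apply/eqP; apply: eq_bigr => i _ /=.
    by rewrite hc cnE.
- have /and3P[/vstripP H1 /hstripP H2 /eqP sk] := Ak.
  have cE i : nat_of_bool (srow lam i < srow kap i) + srow lam i = srow kap i.
    by have [] := H1 i; lia.
  apply/andP; split.
    apply/forallP => i; rewrite ffunE /a /s addnC cE.
    have := H2 i => /andP[_ ->] /=; case: i => [[|i] iL] //=.
    by have /andP[] := H2 i.
  apply/eqP/(@addnI (ssize lam)); rewrite -sk /ssize -big_split.
  by apply: eq_bigr => i _ /=; rewrite ffunE addnC cE.
- apply/ffunP => i; rewrite ffunE hE // -addn1 leq_add2l cnE; by case: (c i).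
- have /and3P[/vstripP H1 /hstripP H2 /eqP sk] := Ak.
  apply: srow_inj => i iL; have [] := H1 i => *.
  rewrite srow_mk // /cn insubT /= ffunE /=; first lia.
  by apply: leq_trans (srow_le kap i); lia.
Qed.

Let count_D j : \sum_(rho | D j rho) 1 =
  \sum_(c : {ffun 'I_L -> bool} | [forall i : 'I_L, s i.+1 (c i) && a i (c i)] && (\sum_(i < L)
    c i == j)) 1.
Proof.
pose cn (c : {ffun 'I_L -> bool}) i : nat := oapp (fun j : 'I_L => c j : nat) 0 (insub i).
have cnE c (i : 'I_L) : cn c i = c i by rewrite /cn valK.
have cn1 c i : cn c i <= 1 by rewrite /cn; case: insub => //= l; case: (c l).
pose h c : shape := mkshape L B (fun i => srow nu i - cn c i).
have hE c i : srow (h c) i = srow nu i - cn c i.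
  have [iL|Li] := ltnP i L; last by rewrite !srow_out.
  by rewrite srow_mk // (leq_trans (leq_subr _ _)) ?srow_le.
apply: (@big_bij _ _ _ _ _ (fun c : {ffun 'I_L -> bool} => [forall i : 'I_L, s i.+1 (c i) && a i
  (c i)] && (\sum_(i < L) c i == j)) (D j)
  h (fun rho => [ffun i : 'I_L => srow rho i < srow nu i]) (fun=> 1)) => [c Pc|rho Dr|c Pc|rho
    Dr].
- case/andP: Pc => /forallP Pc /eqP ck.
  have bd i : srow lam i.+1 + cn c i <= srow nu i /\ srow nu i <= srow lam i + cn c i.
    have [iL|Li] := ltnP i L.
      by have := Pc (Ordinal iL); rewrite /a /s -cnE /= => /andP[-> ].
    have -> : cn c i = 0 by rewrite /cn insubF // ltnNge Li.
    by rewrite !srow_out // ltnW.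
  apply/and3P; split.
  + by apply/hstripP => i; rewrite !hE; have [b1 b2] := bd i; lia.
  + apply/vstripP => i; rewrite !hE; have := cn1 c i; have [b1 b0] := bd i;
    have [b2 b3] := bd i.+1.
    have := nu_part i; split; lia.
  + rewrite -ck /ssize -big_split; apply/eqP; apply: eq_bigr => i _ /=.
    by rewrite hE -cnE; have [] := bd i; lia.
- have /and3P[/hstripP H1 /vstripP H2 /eqP sk] := Dr.
  have cE i : nat_of_bool (srow rho i < srow nu i) + srow rho i = srow nu i.
    by have [] := H2 i; lia.
  apply/andP; split.
    apply/forallP => i; rewrite ffunE /a /s; have := cE i; have := H1 i; lia.
  apply/eqP/(@addnI (ssize rho)); rewrite -sk /ssize -big_split.
  by apply: eq_bigr => i _ /=; rewrite ffunE addnC cE.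
- case/andP: Pc => /forallP Pc _; apply/ffunP => i; rewrite ffunE hE cnE.
  by have := Pc i; rewrite /s; case: (c i) => /=; lia.
- have /and3P[/hstripP H1 /vstripP H2 /eqP sk] := Dr.
  apply: srow_inj => i iL; have [] := H2 i => *.
  by rewrite hE /cn insubT /= ffunE /=; lia.
Qed.

Lemma local_vstrip_part : \sum_(kap | A kap) 1 = \sum_(rho | D k rho) 1 +
  (if k is k'.+1 then \sum_(rho | D k' rho) 1 else 0).
Proof. by rewrite count_A count_step count_D; case: k => // k'; rewrite count_D. Qed.
End Parts.

(** If [lam] or [nu] is not a partition, no strip starts or ends there, and both sides are 0. *)
Lemma local_vstrip : \sum_(kap | A kap) 1 = \sum_(rho | D k rho) 1 +
  (if k is k'.+1 then \sum_(rho | D k' rho) 1 else 0).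
Proof.
have [/andP[/forallP lamP /forallP nuP]|nP] := boolP ([forall i : 'I_L, srow lam i.+1 <= srow
  lam i] &&
    [forall i : 'I_L, srow nu i.+1 <= srow nu i]).
  have ext (mu : shape) : (forall i : 'I_L, srow mu i.+1 <= srow mu i) -> forall i, srow mu i.+1
    <= srow mu i.
    move=> H i; have [iL|Li] := ltnP i L; first exact: (H (Ordinal iL)).
    by rewrite srow_out // ltnW.
  by apply: local_vstrip_part; apply: ext.
have nP' : (forall i, srow lam i.+1 <= srow lam i) -> (forall i, srow nu i.+1 <= srow nu i) ->
  False.
  by move=> H1 H2; case/negP: nP; apply/andP; split; apply/forallP.
have D0 j : \sum_(rho | D j rho) 1 = 0.
  rewrite big_pred0 // => rho; apply/negP => /and3P[/hstripP H1 /vstripP H2 _].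
  by apply: nP' => i; [have := H1 i; lia | case: (H2 i)].
have -> : (if k is k'.+1 then \sum_(rho | D k' rho) 1 else 0) = 0 by case: k => // k'; apply: D0.
rewrite D0 big_pred0 // => kap; apply/negP => /and3P[/vstripP H1 /hstripP H2 _].
apply: nP' => i; first by case: (H1 i).
by have := H2 i; have := H2 i.+1; lia.
Qed.
End LocalV.

Section LocalStrip.
Variables (L' B : nat).
Local Notation L := L'.+1.
Local Notation shape := {ffun 'I_L -> 'I_B.+1}.

(** Highest exponent allowed for one variable: 1 in an elementary polynomial, and [B] in a complete
    one, where it is no restriction since the degrees in use are at most [B]. *)
Definition strip_bound (b : bool) := if b then 1 else B.

(** Common form of both local counts, with [e] the future exponent of the last variable in e_k or
    h_k. For horizontal strips the sizes of [rho] and [nu] determine [e], so the inequality between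
    sizes becomes a sum of equalities. *)
Lemma local_strip b (lam nu : shape) k :
    srow nu L' = 0 -> ssize lam + k <= B ->
  \sum_(kap | [&& strip b lam kap, hstrip nu kap & ssize kap == ssize lam + k]) 1 =
  \sum_(e < k.+1 | e <= strip_bound b)
    \sum_(rho | [&& hstrip rho lam, strip b rho nu & ssize nu == ssize rho + (k - e)]) 1.
Proof.
move=> nuL lamB; case: b => /=; last first.
  rewrite local_hstrip // [RHS](eq_bigl xpredT); last by move=> e; apply/idP; have := ltn_ord e;
    lia.
  under [RHS]eq_bigr do rewrite big_mkcond /=.
  rewrite [RHS]exchange_big [LHS]big_mkcond; apply: eq_bigr => rho _ /=.
  have [Hl|_] := boolP (hstrip rho lam); last by rewrite /= big1.
  have [Hn|_] := boolP (hstrip rho nu); last by rewrite /= big1.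
  have le := @strip_size _ _ false _ _ Hn.
  rewrite /=; case: leqP => H.
    have ek : ssize rho + k - ssize nu < k.+1 by lia.
    rewrite (bigD1 (Ordinal ek)) //= big1 => [|e].
      by rewrite (_ : (ssize nu == _) = true) //; apply/eqP; lia.
    rewrite -val_eqE /= => ne; have ltk := ltn_ord e.
    by rewrite (_ : (ssize nu == _) = false) //; apply/eqP; move/eqP: ne; lia.
  rewrite big1 // => e _; have ltk := ltn_ord e.
  by rewrite (_ : (ssize nu == _) = false) //; apply/eqP; lia.
rewrite local_vstrip //; case: k {lamB} => [|k].
  by rewrite [RHS]big_mkcond [RHS]big_ord_recl [X in _ = _ + X]big_ord0 /= subn0 addn0.
rewrite [RHS]big_mkcond [RHS]big_ord_recl /= subn0; congr (_ + _).
by rewrite [RHS]big_ord_recl /= subSS subn0 [X in _ + X]big1 ?addn0.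
Qed.
End LocalStrip.

(** * Schur polynomials by branching, and the Pieri rules *)

Section Pieri.
Local Open Scope ring_scope.
Variables (K : comNzRingType) (L B : nat) (x : nat -> K).
Local Notation shape := {ffun 'I_L -> 'I_B.+1}.

(* Branching rule: the Schur polynomial in x_0, ..., x_(j-1). *)
Fixpoint sfun (j : nat) (lam : shape) : K :=
  if j is j'.+1 then
    \sum_(nu | hstrip nu lam) sfun j' nu * x j' ^+ (ssize lam - ssize nu)%N
  else (lam == shape0 L B)%:R.

Lemma sfun_row_eq0 j lam i : (j <= i)%N -> (0 < srow lam i)%N -> sfun j lam = 0.
Proof.
elim: j lam i => [|j IH] lam i /=.
  by move=> _; case: eqP => [->|//]; rewrite srow0.
case: i => // i ji lam_i; rewrite big1 // => nu /hstripP/(_ i)/andP[le _].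
by rewrite (IH _ i) ?mul0r // (leq_trans lam_i).
Qed.

(** Truncated generating function of symmetric polynomials in x_0, ..., x_(j-1): the coefficient of
    X^k is e_k when [bd] is 1, and h_k when k is at most [bd]. *)
Definition strip_poly (bd j : nat) : {poly K} :=
  \prod_(i < j) \sum_(e < bd.+1) (x i ^+ e) *: 'X^e.

Lemma coef_strip_polyS bd j k :
  (strip_poly bd j.+1)`_k =
  \sum_(e < k.+1 | (e <= bd)%N) (strip_poly bd j)`_(k - e) * x j ^+ e.
Proof.
rewrite /strip_poly big_ord_recr /= coefMr [RHS]big_mkcond; apply: eq_bigr => e _ /=.
rewrite coef_sum; have [le|lt] := leqP e bd.
  rewrite (bigD1 (Ordinal (le : e < bd.+1)%N)) //= coefZ coefXn eqxx mulr1.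
  rewrite [X in _ + X]big1 ?addr0 // => i; rewrite -val_eqE /= => ne.
  by rewrite coefZ coefXn eq_sym (negPf ne) mulr0.
rewrite [X in _ * X]big1 ?mulr0 // => i _; rewrite coefZ coefXn gtn_eqF ?mulr0 //.
by apply: leq_trans lt; rewrite ltn_ord.
Qed.

End Pieri.

Section PieriRule.
Local Open Scope ring_scope.

(** Induction on the number of variables. Branching off the last variable gives pairs of [kap] and
    [nu] below it; [local_strip] trades [kap] for some [rho] below both [lam] and [nu]. The sum over
    [nu] is then the rule for [rho] in one variable less, and the sum over [rho] is the branching
    rule for [lam]. Cutting shapes off after [L] rows loses nothing, since j is at most [L]. *)
Lemma pieri (K : comNzRingType) (L B : nat) (x : nat -> K) b j (lam : {ffun 'I_L -> 'I_B.+1}) k :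
    (j <= L)%N -> (ssize lam + k <= B)%N ->
  \sum_(kap | strip b lam kap && (ssize kap == ssize lam + k)%N) sfun x j kap =
  (strip_poly x (strip_bound B b) j)`_k * sfun x j lam.
Proof.
elim: j lam k => [|j IH] lam k jL lamB.
  rewrite /strip_poly big_ord0 coefC /=.
  have [/andP[/eqP-> /eqP->]|nz] := boolP ((lam == shape0 L B) && (k == 0)%N).
    rewrite (bigD1 (shape0 L B)) /= ?ssize0 ?addn0 ?eqxx ?big1 ?mulr1 ?addr0 //.
      by move=> kap /andP[_ /negPf->].
    by rewrite andbT; case: b; [apply/vstripP | apply/hstripP] => i; rewrite !srow0.
  rewrite big1 => [|kap /andP[/strip_size le /eqP sk]].
    by move: nz; case: (_ == shape0 _ _); case: (k == 0%N); rewrite ?mulr0 ?mul0r.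
  by case: eqP => // k0; move/esym/eqP: sk nz; rewrite k0 ssize0 addn_eq0 ssize_eq0 => ->.
case: L jL lam lamB IH => [//|L'] jL lam lamB IH.
pose w (nu : {ffun 'I_L'.+1 -> 'I_B.+1}) := sfun x j nu * x j ^+ (ssize lam + k - ssize nu)%N.
pose N nu := (\sum_(kap | [&& strip b lam kap, hstrip nu kap & ssize kap == ssize lam + k]) 1)%N.
transitivity (\sum_nu w nu *+ N nu).
  rewrite /= (exchange_big_dep xpredT) //=; apply: eq_bigr => nu _.
  rewrite /N sum1_card -sumr_const; apply: eq_big => kap.
    by rewrite unfold_in -andbA [X in _ && X]andbC.
  by case/andP => /andP[_ /eqP->].
rewrite coef_strip_polyS mulr_suml.
apply: (@etrans _ _ (\sum_(e < k.+1 | (e <= strip_bound B b)%N) \sum_(rho | hstrip rho lam)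
    \sum_(nu | strip b rho nu && (ssize nu == ssize rho + (k - e))%N) w nu)).
  rewrite /=.
  under [RHS]eq_bigr do under eq_bigr do rewrite big_mkcond.
  under [RHS]eq_bigr do rewrite exchange_big.
  rewrite [RHS]exchange_big; apply: eq_bigr => nu _ /=.
  (* [local_strip] wants the last row of [nu] empty; otherwise [nu] has more rows than there are
     variables left, and its weight is 0. *)
  have [nu0|nuL] := posnP (srow nu L'); last first.
    have w0 : w nu = 0 by rewrite /w (sfun_row_eq0 _ _ nuL) ?mul0r.
    rewrite w0 mul0rn big1 // => e _; rewrite big1 // => rho _; by case: ifP.
  rewrite /N local_strip // -sumrMnr; apply: eq_bigr => e _.
  rewrite -sumrMnr [LHS]big_mkcond [RHS]big_mkcond; apply: eq_bigr => rho _ /=.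
  by case: (hstrip rho lam) => //=; case: ifP.
apply: eq_bigr => e _.
rewrite mulr_sumr; apply: eq_bigr => rho Hr.
have le := @strip_size _ _ false _ _ Hr.
rewrite (eq_bigr (fun nu => sfun x j nu * x j ^+ (e + (ssize lam - ssize rho)))); last first.
  move=> nu /andP[_ /eqP sn]; rewrite /w; congr (_ * _ ^+ _).
  by have lek := ltn_ord e; rewrite sn; lia.
rewrite -mulr_suml IH ?exprD -/(sfun x j rho); first by ring.
  exact: ltnW.
have lek := ltn_ord e; lia.
Qed.

End PieriRule.

(** * Tableaux as chains of partitions *)

Lemma big_inj_surj (R : Type) (idx : R) (op : Monoid.com_law idx) (I J : finType)
    (P : pred I) (Q : pred J) (h : I -> J) (F : J -> R) :
    (forall i, P i -> Q (h i)) -> {in P &, injective h} ->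
    (forall j, Q j -> exists2 i, P i & h i = j) ->
  \big[op/idx]_(j | Q j) F j = \big[op/idx]_(i | P i) F (h i).
Proof.
move=> PQ h_inj h_surj; rewrite -(big_imset _ h_inj); apply: eq_bigl => j.
apply/idP/imsetP => [/h_surj[i Pi <-]|[i Pi ->]]; last exact: PQ.
by exists i.
Qed.

(** Recovers an initial segment from its cardinality, so that row lengths can be read off the
    entries of a tableau. *)
Lemma card_initial B (q : pred nat) :
    (forall c c', c <= c' -> q c' -> q c) -> (forall c, q c -> c < B) ->
  forall c, q c = (c < \sum_(d < B | q d) 1).
Proof.
move=> q_down q_lt; have exN : exists N, ~~ q N.
  by exists B; apply/negP => /q_lt; rewrite ltnn.
case: (ex_minnP exN) => N nqN minN.
have qE c : q c = (c < N).
  apply/idP/idP => [qc|cN].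
    by rewrite ltnNge; apply/negP => /q_down/(_ qc); apply/negP.
  by apply: contraLR cN => /minN; rewrite -leqNgt.
have NB : N <= B.
  by case: N nqN minN qE => // N _ _ qE; apply: q_lt; rewrite qE.
move=> c; rewrite qE (eq_bigl (fun d : 'I_B => d < N)) => [|d]; last exact: qE.
by rewrite -(big_ord_widen B (fun=> 1)) // sum1_card card_ord.
Qed.

Section Chains.
Local Open Scope ring_scope.
Variables (K : comNzRingType) (S : finType) (s0 : S) (W : nat -> S -> S -> K).

(** Schur polynomials and tableau counts both take this form, so a single bijection between tableaux
    and chains serves both. *)
Fixpoint transfer (j : nat) (s : S) : K :=
  if j is j'.+1 then \sum_u transfer j' u * W j' u s else (s == s0)%:R.

Definition chain_at k (c : {ffun 'I_k.+1 -> S}) (j : nat) : S := c (inord j).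

Lemma chain_ext k (c c' : {ffun 'I_k.+1 -> S}) :
  (forall j, (j <= k)%N -> chain_at c j = chain_at c' j) -> c = c'.
Proof. by move=> E; apply/ffunP => j; rewrite -(inord_val j); apply: E; rewrite -ltnS. Qed.

Lemma chain_at_ffun k (f : nat -> S) j : (j <= k)%N ->
  chain_at [ffun i : 'I_k.+1 => f i] j = f j.
Proof. by move=> jk; rewrite /chain_at ffunE inordK. Qed.

Lemma transfer_chain k s : transfer k s =
  \sum_(c : {ffun 'I_k.+1 -> S} | (chain_at c 0 == s0) && (chain_at c k == s))
    \prod_(j < k) W j (chain_at c j) (chain_at c j.+1).
Proof.
elim: k s => [|k IH] s /=.
  under eq_bigr do rewrite big_ord0.
  pose c0 : {ffun 'I_1 -> S} := [ffun=> s0].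
  have c00 : chain_at c0 0 = s0 by rewrite /chain_at ffunE.
  have [->|ne] := eqVneq s s0.
    rewrite (bigD1 c0) /= ?c00 ?eqxx //= big1 ?addr0 // => c /andP[/andP[/eqP c0E _] /eqP[]].
    by apply: chain_ext => j; rewrite leqn0 => /eqP->; rewrite c0E c00.
  by rewrite big1 // => c /andP[/eqP-> /eqP E]; rewrite E eqxx in ne.
transitivity (\sum_(c : {ffun 'I_k.+1 -> S} | chain_at c 0 == s0)
    \prod_(j < k) W j (chain_at c j) (chain_at c j.+1) * W k (chain_at c k) s).
  rewrite [RHS](partition_big (fun c => chain_at c k) xpredT) //=.
  apply: eq_bigr => u _; rewrite IH mulr_suml; apply: eq_bigr => c /andP[_ /eqP->] //.
pose h (c : {ffun 'I_k.+1 -> S}) : {ffun 'I_k.+2 -> S} :=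
  [ffun i : 'I_k.+2 => if (i <= k)%N then chain_at c i else s].
have hE c j : (j <= k)%N -> chain_at (h c) j = chain_at c j.
  move=> jk; rewrite /h (chain_at_ffun (fun i => if (i <= k)%N then chain_at c i else s)) ?jk //.
  exact: leqW.
have hS c : chain_at (h c) k.+1 = s.
  by rewrite /h (chain_at_ffun (fun i => if (i <= k)%N then chain_at c i else s)) // ltnn.
pose h' (c : {ffun 'I_k.+2 -> S}) : {ffun 'I_k.+1 -> S} := [ffun i : 'I_k.+1 => chain_at c i].
have h'E c j : (j <= k)%N -> chain_at (h' c) j = chain_at c j.
  by move=> jk; rewrite /h' chain_at_ffun.
rewrite [RHS](@big_bij _ _ _ _ _ (fun c => chain_at c 0 == s0) _ h h') //.
- apply: eq_bigr => c _; rewrite big_ord_recr /= hE // hS; congr (_ * _).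
  by apply: eq_bigr => j _; rewrite !hE // ltnW.
- by move=> c; rewrite hE // hS eqxx andbT.
- by move=> c /andP[]; rewrite h'E.
- by move=> c _; apply: chain_ext => j jk; rewrite h'E // hE.
- move=> c /andP[_ /eqP ck]; apply: chain_ext => j; rewrite leq_eqVlt ltnS.
  by case/predU1P => [->|jk]; rewrite ?hS ?ck // hE // h'E.
Qed.
End Chains.

Section Boxes.
Variable sh : seq nat.
Implicit Types x y : box sh.

Lemma bcol_lt x : bcol x < nth 0 sh (brow x).
Proof. exact: ltn_ord (tagged x). Qed.

Lemma box_inj x y : brow x = brow y -> bcol x = bcol y -> x = y.
Proof.
case: x y => [i c] [j d]; rewrite /brow /bcol /= => /val_inj E; subst j.
by move=> /val_inj ->.
Qed.

Lemma box_ex i c : c < nth 0 sh i -> exists x, brow x = i /\ bcol x = c.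
Proof.
move=> ci; have il : i < size sh.
  by rewrite ltnNge; apply/negP => /(nth_default 0) E; rewrite E in ci.
by exists (Tagged (fun i : 'I_(size sh) => 'I_(nth 0 sh i)) (Ordinal (ci : c < nth 0 sh (Ordinal
  il)))).
Qed.

Lemma sum_box (f : nat -> nat -> nat) :
  \sum_(x : box sh) f (brow x) (bcol x) =
  \sum_(i < size sh) \sum_(c < nth 0 sh i) f i c.
Proof. by rewrite sig_big_dep. Qed.

End Boxes.

Section Tableaux.
Variables (Lt : finType) (rk : Lt -> nat) (k : nat) (fl : nat -> bool).
Hypotheses (rk_inj : injective rk) (rk_lt : forall l, rk l < k)
  (rk_surj : forall j, j < k -> exists l, rk l = j).
Variables (L B : nat) (lam : {ffun 'I_L -> 'I_B.+1}) (sh : seq nat).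
Hypotheses (sh_size : size sh <= L) (shE : forall i, nth 0 sh i = srow lam i)
  (sh_part : forall i, srow lam i.+1 <= srow lam i).
Local Notation shape := {ffun 'I_L -> 'I_B.+1}.
Local Notation tableau := {ffun box sh -> Lt}.

(** [fl] marks the letters that may not repeat in a row; the others may not repeat in a column. With
    [fl] false everywhere these are the ordinary semistandard tableaux, with [fl] true on the barred
    letters those of [SSMT']. *)
Definition super_tableau (T : tableau) :=
  [forall x, forall y, (brow x == brow y) && (bcol x < bcol y) ==>
     (rk (T x) <= rk (T y)) && ~~ (fl (rk (T x)) && (T x == T y))] &&
  [forall x, forall y, (bcol x == bcol y) && (brow x < brow y) ==>
     (rk (T x) <= rk (T y)) && ~~ (~~ fl (rk (T x)) && (T x == T y))].

(* Entries by row and column, with the value k outside the diagram. *)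
Definition tentry (T : tableau) (i c : nat) : nat :=
  if [pick x | (brow x == i) && (bcol x == c)] is Some x then rk (T x) else k.

Lemma tentryE T x : tentry T (brow x) (bcol x) = rk (T x).
Proof.
rewrite /tentry; case: pickP => [y /andP[/eqP ry /eqP cy]|/(_ x)].
  by rewrite (box_inj ry cy).
by rewrite !eqxx.
Qed.

Lemma tentry_lt T i c : (tentry T i c < k) = (c < srow lam i).
Proof.
rewrite -shE; apply/idP/idP => [|ci]; last first.
  by have [x [<- <-]] := box_ex ci; rewrite tentryE rk_lt.
rewrite /tentry; case: pickP => [y /andP[/eqP <- /eqP <-] _|_]; first exact: bcol_lt.
by rewrite ltnn.
Qed.

Lemma tentry_le T i c : tentry T i c <= k.
Proof. by rewrite /tentry; case: pickP => // x _; apply: ltnW. Qed.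

Lemma tentry_out T i c : srow lam i <= c -> tentry T i c = k.
Proof. by rewrite leqNgt -(tentry_lt T) -leqNgt => H; apply/eqP; rewrite eqn_leq tentry_le. Qed.

Lemma tentry_cases T i c : (exists x, [/\ brow x = i, bcol x = c & tentry T i c = rk (T x)]) \/
  (tentry T i c = k /\ srow lam i <= c).
Proof.
have [ci|ci] := ltnP c (srow lam i); last by right; split=> //; apply: tentry_out.
by left; rewrite -shE in ci; have [x [<- <-]] := box_ex ci; exists x; rewrite tentryE.
Qed.

Lemma super_tableauP T : reflect
  ((forall i c c', c < c' -> tentry T i c <= tentry T i c' /\
      (tentry T i c < k -> fl (tentry T i c) -> tentry T i c != tentry T i c')) /\
   (forall i i' c, i < i' -> tentry T i c <= tentry T i' c /\
      (tentry T i c < k -> ~~ fl (tentry T i c) -> tentry T i c != tentry T i' c)))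
  (super_tableau T).
Proof.
apply: (iffP andP) => -[H1 H2]; split.
- move=> i c c' cc'; have [[x [xi xc ->]]|[-> out]] := tentry_cases T i c; last first.
    by rewrite (tentry_out T (leq_trans out (ltnW cc'))) ltnn.
  have [[y [yi yc ->]]|[-> _]] := tentry_cases T i c'; last first.
    by split; [apply: ltnW | move=> lt _; rewrite neq_ltn lt].
  move/forallP/(_ x)/forallP/(_ y): H1; rewrite xi yi xc yc eqxx cc' /= => /andP[-> /nandP nT].
  by split=> // _ flx; case: nT => [|nT]; [rewrite flx | rewrite (inj_eq rk_inj)].
- move=> i i' c ii'; have [[x [xi xc ->]]|[-> out]] := tentry_cases T i c; last first.
    have le : srow lam i' <= srow lam i.
      by move: ii'; elim: i' => // i' IH; rewrite ltnS leq_eqVlt => /predU1P[->//|/IH];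
        apply: leq_trans.
    by rewrite (tentry_out T (leq_trans le out)) ltnn.
  have [[y [yi yc ->]]|[-> _]] := tentry_cases T i' c; last first.
    by split; [apply: ltnW | move=> lt _; rewrite neq_ltn lt].
  move/forallP/(_ x)/forallP/(_ y): H2; rewrite xi yi xc yc eqxx ii' /= => /andP[-> /nandP nT].
  by split=> // _ flx; case: nT => [|nT]; [rewrite flx | rewrite (inj_eq rk_inj)].
- apply/forallP => x; apply/forallP => y; apply/implyP => /andP[/eqP xy lt].
  have [] := H1 (brow x) _ _ lt; rewrite tentryE xy tentryE => -> nT; apply/nandP.
  have [flx|] := boolP (fl _); [right | by left].
  by rewrite -(inj_eq rk_inj) nT.
- apply/forallP => x; apply/forallP => y; apply/implyP => /andP[/eqP xy lt].
  have [] := H2 _ _ (bcol x) lt; rewrite tentryE xy tentryE => -> nT; apply/nandP.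
  have [flx|flx] := boolP (fl _); [by left | right].
  by rewrite -(inj_eq rk_inj) nT.
Qed.

Definition tchain (T : tableau) : {ffun 'I_k.+1 -> shape} :=
  [ffun j : 'I_k.+1 => mkshape L B (fun i => \sum_(c < B | tentry T i c < j) 1)].

Lemma tchain_row T j i : j <= k ->
  srow (chain_at (tchain T) j) i = \sum_(c < B | tentry T i c < j) 1.
Proof.
move=> jk; rewrite /tchain (chain_at_ffun (fun j => mkshape L B (fun i => \sum_(c < B | tentry T
  i c < j) 1))) //.
have [iL|Li] := ltnP i L.
  by rewrite srow_mk // sum1_card -[leqRHS]card_ord max_card.
rewrite srow_out // big_pred0 // => c; apply/negP => /leq_trans/(_ jk).
by rewrite tentry_lt srow_out.
Qed.

Lemma tchain_entry T j i c : super_tableau T -> j <= k ->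
  (tentry T i c < j) = (c < srow (chain_at (tchain T) j) i).
Proof.
move=> /super_tableauP[H1 _] jk; rewrite tchain_row //.
apply: (@card_initial B (fun c => tentry T i c < j)) => [d d' dd'|d].
  move: dd'; rewrite leq_eqVlt => /predU1P[->//|/(H1 i)[le _]]; exact: leq_ltn_trans le.
by move=> /leq_trans/(_ jk); rewrite tentry_lt => /leq_trans; apply; exact: srow_le.
Qed.

Lemma tchain_size T j : j <= k ->
  ssize (chain_at (tchain T) j) = #|[set x | rk (T x) < j]|.
Proof.
move=> jk; rewrite -sum1_card (eq_bigl (fun x => rk (T x) < j)); last by move=> x; rewrite inE.
rewrite [RHS]big_mkcond (eq_bigr (fun x => if tentry T (brow x) (bcol x) < j then 1 else 0));
  last first.
  by move=> x _; rewrite tentryE.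
rewrite (sum_box _ (fun i c => if tentry T i c < j then 1 else 0)).
have lt i c : tentry T i c < j -> c < srow lam i.
  by move=> /leq_trans/(_ jk); rewrite tentry_lt.
rewrite [RHS](big_ord_widen L (fun i => \sum_(c < nth 0 sh i) if tentry T i c < j then 1 else
  0)) //.
rewrite [RHS]big_mkcond /=; apply: eq_bigr => i _; rewrite tchain_row // shE.
rewrite (big_ord_widen B (fun c => if tentry T i c < j then 1 else 0)) ?srow_le //.
case: ltnP => [_|out].
  rewrite [LHS]big_mkcond [RHS]big_mkcond; apply: eq_bigr => c _ /=.
  by case: ifP => [/lt->|_]; rewrite ?if_same.
rewrite big_pred0 // => c; apply/negP => /lt; rewrite -shE nth_default //.
Qed.

Definition tchain_ok (c : {ffun 'I_k.+1 -> shape}) :=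
  [&& chain_at c 0 == shape0 L B, chain_at c k == lam &
      [forall j : 'I_k, strip (fl j) (chain_at c j) (chain_at c j.+1)]].

(** All boxes between two consecutive partitions of the chain hold the same letter; forbidding it
    twice in a row makes them a vertical strip, twice in a column a horizontal one. *)
Lemma tchainP T : super_tableau T -> tchain_ok (tchain T).
Proof.
move=> TP; have /super_tableauP[H1 H2] := TP; apply/and3P; split.
- by apply/eqP/srow_inj => i _; rewrite tchain_row // srow0 big_pred0.
- apply/eqP/srow_inj => i _; apply/eqP; rewrite eqn_leq.
  apply/andP; split; rewrite leqNgt; apply/negP.
    by rewrite -tchain_entry // tentry_lt ltnn.
  by rewrite -(tentry_lt T) tchain_entry // ltnn.
apply/forallP => j; have jk : j < k by [].
have le i i' c : i <= i' -> tentry T i c <= tentry T i' c.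
  by rewrite leq_eqVlt => /predU1P[->//|lt]; have [] := H2 _ _ c lt.
have mono j' i : j' <= k -> srow (chain_at (tchain T) j') i.+1 <= srow (chain_at (tchain T) j') i.
  move=> jk'; rewrite leqNgt; apply/negP; rewrite -tchain_entry // => lt.
  have := leq_ltn_trans (le _ _ _ (leqnSn i)) lt; rewrite tchain_entry //; lia.
have sub i : srow (chain_at (tchain T) j) i <= srow (chain_at (tchain T) j.+1) i.
  rewrite leqNgt; apply/negP; rewrite -tchain_entry ?(ltnW jk) // => lt.
  have : tentry T i (srow (chain_at (tchain T) j.+1) i) < j.+1 by apply: ltnW.
  by rewrite tchain_entry // ltnn.
have [flj|flj] := boolP (fl j).
  apply/vstripP => i; split=> //; [|exact: mono (ltnW jk) | exact: mono].
  rewrite leqNgt; apply/negP => lt; set a := srow (chain_at (tchain T) j) i in lt.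
  have : tentry T i a.+1 < j.+1 by rewrite tchain_entry.
  have : ~~ (tentry T i a < j) by rewrite tchain_entry ?(ltnW jk) // ltnn.
  have [] := H1 i _ _ (ltnSn a) => H1a H1b G1 G2.
  (* Two new boxes in row i would put the letter j into both of the columns a and a + 1. *)
  have E : tentry T i a = j by apply/eqP; move: G1 G2 H1a; lia.
  by have := H1b; rewrite E => /(_ jk flj); move: G1 G2 H1a; rewrite E; lia.
apply/hstripP => i; rewrite sub andbT leqNgt; apply/negP => lt.
set a := srow (chain_at (tchain T) j) i in lt.
have : tentry T i.+1 a < j.+1 by rewrite tchain_entry.
have : ~~ (tentry T i a < j) by rewrite tchain_entry ?(ltnW jk) // ltnn.
have [] := H2 _ _ a (ltnSn i) => H1a H1b G1 G2.
have E : tentry T i a = j by apply/eqP; move: G1 G2 H1a; lia.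
by have := H1b; rewrite E => /(_ jk flj); move: G1 G2 H1a; rewrite E; lia.
Qed.

Lemma tchain_inj : {in super_tableau &, injective tchain}.
Proof.
move=> T T' TP TP' E; apply/ffunP => x; apply: rk_inj.
have H j : j <= k -> (rk (T x) < j) = (rk (T' x) < j).
  by move=> jk; rewrite -!tentryE !tchain_entry // E.
apply/eqP; rewrite eqn_leq -ltnS -[X in _ && X]ltnS.
by rewrite H ?rk_lt // ltnSn -H ?rk_lt // ltnSn.
Qed.

(** A box is filled with the letter of the step at which the chain first contains it. *)
Lemma tchain_surj c : tchain_ok c -> exists2 T, super_tableau T & tchain T = c.
Proof.
move=> /and3P[/eqP c0 /eqP ck /forallP cS].
have row_le j j' i : j <= j' -> j' <= k -> srow (chain_at c j) i <= srow (chain_at c j') i.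
  elim: j' => [|j' IH]; first by rewrite leqn0 => /eqP->.
  rewrite leq_eqVlt => /predU1P[->//|]; rewrite ltnS => le lt.
  by apply: leq_trans (IH le (ltnW lt)) _; apply: strip_le (cS (Ordinal lt)).
have part j i : j <= k -> srow (chain_at c j) i.+1 <= srow (chain_at c j) i.
  case: j => [|j] jk; first by rewrite c0 !srow0.
  have := cS (Ordinal jk); case: (fl _) => /= [/vstripP/(_ i)[] //|/hstripP/(_ i)].
  by case/andP => le le'; apply: leq_trans le le'.
have part' j i i' : j <= k -> i <= i' -> srow (chain_at c j) i' <= srow (chain_at c j) i.
  move=> jk; elim: i' => [|i' IH]; first by rewrite leqn0 => /eqP->.
  by rewrite leq_eqVlt => /predU1P[->//|] /IH; apply: leq_trans; apply: part.
have ex (x : box sh) : exists l, [forall j : 'I_k.+1, (rk l < j) == (bcol x < srow (chain_at c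
  j) (brow x))].
  have lt : exists j, bcol x < srow (chain_at c j) (brow x).
    by exists k; rewrite ck -shE bcol_lt.
  case: (ex_minnP lt) => j xj minj.
  have jk : j <= k by apply: minj; rewrite ck -shE bcol_lt.
  have j_gt0 : 0 < j by case: j xj {minj jk} => //; rewrite c0 srow0.
  have [l lE] : exists l, rk l = j.-1 by apply: rk_surj; case: j jk j_gt0 {xj minj}.
  exists l; apply/forallP => j'; apply/eqP; rewrite lE prednK //.
  apply/idP/idP => [le|/minj //].
  by apply: leq_trans xj (row_le _ _ _ le _); rewrite -ltnS.
have [T TE] := fin_all_exists ex.
pose T' : tableau := [ffun x => T x].
have T'E x j : j <= k -> (rk (T' x) < j) = (bcol x < srow (chain_at c j) (brow x)).
  by move=> jk; have /forallP/(_ (Ordinal (jk : j < k.+1)))/eqP := TE x; rewrite ffunE.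
have entE i d j : j <= k -> (tentry T' i d < j) = (d < srow (chain_at c j) i).
  move=> jk; have [[x [<- <- ->]]|[-> out]] := tentry_cases T' i d; first exact: T'E.
  rewrite ltnNge jk; apply/esym/negP => lt; have := leq_trans lt (row_le _ _ i jk (leqnn k)).
  by rewrite ck ltnNge out.
have T'P : super_tableau T'.
  apply/super_tableauP; split.
  - move=> i d d' dd'; have le : tentry T' i d <= tentry T' i d'.
      rewrite leqNgt; apply/negP => lt; have lek := tentry_le T' i d.
      move: (lt); rewrite entE // => H.
      have : tentry T' i d < tentry T' i d; last by rewrite ltnn.
      by rewrite entE //; apply: ltn_trans H.
    split=> // ltk flT; apply/eqP => E.
    have := cS (Ordinal ltk); rewrite /= flT => /vstripP/(_ i)[_ le1 _ _].
    have G1 : d' < srow (chain_at c (tentry T' i d).+1) i by rewrite -entE // -E.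
    have G2 : ~~ (d < srow (chain_at c (tentry T' i d)) i) by rewrite -entE ?tentry_le // ltnn.
    by move: le1 G1 G2; lia.
  - move=> i i' d ii'; have le : tentry T' i d <= tentry T' i' d.
      rewrite leqNgt; apply/negP => lt; have lek := tentry_le T' i d.
      move: (lt); rewrite entE // => H.
      have : tentry T' i d < tentry T' i d; last by rewrite ltnn.
      by rewrite entE // (leq_trans H) // part' // ltnW.
    split=> // ltk flT; apply/eqP => E.
    have := cS (Ordinal ltk); rewrite /= (negPf flT) => /hstripP/(_ i)/andP[le1 _].
    have G1 : d < srow (chain_at c (tentry T' i d).+1) i' by rewrite -entE // -E.
    have G2 : ~~ (d < srow (chain_at c (tentry T' i d)) i) by rewrite -entE ?tentry_le // ltnn.
    by have := part' _ _ _ ltk ii'; move: le1 G1 G2; lia.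
exists T' => //; apply: chain_ext => j jk; apply: srow_inj => i _.
apply/eqP; rewrite eqn_leq; apply/andP; split; rewrite leqNgt; apply/negP.
  by rewrite -tchain_entry // entE // ltnn.
by rewrite -entE // tchain_entry // ltnn.
Qed.

(** The weight [w j c] depends on how often the letter j occurs: powers of a variable give Schur
    polynomials, the indicator of a prescribed multiplicity gives the number of tableaux of that
    content. *)
Lemma tableau_transfer (K : comNzRingType) (w : nat -> nat -> K) :
  (\sum_(T | super_tableau T) \prod_(j < k) w j #|[set x | rk (T x) == j]|)%R =
  transfer (shape0 L B)
    (fun j mu nu => if strip (fl j) mu nu then w j (ssize nu - ssize mu) else 0%R) k lam.
Proof.
rewrite transfer_chain (bigID (fun c : {ffun 'I_k.+1 -> shape} =>
  [forall j : 'I_k, strip (fl j) (chain_at c j) (chain_at c j.+1)])) /=.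
rewrite [X in (_ + X)%R]big1 ?addr0 => [|c /andP[_]]; last first.
  by rewrite negb_forall => /existsP[j /negPf nj]; rewrite (bigD1 j) //= nj mul0r.
rewrite (eq_bigl tchain_ok) => [|c]; last by rewrite /tchain_ok andbA.
rewrite (@big_inj_surj _ _ _ _ _ _ _ _ _ tchainP tchain_inj tchain_surj); apply: eq_bigr => T TP.
have /and3P[_ _ /forallP cS] := tchainP TP.
apply: eq_bigr => j _; rewrite cS !tchain_size ?(ltnW (ltn_ord j)) //.
congr (w j _); apply/eqP; rewrite -(eqn_add2r #|[set x | rk (T x) < j]|) subnK; last first.
  by apply/subset_leq_card/subsetP => x; rewrite !inE => /ltnW.
rewrite -cardsUI (_ : _ :&: _ = set0) ?cards0 ?addn0; last first.
  by apply/setP => x; rewrite !inE; case: eqP => // ->; rewrite ltnn.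
by apply/eqP/eq_card => x; rewrite !inE [RHS]ltnS [RHS]leq_eqVlt.
Qed.

End Tableaux.

(** * Partitions of d with at most n parts as shapes *)

Section PartShape.
Variables (n d : nat).
Local Notation shape := {ffun 'I_n -> 'I_d.+1}.

Definition part_shape (l : intpart d) : shape := mkshape n d (nth 0 (parts l)).

Lemma parts_spec (l : intpart d) :
  [/\ sorted geq (parts l), 0 \notin parts l & sumn (parts l) = d].
Proof.
by have /intpartP/and3P[? ? /eqP ?] : exists mu : intpart d, parts mu = parts l by exists l.
Qed.

Lemma nth_parts_le (l : intpart d) i : nth 0 (parts l) i <= d.
Proof.
have [_ _ E] := parts_spec l.
have [il|/(nth_default 0)-> //] := ltnP i (size (parts l)).
by rewrite -[X in _ <= X]E sumnE (big_nth 0) big_mkord (bigD1 (Ordinal il)) //= leq_addr.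
Qed.

Lemma srow_part_shape (l : intpart d) i : size (parts l) <= n ->
  srow (part_shape l) i = nth 0 (parts l) i.
Proof.
move=> ln; have [iL|Li] := ltnP i n; first by rewrite srow_mk // nth_parts_le.
by rewrite srow_out // nth_default // (leq_trans ln).
Qed.

Lemma part_shape_sorted (l : intpart d) i : size (parts l) <= n ->
  srow (part_shape l) i.+1 <= srow (part_shape l) i.
Proof.
move=> ln; rewrite !srow_part_shape //; have [so _ _] := parts_spec l.
have [il|/(nth_default 0)-> //] := ltnP i.+1 (size (parts l)).
by have /sortedP := so => /(_ 0 i il).
Qed.

Definition is_part_shape (s : shape) :=
  [forall i : 'I_n, srow s i.+1 <= srow s i] && (ssize s == d).

Lemma sum_intpart (R : Type) (idx : R) (op : Monoid.com_law idx) (F : shape -> R) :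
  \big[op/idx]_(s | is_part_shape s) F s =
  \big[op/idx]_(l : intpart d | size (parts l) <= n) F (part_shape l).
Proof.
apply: big_inj_surj => [l ln|l l' ln ln' E|s].
- apply/andP; split; first by apply/forallP => i; apply: part_shape_sorted.
  apply/eqP; have [_ _ ld] := parts_spec l; rewrite -[RHS]ld sumnE (big_nth 0) big_mkord.
  rewrite (big_ord_widen n (fun i => nth 0 (parts l) i)) // /ssize big_mkcond.
  rewrite [RHS]big_mkcond; apply: eq_bigr => i _ /=; rewrite srow_part_shape //.
  by case: ltnP => // ?; rewrite nth_default.
- have Enth i : nth 0 (parts l) i = nth 0 (parts l') i by rewrite -!srow_part_shape // E.
  have pos (l1 : intpart d) i : (i < size (parts l1)) = (0 < nth 0 (parts l1) i).
    have [_ nz _] := parts_spec l1; case: ltnP => il; last by rewrite nth_default.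
    by rewrite lt0n; apply/esym; apply: contraNneq nz => <-; apply: mem_nth.
  have Esize i : (i < size (parts l)) = (i < size (parts l')) by rewrite !pos Enth.
  apply: parts_inj; apply: (@eq_from_nth _ 0) => [|i _]; last exact: Enth.
  by apply/eqP; rewrite eqn_leq leqNgt Esize ltnn /= leqNgt -Esize ltnn.
- case/andP => /forallP so /eqP sd.
  pose q := [seq i <- mkseq (srow s) n | 0 < i].
  have so' i : srow s i.+1 <= srow s i.
    by have [iL|Li] := ltnP i n; [exact: (so (Ordinal iL)) | rewrite srow_out // ltnW].
  have srt : sorted geq (mkseq (srow s) n).
    by apply/(sortedP 0) => i; rewrite size_mkseq => lt; have lt' := ltnW lt;
      rewrite !nth_mkseq //; exact: so'.
  have geq_tr : transitive geq by move=> ? ? ?; rewrite /= => ? ?; lia.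
  have qsum : sumn q = d.
    rewrite -sd sumnE big_filter big_map /ssize -(big_mkord xpredT (srow s)) /index_iota subn0.
    by rewrite big_mkcond; apply: eq_bigr => i _; case: posnP.
  have [|l lE] := (intpartP d q).1.
    by rewrite sorted_filter // qsum eqxx mem_filter.
  have qs : size q <= n by rewrite size_filter -[leqRHS](size_mkseq (srow s)) count_size.
  exists l; rewrite ?lE //; apply: srow_inj => i iL; rewrite srow_part_shape lE //.
  (* In a decreasing sequence only a tail of zeros is filtered out, so the positive entries keep
     their positions. *)
  have nthq (r : seq nat) : sorted geq r -> forall i, nth 0 [seq i <- r | 0 < i] i = nth 0 r i.
    elim: r => // y r IH srtr {i iL} i /=; case: ltnP => [_|y0].
      by case: i => //= i; apply: IH; apply: path_sorted srtr.
    have all0 : forall z, z \in y :: r -> z = 0.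
      move=> z; rewrite inE => /predU1P[->|zr]; first lia.
      by have /allP/(_ z zr) := order_path_min geq_tr srtr; rewrite /=; lia.
    rewrite (_ : [seq _ <- r | _] = [::]); last first.
      by apply/eqP; rewrite -(negbK (_ == _)) -has_filter; apply/hasPn => z zr;
        rewrite (all0 z) // inE zr orbT.
    rewrite nth_nil; have [il|?] := ltnP i (size (y :: r)); last by rewrite nth_default.
    by apply/esym/all0/mem_nth.
  by rewrite nthq // nth_mkseq.
Qed.

End PartShape.

(** * Schur expansion of products of complete and elementary polynomials *)

Section TableauSums.
Variables (K : numFieldType) (n d : nat).
Local Notation shape := {ffun 'I_n -> 'I_d.+1}.
Local Open Scope ring_scope.

Definition natext (T : Type) (x0 : T) k (f : 'I_k -> T) (i : nat) : T := oapp f x0 (insub i).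

Lemma natext_ord (T : Type) (x0 : T) k (f : 'I_k -> T) (i : 'I_k) : natext x0 f i = f i.
Proof. by rewrite /natext valK. Qed.

Lemma sfun_transfer (x : nat -> K) j (s : shape) : sfun x j s =
  transfer (shape0 n d) (fun i (mu nu : shape) =>
    if strip false mu nu then x i ^+ (ssize nu - ssize mu)%N else 0) j s.
Proof.
elim: j s => [//|j IH] s /=; rewrite big_mkcond; apply: eq_bigr => u _.
by rewrite IH; case: ifP; rewrite ?mulr0.
Qed.

Lemma sfun_partition (x : nat -> K) j (s : shape) i : sfun x j s != 0 ->
  (srow s i.+1 <= srow s i)%N.
Proof.
case: j => [|j] /=; first by case: (s =P _) => [->|]; rewrite ?eqxx // !srow0.
move=> nz; rewrite leqNgt; apply/negP => lt; case/eqP: nz; rewrite big1 // => u.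
by move=> /hstripP/(_ i)/andP[le le']; move: (leq_trans le le'); rewrite leqNgt lt.
Qed.

Lemma schur_sfun (l : intpart d) (t : 'I_n -> K) : (size (parts l) <= n)%N ->
  (schur K n (parts l)).@[t] = sfun (natext 0 t) n (part_shape n l).
Proof.
move=> ln; rewrite sfun_transfer.
have Hs i : nth 0%N (parts l) i = srow (part_shape n l) i by rewrite srow_part_shape.
have Hp i : (srow (part_shape n l) i.+1 <= srow (part_shape n l) i)%N by apply: part_shape_sorted.
have surj j : (j < n)%N -> exists i : 'I_n, val i = j by move=> jn; exists (Ordinal jn).
have := tableau_transfer xpred0 val_inj (@ltn_ord n) surj ln Hs Hp (fun j c => natext 0 t j ^+ c).
move=> <-; rewrite /schur rmorph_sum; apply: eq_big => T.
  rewrite inE; apply/idP/idP => [H|/andP[/forallP H1 /forallP H2]].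
    apply/andP; split; apply/forallP => x; apply/forallP => y; apply/implyP => xy;
      move/forallP/(_ x)/forallP/(_ y): H; rewrite xy /= => /andP[H1 H2].
    - by rewrite andbT.
    - by rewrite -val_eqE /=; move: H2; rewrite ltn_neqAle andbC.
  apply/forallP => x; apply/forallP => y; apply/andP; split; apply/implyP => xy.
    by move/forallP/(_ y): (H1 x); rewrite xy /= andbT.
  by move/forallP/(_ y): (H2 x); rewrite xy /= ltn_neqAle andbC -val_eqE.
move=> _; rewrite rmorph_prod (partition_big T xpredT) //=; apply: eq_bigr => j _.
rewrite -prodr_const; apply: eq_big => x; first by rewrite inE.
by move=> /eqP ->; rewrite mevalXU natext_ord.
Qed.

Section Content.
Variables (m m' : nat) (a : 'I_m -> nat) (b : 'I_m' -> nat).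

Definition letter_rank (u : letter m m') : nat :=
  match u with inl i => i | inr j => m + j end.

Definition content (i : nat) : nat :=
  if (i < m)%N then natext 0%N a i else natext 0%N b (i - m).

Definition content_weight (i : nat) (mu nu : shape) : K :=
  if strip (m <= i)%N mu nu then (ssize nu - ssize mu == content i)%N%:R else 0.

Lemma letter_rank_inj : injective letter_rank.
Proof.
move=> [i|i] [j|j] /= E; try by move: (ltn_ord i) (ltn_ord j); lia.
  by congr inl; apply/val_inj.
by congr inr; apply/val_inj; apply/(@addnI m).
Qed.

Lemma letter_rank_lt u : (letter_rank u < m + m')%N.
Proof. by case: u => i /=; have := ltn_ord i; lia. Qed.

Lemma letter_rank_surj j : (j < m + m')%N -> exists u, letter_rank u = j.
Proof.
move=> jm; have [lt|ge] := ltnP j m; first by exists (inl (Ordinal lt)).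
have lt : (j - m < m')%N by lia.
by exists (inr (Ordinal lt)); rewrite /= subnKC.
Qed.

Lemma content_inl (i : 'I_m) : content i = a i.
Proof. by rewrite /content ltn_ord natext_ord. Qed.

Lemma content_inr (j : 'I_m') : content (m + j) = b j.
Proof. by rewrite /content ltnNge leq_addr addKn natext_ord. Qed.

Lemma prod_content (G : bool -> nat -> K) :
  \prod_(i < m + m') G (m <= i)%N (content i) =
  (\prod_(i < m) G false (a i)) * \prod_(j < m') G true (b j).
Proof.
rewrite big_split_ord /=; congr (_ * _); apply: eq_bigr => i _.
  by rewrite leqNgt ltn_ord content_inl.
by rewrite leq_addr content_inr.
Qed.

Lemma sum_content : (\sum_(i < m + m') content i = \sum_(i < m) a i + \sum_(j < m') b j)%N.
Proof.
rewrite big_split_ord /=; congr (_ + _)%N; apply: eq_bigr => i _.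
  exact: content_inl.
exact: content_inr.
Qed.

Lemma card_SSMT' (l : intpart d) : (size (parts l) <= n)%N ->
  #|SSMT' (parts l) a b|%:R =
  transfer (shape0 n d) content_weight (m + m') (part_shape n l) :> K.
Proof.
move=> ln.
have Hs i : nth 0%N (parts l) i = srow (part_shape n l) i by rewrite srow_part_shape.
have Hp i : (srow (part_shape n l) i.+1 <= srow (part_shape n l) i)%N by apply: part_shape_sorted.
have := tableau_transfer (fun i => m <= i)%N letter_rank_inj letter_rank_lt letter_rank_surj
  ln Hs Hp (fun j c => (c == content j)%:R : K).
move=> <-; rewrite -sum1_card natr_sum big_mkcond [RHS]big_mkcond; apply: eq_bigr => T _.
have leE (u v : letter m m') : le_letter u v = (letter_rank u <= letter_rank v)%N.
  by case: u v => [i|i] [j|j] //=; have := ltn_ord i; have := ltn_ord j; lia.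
have flE (u : letter m m') : barred u = (m <= letter_rank u)%N.
  by case: u => i /=; have := ltn_ord i; lia.
have contE j : #|[set x | letter_rank (T x) == letter_rank j]| = #|[set x | T x == j]|.
  by apply: eq_card => x; rewrite !inE (inj_eq letter_rank_inj).
rewrite inE andbA [X in X && _](_ : _ = super_tableau letter_rank (fun i => m <= i)%N T);
  last first.
  congr (_ && _); apply: eq_forallb => x; apply: eq_forallb => y; by rewrite leE flE.
case: super_tableau => //=.
have [/andP[/forallP ha /forallP hb]|] := boolP (_ && _).
  rewrite big1 // => j _; have [u uj] := letter_rank_surj (ltn_ord j).
  rewrite -uj contE; case: u {uj} => i; rewrite [letter_rank _]/= ?content_inl ?content_inr.
    by rewrite (eqP (ha i)) eqxx.
  by rewrite (eqP (hb i)) eqxx.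
rewrite negb_and !negb_forall => /orP[]/existsP[i ne].
  have lt := letter_rank_lt (inl i); rewrite (bigD1 (Ordinal lt)) //=.
  by rewrite content_inl (contE (inl i)) (negPf ne) mul0r.
have lt := letter_rank_lt (inr i); rewrite (bigD1 (Ordinal lt)) //=.
by rewrite content_inr (contE (inr i)) (negPf ne) mul0r.
Qed.

Lemma transfer_size j (u : shape) :
  transfer (shape0 n d) content_weight j u != 0 ->
  ssize u = (\sum_(i < j) content i)%N.
Proof.
elim: j u => [|j IH] u /=.
  by case: (u =P _) => [->|]; rewrite ?eqxx // ssize0 big_ord0.
move=> nz; apply/eqP; apply: contraNT nz => ne; rewrite big1 // => s _.
apply/eqP; rewrite mulf_eq0 orbC /content_weight; case: ifP => [st|]; last by rewrite eqxx.
have [/eqP E|] := boolP (_ == content j); last by rewrite eqxx.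
rewrite oner_eq0 /=; apply: contraNT ne => /IH sE; rewrite big_ord_recr /= -sE -E.
by rewrite subnKC // (strip_size st).
Qed.

(** Induction on the letters: adding the strip of one more letter and summing over its outer shape
    is one Pieri rule, whose coefficient is the new factor. The size of the inner shape is known by
    [transfer_size], so the bound [d] is respected. *)
Lemma transfer_sfun (x : nat -> K) j : (\sum_(i < j) content i <= d)%N ->
  \sum_(s : shape) transfer (shape0 n d) content_weight j s * sfun x n s =
  \prod_(i < j) (strip_poly x (strip_bound d (m <= i)%N) n)`_(content i).
Proof.
elim: j => [_|j IH] /=.
  rewrite big_ord0 (bigD1 (shape0 n d)) //= eqxx mul1r big1 ?addr0 => [|s /negPf->];
    last by rewrite mul0r.
  suff -> : forall k, sfun x k (shape0 n d) = 1 by [].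
  elim=> [|k IHk] /=; first by rewrite eqxx.
  rewrite (bigD1 (shape0 n d)) /=; last by apply/hstripP => i; rewrite !srow0.
  rewrite IHk subnn mulr1 big1 ?addr0 // => s /andP[/(@strip_size _ _ false)];
    rewrite ssize0 leqn0.
  by rewrite ssize_eq0 => ->.
rewrite big_ord_recr /= => le.
under eq_bigr do rewrite mulr_suml; rewrite exchange_big big_ord_recr /= -IH;
  last by apply: leq_trans le; apply: leq_addr.
rewrite mulr_suml; apply: eq_bigr => u _.
have [->|/transfer_size su] := eqVneq (transfer (shape0 n d) content_weight j u) 0.
  by rewrite !mul0r big1 // => s _; rewrite !mul0r.
rewrite -mulrA [X in _ * X]mulrC -pieri //; last by rewrite su.
rewrite mulr_sumr [RHS]big_mkcond; apply: eq_bigr => s _ /=.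
rewrite -mulrA /content_weight; case: ifP => [st|_]; last by rewrite mul0r mulr0.
have := strip_size st => les; rewrite -(eqn_add2l (ssize u)) subnKC //=.
by case: eqP; rewrite ?mul1r // mul0r mulr0.
Qed.

Theorem sum_SSMT'_schur (t : 'I_n -> K) :
    (\sum_(i < m) a i + \sum_(j < m') b j = d)%N ->
  \sum_(l : intpart d | (size (parts l) <= n)%N)
    #|SSMT' (parts l) a b|%:R * (schur K n (parts l)).@[t] =
  \prod_(i < m) (strip_poly (natext 0 t) d n)`_(a i) *
  \prod_(j < m') (strip_poly (natext 0 t) 1 n)`_(b j).
Proof.
move=> sd; rewrite -(prod_content
  (fun fl c => (strip_poly (natext 0 t) (strip_bound d fl) n)`_c)).
rewrite -transfer_sfun ?sum_content ?sd //.
(* All other shapes contribute 0: a nonzero transfer sum forces size [d], a nonzero [sfun] forces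
   decreasing rows. *)
rewrite [RHS](bigID (@is_part_shape n d)) /= [X in _ + X]big1 ?addr0.
  by rewrite sum_intpart; apply: eq_bigr => l ln; rewrite card_SSMT' // schur_sfun.
move=> s ns; apply/eqP; rewrite mulf_eq0; apply: contraNT ns; rewrite negb_or.
case/andP => /transfer_size sE nz; apply/andP; split.
  by apply/forallP => i; apply: sfun_partition nz.
by rewrite sE sum_content sd.
Qed.

End Content.
End TableauSums.

Local Open Scope ring_scope.
Local Open Scope sesquilinear_scope.

(** * Decomposition of representations closed under adjoints *)

Section MxSubspace.
Variables (K : fieldType) (k : nat) (X : 'rV[K]_k -> Prop).
Hypotheses (X0 : X 0) (XP : forall c u v, X u -> X v -> X (c *: u + v)).

(** As long as [X] has a vector outside the row space of [M], adjoin it; the rank bounds the number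
    of rounds. *)
Lemma closed_submx : exists M : 'M[K]_k, forall u, X u <-> (u <= M)%MS.
Proof.
suff H r (M : 'M[K]_k) : (k - \rank M <= r)%N -> (forall u, (u <= M)%MS -> X u) ->
    exists M : 'M[K]_k, forall u, X u <-> (u <= M)%MS.
  by apply: (H k 0); rewrite ?leq_subr // => u; rewrite submx0 => /eqP->.
elim: r M => [|r IH] M.
all: have [sXM|] := boolp.EM (forall u, X u -> (u <= M)%MS).
- by exists M => u; split; auto.
- move=> /boolp.existsNP[u /boolp.not_implyP[Xu /negP nuM]]; rewrite leqn0 subn_eq0 => kM.
  case/negP: nuM; apply: submx_full.
  by rewrite /row_full eqn_leq rank_leq_col kM.
- by exists M => u; split; auto.
move=> /boolp.existsNP[u /boolp.not_implyP[Xu /negP nuM]] rM XM.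
apply: (IH (M + u)%MS).
  have ltr : (\rank M < \rank (M + u)%MS)%N.
    rewrite ltnNge; apply: contra nuM => le_r.
    have /eqmxP E : (M == M + u)%MS by rewrite -(geq_leqif (mxrank_leqif_eq (addsmxSl M u))).
    by rewrite E addsmxSr.
  by rewrite -ltnS; apply: leq_trans rM; apply: ltn_sub2l => //;
    apply: leq_trans ltr (rank_leq_col _).
move=> v /sub_addsmxP[[z1 z2] /= ->]; rewrite -[z1 *m M]scale1r; apply: XP.
  by apply: XM; rewrite submxMl.
by rewrite [z2]mx11_scalar mul_scalar_mx -[_ *: u]addr0; apply: XP.
Qed.
End MxSubspace.

Section Reps.
Variables (C : numClosedFieldType) (n : nat).
Local Notation G := {g : 'M[C]_n | g \in unitmx}.

(* Matrices act on row vectors, so that a representation is an                *)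
(* antihomomorphism to matrices.                                              *)
Definition is_mxrep N (rho : 'M[C]_n -> 'M[C]_N) :=
  rho 1%:M = 1%:M /\
  forall g h, g \in unitmx -> h \in unitmx -> rho (g *m h) = rho h *m rho g.

Definition is_starrep N (rho : 'M[C]_n -> 'M[C]_N) :=
  forall g, g \in unitmx -> rho (g ^t*) = (rho g) ^t*.

Definition mxinvariant N (rho : 'M[C]_n -> 'M[C]_N) m (U : 'M[C]_(m, N)) :=
  forall g, g \in unitmx -> (U *m rho g <= U)%MS.

Definition is_mxsimple N (rho : 'M[C]_n -> 'M[C]_N) :=
  (0 < N)%N /\ forall U : 'M[C]_N, mxinvariant rho U -> U = 0 \/ row_full U.

(** Formal linear combinations, compared only through their images under [ga_eval], so like terms
    are never collected. *)
Definition group_alg := seq (C * G).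

Definition ga_eval N (rho : 'M[C]_n -> 'M[C]_N) (a : group_alg) : 'M[C]_N :=
  \sum_(p <- a) p.1 *: rho (val p.2).

Definition ga_scale c (a : group_alg) : group_alg := [seq (c * p.1, p.2) | p <- a].

Lemma valG (g : G) : val g \in unitmx.
Proof. exact: valP g. Qed.

Lemma mulG_unit (p q : G) : val q *m val p \in unitmx.
Proof. by rewrite unitmx_mul !valG. Qed.

(** The group elements are multiplied in the opposite order, which makes [ga_eval] multiplicative
    for antihomomorphisms. *)
Definition ga_mul (a b : group_alg) : group_alg :=
  [seq (p.1 * q.1, exist (fun g => g \in unitmx) _ (mulG_unit p.2 q.2)) | p <- a, q <- b].

Lemma adjG_unit (p : G) : (val p) ^t* \in unitmx.
Proof. by rewrite map_unitmx unitmx_tr valG. Qed.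

Definition ga_star (a : group_alg) : group_alg :=
  [seq (p.1 ^*, exist (fun g => g \in unitmx) _ (adjG_unit p.2)) | p <- a].

Lemma ga_eval_cat N (rho : 'M[C]_n -> 'M[C]_N) a b :
  ga_eval rho (a ++ b) = ga_eval rho a + ga_eval rho b.
Proof. by rewrite /ga_eval big_cat. Qed.

Lemma ga_eval_scale N (rho : 'M[C]_n -> 'M[C]_N) c a :
  ga_eval rho (ga_scale c a) = c *: ga_eval rho a.
Proof.
by rewrite /ga_eval big_map scaler_sumr; apply: eq_bigr => p _; rewrite scalerA.
Qed.

Lemma ga_eval_mul N (rho : 'M[C]_n -> 'M[C]_N) a b : is_mxrep rho ->
  ga_eval rho (ga_mul a b) = ga_eval rho a *m ga_eval rho b.
Proof.
move=> [_ rhoM]; rewrite /ga_eval big_allpairs_dep mulmx_suml.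
apply: eq_bigr => p _; rewrite mulmx_sumr; apply: eq_bigr => q _ /=.
by rewrite rhoM ?valG // -scalemxAl -scalemxAr scalerA.
Qed.

Lemma ga_eval_star N (rho : 'M[C]_n -> 'M[C]_N) a : is_starrep rho ->
  ga_eval rho (ga_star a) = (ga_eval rho a) ^t*.
Proof.
move=> rhoS; rewrite /ga_eval big_map linear_sum /= map_mx_sum.
apply: eq_bigr => p _ /=.
by rewrite rhoS ?valG // linearZ /= map_mxZ.
Qed.

Lemma mxtrace_mulCT_eq0 m k (A : 'M[C]_(m, k)) : \tr (A *m A ^t*) = 0 -> A = 0.
Proof.
rewrite /mxtrace => trA; apply/matrixP => i j; rewrite mxE; apply/eqP.
have ge0 i' j' : 0 <= A i' j' * (A ^t*) j' i' by rewrite !mxE mul_conjC_ge0.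
have sumge0 i' : 0 <= (A *m A ^t*) i' i' by rewrite mxE sumr_ge0.
move/eqP: trA; rewrite psumr_eq0 // => /allP/(_ i); rewrite mem_index_enum => /(_ isT).
rewrite mxE psumr_eq0 // => /allP/(_ j); rewrite mem_index_enum => /(_ isT) /=.
by rewrite !mxE mul_conjC_eq0.
Qed.

Lemma ga_eval_g N (rho : 'M[C]_n -> 'M[C]_N) (g : G) :
  ga_eval rho [:: (1, g)] = rho (val g).
Proof. by rewrite /ga_eval big_seq1 scale1r. Qed.

Definition unitG : G := exist (fun g => g \in unitmx) _ (unitmx1 C n).

(** * Identifying a minimal submodule by density *)

Section Density.
Variables (I : finType) (d : I -> nat) (sigma : forall i, 'M[C]_n -> 'M[C]_(d i)).
Variables (P : {pred I}).
Hypotheses (sigmaP : forall i, i \in P -> is_mxrep (sigma i))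
  (sigmaS : forall i, i \in P -> is_mxsimple (sigma i)).
Variables (N : nat) (rho : 'M[C]_n -> 'M[C]_N) (W : 'M[C]_N) (w : 'rV[C]_N).
Hypotheses (rhoP : is_mxrep rho) (W_inv : mxinvariant rho W)
  (W_min : forall U : 'M[C]_N, mxinvariant rho U -> (U <= W)%MS -> U != 0 -> (W <= U)%MS)
  (wW : (w <= W)%MS) (w_neq0 : w != 0).

Lemma ga_eval_sub a (u : 'rV_N) : (u <= W)%MS -> (u *m ga_eval rho a <= W)%MS.
Proof.
move=> uW; rewrite mulmx_sumr summx_sub // => p _.
rewrite -scalemxAr scalemx_sub // (submx_trans (submxMr _ uW)) //.
exact: W_inv (valG p.2).
Qed.

(* The pairs (v a, w a), for a in the left ideal annihilating vs, form the    *)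
(* graph of an intertwiner from the simple module of v onto W.                *)
Lemma density_step (vs : seq {i : I & 'rV[C]_(d i)}) :
  (forall p, p \in vs -> tag p \in P) ->
  (forall a, (forall p, p \in vs -> tagged p *m ga_eval (sigma (tag p)) a = 0) ->
     w *m ga_eval rho a = 0) ->
  exists i, i \in P /\ exists phi : 'M[C]_(d i, N),
    [/\ row_free phi, (phi :=: W)%MS &
        forall g, g \in unitmx -> phi *m rho g = sigma i g *m phi].
Proof.
elim: vs => [|[i v] vs IH] vsP vsK.
  have := vsK [:: (1, unitG)]; move=> /(_ (fun p pnil => False_ind _ (notF pnil))).
  by rewrite ga_eval_g /= (proj1 rhoP) mulmx1 => /eqP; rewrite (negPf w_neq0).
have iP : i \in P by apply: (vsP (Tagged (fun i => 'rV[C]_(d i)) v)); rewrite mem_head.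
pose kills a := forall p, p \in vs -> tagged p *m ga_eval (sigma (tag p)) a = 0.
have [vsK'|] := boolp.EM (forall a, kills a -> w *m ga_eval rho a = 0).
  by apply: IH => // p pvs; apply: vsP; rewrite in_cons pvs orbT.
move=> /boolp.existsNP[a0 /boolp.not_implyP[a0K wa0]].
pose X (u : 'rV[C]_(d i + N)) := exists2 a, kills a &
  u = row_mx (v *m ga_eval (sigma i) a) (w *m ga_eval rho a).
have [|c u u' [a aK ->] [b bK ->]|M MP] := @closed_submx _ _ X.
- by exists [::] => [p _|]; rewrite /ga_eval !big_nil !mulmx0 ?row_mx0.
- exists (ga_scale c a ++ b) => [p pvs|].
    by rewrite ga_eval_cat ga_eval_scale mulmxDr -scalemxAr aK // bK // scaler0 addr0.
  rewrite !ga_eval_cat !ga_eval_scale !mulmxDr -!scalemxAr scale_row_mx.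
  by rewrite add_row_mx.
pose M1 := lsubmx M; pose M2 := rsubmx M.
have XM (u : 'rV_(d i + N)) : X (u *m M) by apply/MP; rewrite submxMl.
have XE a : kills a -> exists u : 'rV_(d i + N),
    v *m ga_eval (sigma i) a = u *m M1 /\ w *m ga_eval rho a = u *m M2.
  move=> aK; have : X (row_mx (v *m ga_eval (sigma i) a) (w *m ga_eval rho a)) by exists a.
  move=> /MP/submxP[u uE]; exists u; rewrite mulmx_lsub mulmx_rsub -uE.
  by rewrite row_mxKl row_mxKr.
have X12 (u : 'rV_(d i + N)) : exists2 a, kills a &
    u *m M1 = v *m ga_eval (sigma i) a /\ u *m M2 = w *m ga_eval rho a.
  have [a aK uE] := XM u; exists a => //; rewrite mulmx_lsub mulmx_rsub uE.
  by rewrite row_mxKl row_mxKr.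
have killsM a (g : G) : kills a -> kills (ga_mul a [:: (1, g)]).
  move=> aK p pvs; have pP : tag p \in P by apply: vsP; rewrite in_cons pvs orbT.
  by rewrite ga_eval_mul ?mulmxA ?aK ?mul0mx //; apply: sigmaP.
have kills0 a : kills a -> v *m ga_eval (sigma i) a = 0 -> w *m ga_eval rho a = 0.
  move=> aK va0; apply: vsK => p; rewrite in_cons => /predU1P[->//|]; exact: aK.
have [phi M12] : exists phi, M1 *m phi = M2.
  exists (pinvmx M1 *m M2).
  have : (kermx M1 <= kermx M2)%MS.
    apply/row_subP => l; apply/sub_kermxP; set u := row l _.
    have [a aK [u1 u2]] := X12 u; rewrite u2 kills0 // -u1.
    by apply/sub_kermxP; rewrite row_sub.
  move=> sK; apply/eqP; rewrite -subr_eq0 -[X in _ - X]mul1mx mulmxA -mulmxBl.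
  apply/eqP/sub_kermxP; apply: submx_trans sK; apply/sub_kermxP.
  by rewrite mulmxBl mulmxKpV // mul1mx subrr.
have M1_inv : mxinvariant (sigma i) <<M1>>%MS.
  move=> g gU; rewrite !genmxE (eqmxMr _ (genmxE _)); apply/row_subP => l.
  rewrite row_mul rowE; have [a aK [-> _]] := X12 (delta_mx 0 l).
  have [u [uE _]] := XE _ (killsM a (exist _ g gU) aK).
  move: uE; rewrite ga_eval_mul; last exact: sigmaP.
  by rewrite ga_eval_g mulmxA /= => ->; rewrite submxMl.
(* By simplicity it is enough that [M1] is nonzero; if it were zero, [a0] would kill [v] as well and
   hence, by [kills0], also [w]. *)
have M1_full : row_full M1.
  have [|] := (sigmaS iP).2 _ M1_inv; last by rewrite /row_full mxrank_gen.
  move=> /eqP; rewrite -submx0 genmxE submx0 => /eqP M10.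
  have [u [v0 _]] := XE _ a0K; case: wa0; apply: kills0 => //.
  by rewrite v0 M10 mulmx0.
have phiE g : g \in unitmx -> phi *m rho g = sigma i g *m phi.
  move=> gU; apply: (row_full_inj M1_full); apply/row_matrixP => l.
  rewrite !rowE !mulmxA -(mulmxA _ _ phi) M12; set u := delta_mx 0 l.
  have [a aK [u1 u2]] := X12 u; rewrite u2 u1.
  have [u' []] := XE _ (killsM a (exist _ g gU) aK).
  rewrite ga_eval_mul; last exact: sigmaP.
  by rewrite ga_eval_mul // !ga_eval_g !mulmxA /= => -> ->; rewrite -mulmxA M12.
have phi_neq0 : phi != 0.
  apply/eqP => phi0; have [u [_ w0]] := XE _ a0K; case: wa0.
  by rewrite w0 -M12 phi0 mulmx0 mulmx0.
exists i; split=> //; exists phi.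
have phi_free : row_free phi.
  have [||] := (sigmaS iP).2 (kermx phi).
  - move=> g gU; apply/sub_kermxP.
    by rewrite -mulmxA -phiE // mulmxA mulmx_ker mul0mx.
  - by move/eqP; rewrite kermx_eq0.
  move=> kfull; case/eqP: phi_neq0; apply: (row_full_inj kfull).
  by rewrite mulmx_ker mulmx0.
have phiW : (phi <= W)%MS.
  have M2W : (M2 <= W)%MS.
    apply/row_subP => l; rewrite rowE; have [a aK [_ ->]] := X12 (delta_mx 0 l).
    exact: ga_eval_sub.
  by rewrite (submx_trans _ M2W) // -M12 -[X in (X <= _)%MS](mul1mx phi) -(mulVpmx M1_full)
    -mulmxA submxMl.
split=> //; apply/eqmxP; rewrite phiW /= -(genmxE phi); apply: W_min.
- by move=> g gU; rewrite genmxE (eqmxMr _ (genmxE _)) phiE // submxMl.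
- by rewrite genmxE.
- by rewrite -submx0 genmxE submx0.
Qed.


(** Take for [vs] a basis of every [sigma i] together: an [a] killing all these vectors acts as zero
    on every [sigma i]. *)
Lemma density :
  (forall a, (forall i, i \in P -> ga_eval (sigma i) a = 0) -> ga_eval rho a = 0) ->
  exists i, i \in P /\ exists phi : 'M[C]_(d i, N),
    [/\ row_free phi, (phi :=: W)%MS &
        forall g, g \in unitmx -> phi *m rho g = sigma i g *m phi].
Proof.
move=> killP.
pose vs := [seq Tagged (fun i => 'rV[C]_(d i)) (row l 1%:M) | i <- enum P, l <- enum 'I_(d i)].
apply: (@density_step vs) => [p /allpairsPdep[i [l [iP _ ->]]]|a aK].
  by rewrite mem_enum in iP.
rewrite killP ?mulmx0 // => i iP; apply/row_matrixP => l.
rewrite row0 -[ga_eval _ _]mul1mx row_mul.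
apply: (aK (Tagged (fun i => 'rV[C]_(d i)) (row l 1%:M))).
by apply/allpairsPdep; exists i, l; rewrite !mem_enum.
Qed.

End Density.

Lemma minimal_mxinvariant N (rho : 'M[C]_n -> 'M[C]_N) : (0 < N)%N ->
  exists W : 'M[C]_N, [/\ mxinvariant rho W, W != 0 &
    forall U : 'M[C]_N, mxinvariant rho U -> (U <= W)%MS -> U != 0 -> (W <= U)%MS].
Proof.
move=> N_gt0.
have : exists W : 'M[C]_N, mxinvariant rho W /\ W != 0.
  exists 1%:M; split=> [g _|]; first exact: submx1.
  by rewrite -mxrank_eq0 mxrank1 -lt0n.
case=> W; have [r] := ubnP (\rank W); elim: r W => // r IH W.
rewrite ltnS => rW [Winv W0].
have [Wmin|] := boolp.EM
    (forall U : 'M[C]_N, mxinvariant rho U -> (U <= W)%MS -> U != 0 -> (W <= U)%MS).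
  by exists W.
move=> /boolp.existsNP[U /boolp.not_implyP[Uinv /boolp.not_implyP[UW]]].
move=> /boolp.not_implyP[U0 /negP nWU]; apply: (IH U) => //.
apply: leq_trans rW; rewrite ltnNge; apply: contra nWU => le_r.
have /eqmxP E : (U == W)%MS by rewrite -(geq_leqif (mxrank_leqif_eq UW)).
by rewrite E.
Qed.

Lemma mulCT m k l (A : 'M[C]_(m, k)) (B : 'M[C]_(k, l)) :
  (A *m B) ^t* = B ^t* *m A ^t*.
Proof. by rewrite trmx_mul map_mxM. Qed.

(** The rows of [B] are an orthonormal basis of the image of the orthogonal projection [Q]. The
    product [B ^t* *m B *m Q] is [Q], by taking the adjoint of [QB], and also [B ^t* *m B], by
    [BQB]. *)
Lemma unitary_basis N (Q : 'M[C]_N) : Q ^t* = Q -> Q *m Q = Q ->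
  exists k (B : 'M[C]_(k, N)), B \is unitarymx /\ B ^t* *m B = Q.
Proof.
move=> Qs QQ; exists (\rank Q), (schmidt (row_base Q)).
set B := schmidt _; have BU : B \is unitarymx by rewrite schmidt_unitarymx ?rank_leq_col.
split=> //; have BQ : (B :=: Q)%MS.
  by apply: eqmx_trans (eq_row_base Q); apply/eqmx_schmidt_free/row_base_free.
have /submxP[Z BE] : (B <= Q)%MS by rewrite BQ.
have /submxP[Y QE] : (Q <= B)%MS by rewrite BQ.
have BQB : B *m Q = B by rewrite BE -mulmxA QQ.
have QB : Q *m (B ^t* *m B) = Q by rewrite mulmxA [X in X *m _ *m _]QE mulmxtVK.
have : (Q *m (B ^t* *m B)) ^t* = Q by rewrite QB.
by rewrite mulCT mulCT trmxCK Qs -mulmxA BQB.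
Qed.

Lemma starrep_sub N (rho : 'M[C]_n -> 'M[C]_N) k (B : 'M[C]_(k, N)) :
    is_mxrep rho -> is_starrep rho -> B \is unitarymx ->
    (forall g, g \in unitmx -> B *m rho g = B *m rho g *m B ^t* *m B) ->
  is_mxrep (fun g => B *m rho g *m B ^t*) /\
  is_starrep (fun g => B *m rho g *m B ^t*).
Proof.
move=> [rho1 rhoM] rhoS BU Binv; split; last first.
  by move=> g gU; rewrite rhoS // !mulCT trmxCK mulmxA.
split=> [|g h gU hU]; first by rewrite rho1 mulmx1 (unitarymxP BU).
by rewrite rhoM // (mulmxA B) [in LHS]Binv // !mulmxA.
Qed.

Section Decomposition.
Variables (I : finType) (d : I -> nat) (sigma : forall i, 'M[C]_n -> 'M[C]_(d i)).

Lemma mxtrace_ga_eval N (rho : 'M[C]_n -> 'M[C]_N) (P : {pred I}) a :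
  (forall g, g \in unitmx -> \tr (rho g) = \sum_(i in P) \tr (sigma i g)) ->
  \tr (ga_eval rho a) = \sum_(i in P) \tr (ga_eval (sigma i) a).
Proof.
move=> trE; rewrite linear_sum.
under [RHS]eq_bigr do rewrite linear_sum; rewrite [RHS]exchange_big; apply: eq_bigr => p _ /=.
by rewrite linearZ /= trE ?valG // mulr_sumr; apply: eq_bigr => i _; rewrite linearZ.
Qed.

(** Induction on the number of summands; the trace at 1 gives the dimension, so no summands means
    dimension 0. Otherwise a minimal invariant subspace is a copy of some [sigma i] by [density].
    Its orthogonal complement is invariant, is again closed under adjoints, and has as trace the sum
    over the remaining indices. [pi] and [iota] are the projections and inclusions of the resulting
    direct sum. *)
Lemma starrep_decomposition (P : {set I}) N (rho : 'M[C]_n -> 'M[C]_N) :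
    (forall i, i \in P -> is_mxrep (sigma i)) ->
    (forall i, i \in P -> is_mxsimple (sigma i)) ->
    is_mxrep rho -> is_starrep rho ->
    (forall g, g \in unitmx -> \tr (rho g) = \sum_(i in P) \tr (sigma i g)) ->
  exists (pi : forall i, 'M[C]_(N, d i)) (iota : forall i, 'M[C]_(d i, N)),
    [/\ forall i g, i \in P -> g \in unitmx -> rho g *m pi i = pi i *m sigma i g,
        forall i, i \in P -> iota i *m pi i = 1%:M,
        forall i j, i \in P -> j \in P -> i != j -> iota i *m pi j = 0 &
        \sum_(i in P) pi i *m iota i = 1%:M].
Proof.
have [c] := ubnP #|P|; elim: c P N rho => // c IH P N rho.
rewrite ltnS => leP sigmaP sigmaS rhoP rhoS trE.
have trN : N%:R = \sum_(i in P) (d i)%:R :> C.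
  rewrite -(@mxtrace1 C N) -(proj1 rhoP) trE ?unitmx1 //.
  by apply: eq_bigr => i iP; rewrite (proj1 (sigmaP i iP)) mxtrace1.
have [P0|[i1 i1P]] := set_0Vmem P.
  have N0 : N = 0%N by apply/eqP; rewrite -(@pnatr_eq0 C) trN P0 big_set0.
  exists (fun i => 0), (fun i => 0); subst P; split=> [i|i|i|]; rewrite ?inE //.
  by rewrite big_set0; subst N; apply/matrixP => - [].
have N_gt0 : (0 < N)%N.
  rewrite lt0n -(@pnatr_eq0 C) trN -natr_sum pnatr_eq0 (bigD1 i1) //= addn_eq0.
  by rewrite negb_and -lt0n (proj1 (sigmaS i1 i1P)).
have [W [Winv W0 Wmin]] := minimal_mxinvariant rho N_gt0.
have /rowV0Pn[w wW w0] := W0.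
(* Both sides of [trE] vanish at [ga_mul a (ga_star a)]. *)
have killP a : (forall i, i \in P -> ga_eval (sigma i) a = 0) -> ga_eval rho a = 0.
  move=> aK; apply: mxtrace_mulCT_eq0.
  rewrite -ga_eval_star // -ga_eval_mul // (mxtrace_ga_eval _ trE) big1 // => i iP.
  by rewrite ga_eval_mul ?aK ?mul0mx ?linear0 //; apply: sigmaP.
have [i [iP [phi [phi_free _ phiE]]]] := density sigmaP sigmaS rhoP Winv Wmin wW w0 killP.
have le_dN : (d i <= N)%N by rewrite -(eqP phi_free) rank_leq_col.
have [B [BU Bphi]] : exists B : 'M_(d i, N), B \is unitarymx /\ (B :=: phi)%MS.
  by exists (schmidt phi); split; [apply: schmidt_unitarymx | apply: eqmx_schmidt_free].
(* The intertwiner [phi] need not be unitary; [Y] and [Z] change between its rows and the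
   orthonormal basis [B] of the same subspace. *)
have /submxP[Y BE] : (B <= phi)%MS by rewrite Bphi.
have /submxP[Z phiB] : (phi <= B)%MS by rewrite Bphi.
have ZY : Z *m Y = 1%:M.
  by apply: (row_free_inj phi_free); rewrite -mulmxA -BE -phiB mul1mx.
have BB : B *m B ^t* = 1%:M by apply/unitarymxP.
have phiBC : phi *m B ^t* = Z by rewrite phiB mulmxtVK.
pose R g := B *m rho g *m B ^t*.
have RE g : g \in unitmx -> R g = Y *m sigma i g *m Z.
  by move=> gU; rewrite /R [X in X *m _ *m _]BE -!mulmxA (mulmxA phi) phiE // -mulmxA phiBC. 
have BrhoE g : g \in unitmx -> B *m rho g = R g *m B.
  by move=> gU; rewrite RE // -!mulmxA -phiB -phiE // mulmxA -BE. 
have gCU (g : 'M[C]_n) : g \in unitmx -> g ^t* \in unitmx.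
  by move=> gU; rewrite map_unitmx unitmx_tr.
(* The adjoint of [BrhoE] taken at [g ^t*]; this is what makes the orthogonal complement
   invariant. *)
have rhoBC g : g \in unitmx -> rho g *m B ^t* = B ^t* *m R g.
  move=> gU; have := BrhoE _ (gCU g gU); rewrite rhoS // => /(congr1 (fun A => A ^t*)).
  by rewrite !mulCT !trmxCK => ->; rewrite /R rhoS // trmxCK -mulmxA.
pose Q := 1%:M - B ^t* *m B.
have [||k [B2 [B2U B2Q]]] := @unitary_basis _ Q.
- by rewrite /Q linearB /= map_mxB trmx1 map_mx1 mulCT trmxCK.
- rewrite /Q mulmxBl !mulmxBr !mulmx1 !mul1mx mulmxA -(mulmxA _ B) BB mulmx1.
  by rewrite subrr subr0.
have B2BC : B2 *m B ^t* = 0.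
  have : B2 *m Q *m B ^t* = 0.
    by rewrite /Q -mulmxA mulmxBl mul1mx -mulmxA BB mulmx1 subrr mulmx0.
  by rewrite -B2Q mulmxA (unitarymxP B2U) mul1mx.
have BB2C : B *m B2 ^t* = 0.
  by rewrite -[LHS]trmxCK mulCT trmxCK B2BC trmx0 map_mx0.
have Q1 : B ^t* *m B + B2 ^t* *m B2 = 1%:M by rewrite B2Q /Q addrC subrK.
pose R2 g := B2 *m rho g *m B2 ^t*.
have B2rhoE g : g \in unitmx -> B2 *m rho g = R2 g *m B2.
  move=> gU; rewrite -[LHS]mulmx1 -Q1 mulmxDr !mulmxA -(mulmxA B2) rhoBC //.
  by rewrite !mulmxA B2BC !mul0mx add0r.
have [R2P R2S] := starrep_sub rhoP rhoS B2U B2rhoE.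
have [||||||pi [iota [piE iotapi iotapi0 piiota]]] := IH (P :\ i) k R2.
- by move: leP; rewrite (cardsD1 i) iP.
- by move=> j; rewrite inE => /andP[_]; apply: sigmaP.
- by move=> j; rewrite inE => /andP[_]; apply: sigmaS.
- exact: R2P.
- exact: R2S.
- move=> g gU; apply: (addrI (\tr (sigma i g))).
  rewrite -(big_setD1 i iP) -trE //=.
  rewrite -[in RHS](mulmx1 (rho g)) -Q1 mulmxDr linearD /= !mulmxA.
  have -> : \tr (rho g *m B ^t* *m B) = \tr (sigma i g).
    by rewrite mxtrace_mulC mulmxA -/(R g) RE // mxtrace_mulC mulmxA ZY mul1mx.
  by rewrite [\tr (_ *m B2)]mxtrace_mulC mulmxA.
(* The families obtained on the complement are carried back by [B2], and the summand [i] is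
   inserted. *)
exists (dfwith (fun j => B2 ^t* *m pi j) (B ^t* *m Y)).
exists (dfwith (fun j => iota j *m B2) phi).
have dfi T (f : forall j, T j) (x : T i) : dfwith f x i = x by rewrite dfwith_in.
have dfo T (f : forall j, T j) (x : T i) j : i != j -> dfwith f x j = f j.
  by move=> ij; rewrite dfwith_out.
split=> [j g jP gU|j jP|j l jP lP|].
- have [<-|ij] := eqVneq i j.
    rewrite !dfi mulmxA rhoBC // -mulmxA RE // -!mulmxA.
    by rewrite ZY mulmx1.
  rewrite !dfo // -mulmxA -piE ?inE 1?eq_sym ?ij // !mulmxA.
  rewrite -[X in X *m _ *m _]mul1mx -Q1 !mulmxDl.
  have -> : B ^t* *m B *m rho g *m B2 ^t* = 0.
    by rewrite -mulmxA -mulmxA (mulmxA B) BrhoE // -mulmxA BB2C !mulmx0.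
  by rewrite mul0mx add0r.
- have [<-|ij] := eqVneq i j; first by rewrite !dfi mulmxA phiBC.
  rewrite !dfo // mulmxA -(mulmxA (iota j)) (unitarymxP B2U) mulmx1.
  by rewrite iotapi // !inE eq_sym ij.
- have [<-|ij] := eqVneq i j => jl.
    by rewrite dfi dfo // phiB mulmxA -(mulmxA Z) BB2C mulmx0 mul0mx.
  have [il|il] := eqVneq i l.
    by subst l; rewrite dfi dfo // mulmxA -(mulmxA (iota j)) B2BC mulmx0 mul0mx.
  rewrite !dfo // mulmxA -(mulmxA (iota j)) (unitarymxP B2U) mulmx1.
  by rewrite iotapi0 // !inE 1?eq_sym ?ij ?il ?jP ?lP //.
- rewrite (big_setD1 i iP) /= !dfi -mulmxA -BE -Q1; congr (_ + _).
  rewrite -[in RHS](mulmx1 (B2 ^t*)) -piiota mulmx_sumr mulmx_suml; apply: eq_bigr => j.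
  by rewrite !inE => /andP[ji _]; rewrite !dfo 1?eq_sym // !mulmxA.
Qed.

End Decomposition.
End Reps.

(** * Class functions vanishing on the torus *)

Section LinePoly.
Variables (C : numClosedFieldType) (n : nat).
Implicit Types (A B g : 'M[C]_n) (f : 'M[C]_n -> C).

(** A weak form of being polynomial in the entries: it constrains values at invertible matrices
    only, is stable under sums and products, and is all that a perturbation argument needs. *)
Definition line_poly f := forall A B, exists Q : {poly C},
  forall e, A + e *: B \in unitmx -> f (A + e *: B) = Q.[e].

Lemma line_poly_const c : line_poly (fun=> c).
Proof. by move=> A B; exists c%:P => e _; rewrite hornerC. Qed.

Lemma line_poly_entry i j : line_poly (fun g => g i j).
Proof.
move=> A B; exists ((A i j)%:P + (B i j) *: 'X) => e _.
by rewrite !mxE !hornerE mulrC.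
Qed.

Lemma line_polyD f1 f2 : line_poly f1 -> line_poly f2 -> line_poly (fun g => f1 g + f2 g).
Proof.
move=> f1P f2P A B; have [[Q1 E1] [Q2 E2]] := (f1P A B, f2P A B).
by exists (Q1 + Q2) => e eU; rewrite hornerD E1 ?E2.
Qed.

Lemma line_polyM f1 f2 : line_poly f1 -> line_poly f2 -> line_poly (fun g => f1 g * f2 g).
Proof.
move=> f1P f2P A B; have [[Q1 E1] [Q2 E2]] := (f1P A B, f2P A B).
by exists (Q1 * Q2) => e eU; rewrite hornerM E1 ?E2.
Qed.

Lemma line_poly_sum (J : Type) (r : seq J) (P : pred J) (F : J -> 'M[C]_n -> C) :
  (forall j, P j -> line_poly (F j)) -> line_poly (fun g => \sum_(j <- r | P j) F j g).
Proof.
move=> FP; elim: r => [|j r IH] A B.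
  by exists 0 => e _; rewrite big_nil horner0.
have [Q2 E2] := IH A B; have [Pj|nPj] := boolP (P j).
  have [Q1 E1] := FP j Pj A B.
  by exists (Q1 + Q2) => e eU; rewrite big_cons Pj hornerD E1 ?E2.
by exists Q2 => e eU; rewrite big_cons (negPf nPj) E2.
Qed.

Lemma line_poly_prod (J : Type) (r : seq J) (P : pred J) (F : J -> 'M[C]_n -> C) :
  (forall j, P j -> line_poly (F j)) -> line_poly (fun g => \prod_(j <- r | P j) F j g).
Proof.
move=> FP; elim: r => [|j r IH] A B.
  by exists 1 => e _; rewrite big_nil hornerC.
have [Q2 E2] := IH A B; have [Pj|nPj] := boolP (P j).
  have [Q1 E1] := FP j Pj A B.
  by exists (Q1 * Q2) => e eU; rewrite big_cons Pj hornerM E1 ?E2.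
by exists Q2 => e eU; rewrite big_cons (negPf nPj) E2.
Qed.

Lemma poly_eq0_values (Q : {poly C}) : (forall e, Q.[e] = 0) -> Q = 0.
Proof.
move=> Q0; apply/eqP/negPn/negP => nz.
have := max_poly_roots nz (rs := [seq k%:R | k <- iota 0 (size Q)]).
rewrite size_map size_iota ltnn => /(_ _ _)/notF; apply.
  by apply/allP => e _; rewrite /root Q0.
by rewrite map_inj_uniq ?iota_uniq //; exact: mulrIn (oner_neq0 C).
Qed.

Lemma distinct_trig_diagonalizable n' (A : 'M[C]_n'.+1) : is_trig_mx A ->
  injective (fun i => A i i) -> diagonalizable A.
Proof.
move=> Atrig Ainj; apply/diagonalizableP; exists [seq A i i | i <- enum 'I_n'.+1].
  by rewrite map_inj_uniq ?enum_uniq.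
rewrite big_map big_enum /= -char_poly_trig //; exact: mxminpoly_dvd_char.
Qed.

End LinePoly.

Section ClassFunction.
Variables (C : numClosedFieldType) (n' : nat).
Local Notation n := n'.+1.
Variable f : 'M[C]_n -> C.
Hypotheses (f_line : line_poly f)
  (f_class : forall g p, g \in unitmx -> p \in unitmx -> f (p *m g *m invmx p) = f g)
  (f_diag : forall t : 'rV[C]_n, (forall i, t 0 i != 0) -> f (diag_mx t) = 0).

Lemma class_fun_diagonalizable g : g \in unitmx -> diagonalizable g -> f g = 0.
Proof.
move=> gU [p pU /similar_diagPex[t]]; rewrite /similar_to => /eqP.
rewrite conjumx // => E; have tU : diag_mx t \in unitmx.
  by rewrite -E !unitmx_mul pU gU unitmx_inv.
rewrite -(@f_class g p) // E f_diag // => i.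
move: tU; rewrite unitmxE det_diag unitfE; apply: contraNneq => ti.
by rewrite (bigD1 i) //= ti mul0r.
Qed.

(* A triangular matrix becomes diagonalizable under almost every perturbation *)
(* by a multiple of diag(1, ..., n).                                          *)
Lemma class_fun_trig g : g \in unitmx -> is_trig_mx g -> f g = 0.
Proof.
move=> gU gT; pose D : 'M[C]_n := diag_mx (\row_i i.+1%:R).
have [Q QE] := f_line g D.
(* The roots of [Bad] include every e at which the perturbed matrix is singular or has a repeated
   diagonal entry. The slopes 1, ..., n are nonzero and distinct, so no factor is zero. *)
pose Bad : {poly C} := (\prod_i ((g i i)%:P + i.+1%:R *: 'X)) *
  \prod_i \prod_(j | j != i) ((g i i - g j j)%:P + (i.+1%:R - j.+1%:R) *: 'X).
have lin_neq0 (c d : C) : d != 0 -> c%:P + d *: 'X != 0.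
  move=> d0; apply: contraNneq d0 => /(congr1 (fun p : {poly C} => p`_1)).
  by rewrite coefD coefC coefZ coefX mulr1 add0r coef0 => ->.
have Bad0 : Bad != 0.
  rewrite mulf_neq0 //.
    by apply/prodf_neq0 => i _; apply: lin_neq0; rewrite pnatr_eq0.
  apply/prodf_neq0 => i _; apply/prodf_neq0 => j ji; apply: lin_neq0.
  by rewrite subr_eq0 eqr_nat eqSS eq_sym.
have entE e i j : (g + e *: D) i j = g i j + e * (i.+1%:R *+ (i == j)).
  rewrite !mxE; congr (_ + _ * _).
have gT' e : is_trig_mx (g + e *: D).
  apply/is_trig_mxP => i j ij; rewrite entE (is_trig_mxP gT) // add0r.
  by rewrite -val_eqE ltn_eqF // mulr0n mulr0.
have good e : Bad.[e] != 0 -> Q.[e] = 0.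
  rewrite hornerM mulf_eq0 negb_or !horner_prod => /andP[/prodf_neq0 nz /prodf_neq0 dist].
  have eU : g + e *: D \in unitmx.
    rewrite unitmxE det_trig // unitfE; apply/prodf_neq0 => i _.
    by have := nz i isT; rewrite entE eqxx !hornerE mulrC.
  rewrite -QE // class_fun_diagonalizable //.
  apply: distinct_trig_diagonalizable => // i j /eqP; rewrite !entE !eqxx => E.
  apply/eqP; apply: contraTT E => ji; have := dist i isT.
  rewrite horner_prod => /prodf_neq0/(_ j); rewrite eq_sym => /(_ ji).
  rewrite !hornerE mulrBl addrACA -opprD subr_eq0 => d.
  by rewrite !mulr1n !(mulrC e).
(* The value wanted is that of [Q] at 0, which may be a root of [Bad]; hence the whole polynomial is
   shown to vanish. *)
have Q0 : Q = 0.
  have /eqP : Q * Bad = 0.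
    apply: poly_eq0_values => e; rewrite hornerM.
    by have [->|/good ->] := eqVneq Bad.[e] 0; rewrite ?mulr0 ?mul0r.
  by rewrite mulf_eq0 (negPf Bad0) orbF => /eqP.
by rewrite -[g]addr0 -(scale0r D) QE ?scale0r ?addr0 // Q0 horner0.
Qed.

Lemma class_fun_eq0 g : g \in unitmx -> f g = 0.
Proof.
move=> gU; have [p pU] := Schur g (ltn0Sn n').
have {}pU : p \in unitmx by apply: unitarymx_unit.
rewrite /similar_to conjumx // => T.
by rewrite -(@f_class g p) // class_fun_trig // !unitmx_mul pU gU unitmx_inv.
Qed.

End ClassFunction.

Lemma class_fun_unit_eq0 (C : numClosedFieldType) (n : nat) (f : 'M[C]_n -> C) g :
    (0 < n)%N -> line_poly f ->
    (forall g p, g \in unitmx -> p \in unitmx -> f (p *m g *m invmx p) = f g) ->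
    (forall t : 'rV[C]_n, (forall i, t 0 i != 0) -> f (diag_mx t) = 0) ->
  g \in unitmx -> f g = 0.
Proof. by case: n f g => // n' f g _ *; apply: class_fun_eq0. Qed.

(** * Quotients of representations closed under adjoints *)

Section Quotient.
Variables (C : numClosedFieldType) (n N J : nat).
Variables (rho : 'M[C]_n -> 'M[C]_N) (T : 'M[C]_(N, J)).
Hypotheses (rhoP : is_mxrep rho) (rhoS : is_starrep rho) (T_full : row_full T).
Hypothesis T_inv : forall g (u : 'rV[C]_N), g \in unitmx -> u *m T = 0 -> u *m rho g *m T = 0.

(* The quotient of the representation rho by ker T is realized on the         *)
(* orthogonal complement of ker T, of which B is an orthonormal basis.        *)
Lemma starrep_quotient : exists k (B : 'M[C]_(k, N)) (X : 'M[C]_(J, k)),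
  let R g := B *m rho g *m B ^t* in
  [/\ is_mxrep R, is_starrep R, (B *m T) *m X = 1%:M, X *m (B *m T) = 1%:M &
      forall g, g \in unitmx -> R g *m (B *m T) = B *m rho g *m T].
Proof.
pose K1 := schmidt (row_base (kermx T)).
have K1U : K1 \is unitarymx by rewrite schmidt_unitarymx ?rank_leq_col.
have K1T : (K1 :=: kermx T)%MS.
  by apply: eqmx_trans (eq_row_base _); apply/eqmx_schmidt_free/row_base_free.
pose E := K1 ^t* *m K1.
have ET : E *m T = 0.
  have K1T0 : K1 *m T = 0 by apply/sub_kermxP; rewrite K1T.
  by rewrite -mulmxA K1T0 mulmx0.
have Eid l (y : 'M_(l, N)) : y *m T = 0 -> y *m E = y.
  move=> /sub_kermxP; rewrite -K1T => /submxP[z ->].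
  by rewrite /E -mulmxA (mulmxA K1) (unitarymxP K1U) mul1mx.
have ES : E ^t* = E by rewrite /E mulCT trmxCK.
have EE : E *m E = E by apply: Eid.
clearbody E.
have ErhoT g : g \in unitmx -> E *m rho g *m T = 0.
  move=> gU; apply/row_matrixP => i; rewrite row0 (row_mul i (E *m _)) (row_mul i E).
  by apply: T_inv; rewrite // -row_mul ET row0.
have Erho g : g \in unitmx -> E *m rho g *m E = E *m rho g.
  by move=> gU; apply: Eid; apply: ErhoT.
pose Q := 1%:M - E.
have [||k [B [BU BQ]]] := @unitary_basis _ _ Q.
- by rewrite /Q linearB /= map_mxB trmx1 map_mx1 ES.
- by rewrite /Q mulmxBl !mulmxBr !mulmx1 !mul1mx EE subrr subr0.
have BE : B *m E = 0.
  have : B *m Q = B by rewrite -BQ mulmxA (unitarymxP BU) mul1mx.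
  rewrite /Q mulmxBr mulmx1 => /eqP; rewrite -subr_eq0 addrAC subrr add0r oppr_eq0.
  by move/eqP.
have QT : Q *m T = T by rewrite /Q mulmxBl ET subr0 mul1mx.
(* The adjoint of [Erho] taken at [g ^t*]: the orthogonal complement of the kernel is invariant
   too. *)
have rhoE g : g \in unitmx -> E *m (rho g *m E) = rho g *m E.
  move=> gU; have gCU : g ^t* \in unitmx by rewrite map_unitmx unitmx_tr.
  have := Erho _ gCU; rewrite rhoS // => /(congr1 (fun A => A ^t*)).
  by rewrite !mulCT !trmxCK !ES.
have Binv g : g \in unitmx -> B *m rho g = B *m rho g *m B ^t* *m B.
  move=> gU; rewrite -mulmxA BQ /Q mulmxBr mulmx1 -(mulmxA B) -rhoE // !mulmxA BE.
  by rewrite !mul0mx subr0.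
have [RP RS] := starrep_sub rhoP rhoS BU Binv.
have Xfree : row_free (B *m T).
  apply/inj_row_free => v; rewrite mulmxA => /Eid.
  rewrite -mulmxA BE mulmx0 => /(congr1 (mulmx^~ (B ^t*))).
  by rewrite mul0mx mulmxtVK.
have Xfull : row_full (B *m T).
  have TE : T = B ^t* *m (B *m T) by rewrite mulmxA BQ QT.
  by rewrite -sub1mx (submx_trans _ (submxMl (B ^t*) _)) // -TE sub1mx.
exists k, B, (pinvmx (B *m T)); split=> //.
- exact: mulmxVp.
- exact: mulVpmx.
- by move=> g gU; rewrite mulmxA -Binv.
Qed.

End Quotient.

(** * Superpolynomials as a quotient of tensor space *)

Lemma mxvec_index_bij (n k : nat) : bijective (fun p : 'I_n * 'I_k => mxvec_index p.1 p.2).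
Proof.
apply: inj_card_bij => [[i j] [i' j'] /= /eqP|]; last by rewrite card_prod !card_ord.
by rewrite mxvec_index_eq => /andP[/eqP-> /eqP->].
Qed.

Section Words.
Variables (C : numClosedFieldType) (n m m' d : nat).
Local Notation E := (superpoly C (n * m) (n * m')).
Local Notation col := ('I_m + 'I_m')%type.
Local Notation var := ('I_n * col)%type.
Local Notation word := {ffun 'I_d -> var}.
Implicit Types (g h : 'M[C]_n) (v : var) (w : word).

Definition spvar v : E :=
  match v.2 with
  | inl j => spX C (n * m') (mxvec_index v.1 j)
  | inr j => spTheta C (n * m) (mxvec_index v.1 j)
  end.

(** The matrix of g on the tensor product of C^n with the space of column labels, g acting on the
    first factor. *)
Definition var_coef g v' v : C := g v'.1 v.1 *+ (v'.2 == v.2).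

Lemma sp_act_var g v : sp_act g (spvar v) = \sum_v' var_coef g v' v *: spvar v'.
Proof.
have -> : \sum_v' var_coef g v' v *: spvar v' = \sum_(l < n) g l v.1 *: spvar (l, v.2).
  rewrite -(pair_bigA _ (fun l t => var_coef g (l, t) v *: spvar (l, t))) /=.
  apply: eq_bigr => l _; rewrite (bigD1 v.2) //= /var_coef eqxx mulr1n.
  by rewrite big1 ?addr0 // => t /negPf ne; rewrite /= ne mulr0n scale0r.
by case: v => i [j|j]; rewrite /spvar /= ?sp_act_X ?sp_act_Theta.
Qed.

Lemma var_coefM g h v' v :
  var_coef (g *m h) v' v = \sum_u var_coef g v' u * var_coef h u v.
Proof.
rewrite /var_coef mxE -(pair_bigA _ (fun l t => (g v'.1 l *+ (v'.2 == t)) * (h l v.1 *+ (t ==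
  v.2)))) /=.
rewrite -sumrMnl; apply: eq_bigr => l _; rewrite (bigD1 v.2) //= eqxx mulr1n mulrnAl.
rewrite big1 ?addr0 // => t /negPf ne; by rewrite ne mulr0n mulr0.
Qed.

Lemma var_coef1 v' v : var_coef 1%:M v' v = (v' == v)%:R.
Proof.
by rewrite /var_coef mxE -[v' == v]/((v'.1 == v.1) && (v'.2 == v.2)); case: eqP; case: eqP.
Qed.

Lemma var_coefC g v' v : var_coef (g ^t*) v' v = (var_coef g v v') ^*.
Proof. by rewrite /var_coef !mxE eq_sym rmorphMn. Qed.

Definition spword w : E := \prod_k spvar (w k).

Definition word_coef g w' w : C := \prod_k var_coef g (w' k) (w k).

Lemma sp_act_word g w : sp_act g (spword w) = \sum_w' word_coef g w' w *: spword w'.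
Proof.
rewrite rmorph_prod /=; under eq_bigr do rewrite sp_act_var.
rewrite bigA_distr_bigA; apply: eq_bigr => w' _.
by rewrite scaler_prod.
Qed.

(** The d-th tensor power, transposed to act on row vectors. In its basis of words the adjoint of g
    acts as an adjoint matrix; in the monomial basis of superpolynomials multinomial factors would
    spoil this. *)
Definition tensor_rep g : 'M[C]_#|word| :=
  \matrix_(p, q) word_coef g (enum_val q) (enum_val p).

Lemma sum_enum_val (F : word -> C) : \sum_(p < #|word|) F (enum_val p) = \sum_w F w.
Proof.
by rewrite [RHS](reindex _ (onW_bij _ (enum_val_bij word))).
Qed.

Lemma tensor_rep_mxrep : is_mxrep tensor_rep.
Proof.
split=> [|g h _ _]; apply/matrixP => p q; rewrite !mxE.
  rewrite /word_coef; under eq_bigr do rewrite var_coef1.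
  have [<-|ne] := eqVneq p q; first by rewrite big1 // => k _; rewrite eqxx.
  have /existsP[k nek] : [exists k, enum_val q k != enum_val p k].
    rewrite -negb_forall; apply: contra ne => /forallP H; apply/eqP/esym/enum_val_inj/ffunP => k.
    exact/eqP.
  by rewrite (bigD1 k) //= (negPf nek) mul0r.
under [RHS]eq_bigr do rewrite !mxE mulrC.
rewrite (sum_enum_val (fun u => word_coef g (enum_val q) u * word_coef h u (enum_val p))).
rewrite /word_coef; under eq_bigr do rewrite var_coefM.
by rewrite bigA_distr_bigA; apply: eq_bigr => u _; rewrite -big_split.
Qed.

Lemma tensor_rep_star : is_starrep tensor_rep.
Proof.
move=> g _; apply/matrixP => p q; rewrite !mxE /word_coef rmorph_prod.
by apply: eq_bigr => k _; rewrite var_coefC.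
Qed.

Variables (a : 'I_m -> nat) (b : 'I_m' -> nat).

Definition col_degree (t : col) : nat := match t with inl j => a j | inr j => b j end.

Definition word_ok w := [forall t, #|[set k | (w k).2 == t]| == col_degree t].

Lemma word_coef_ok g w' w : word_coef g w' w != 0 -> word_ok w' = word_ok w.
Proof.
move=> nz; apply: eq_forallb => t; congr (_ == _); apply: eq_card => k; rewrite !inE.
suff /eqP -> : (w' k).2 == (w k).2 by [].
apply: contraNT nz => ne; rewrite /word_coef (bigD1 k) //= /var_coef (negPf ne) mulr0n mul0r //.
Qed.

Lemma spword_grade w : word_ok w -> spword w \in spgrade a b.
Proof.
move=> /forallP wP.
pose ax (v : var) (t : 'I_m) : nat := v.2 == inl t.
pose bx (v : var) (t : 'I_m') : nat := v.2 == inr t.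
have vP v : spvar v \in spgrade (ax v) (bx v).
  by case: v => i [j|j]; rewrite /spvar /=; [apply: spgradeX | apply: spgradeTheta].
have := spgrade_prod (index_enum 'I_d) (fun k => vP (w k)).
rewrite (@eq_spgrade _ _ _ _ _ a _ b) // => t.
  have <- : _ = a t := eqP (wP (inl t)); rewrite -sum1_card [RHS]big_mkcond /=;
    apply: eq_bigr => k _.
  by rewrite inE /ax; case: eqP.
have <- : _ = b t := eqP (wP (inr t)); rewrite -sum1_card [RHS]big_mkcond /=;
  apply: eq_bigr => k _.
by rewrite inE /bx; case: eqP.
Qed.

(** Words with the wrong column content are sent to 0, so the source remains the full tensor power;
    this is equivariant because the action preserves the column of each letter. *)
Definition tensor_val (u : 'rV[C]_#|word|) : E :=
  \sum_(p < #|word|) (if word_ok (enum_val p) then u 0 p else 0) *: spword (enum_val p).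

Fact tensor_val_is_linear : linear tensor_val.
Proof.
move=> c u u'; rewrite /tensor_val scaler_sumr -big_split; apply: eq_bigr => p _ /=.
by case: ifP => _; rewrite ?scale0r ?scaler0 ?addr0 // !mxE scalerDl scalerA.
Qed.

HB.instance Definition _ := GRing.isLinear.Build C 'rV[C]_#|word| E *:%R tensor_val
  tensor_val_is_linear.

Lemma tensor_val_grade u : tensor_val u \in spgrade a b.
Proof.
apply: rpred_sum => p _; case: ifP => [ok|_]; last by rewrite scale0r rpred0.
by apply: rpredZ; apply: spword_grade.
Qed.

Lemma tensor_valM g u : tensor_val (u *m tensor_rep g) = sp_act g (tensor_val u).
Proof.
rewrite /tensor_val linear_sum /=; under [RHS]eq_bigr do rewrite linearZ /= sp_act_word
  scaler_sumr.
rewrite exchange_big /= [RHS](reindex _ (onW_bij _ (enum_val_bij word))) /=.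
apply: eq_bigr => q _; under [RHS]eq_bigr do rewrite scalerA; rewrite -scaler_suml;
  congr (_ *: _).
rewrite mxE; case: ifP => ok.
  apply: eq_bigr => p _; rewrite mxE; have [->|nz] := eqVneq (word_coef g (enum_val q) (enum_val
    p)) 0.
    by rewrite !mulr0.
  by rewrite -(word_coef_ok nz) ok.
rewrite big1 // => p _; have [->|nz] := eqVneq (word_coef g (enum_val q) (enum_val p)) 0.
  by rewrite mulr0.
by rewrite -(word_coef_ok nz) ok mul0r.
Qed.

Hypothesis ab_d : (\sum_(i < m) a i + \sum_(j < m') b j = d)%N.

Lemma word_of_seq (s : seq var) :
    (forall t, count (fun v : var => v.2 == t) s = col_degree t) ->
  exists2 w : word, word_ok w & spword w = \prod_(v <- s) spvar v.
Proof.
move=> sc; have sd : size s = d.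
  rewrite -ab_d -sum1_size (eq_bigr (fun v => \sum_(t : col) (v.2 == t))%N); last first.
    by move=> v _; rewrite (bigD1 v.2) //= eqxx big1 // => t /negPf; rewrite eq_sym => ->.
  rewrite exchange_big big_sumType /=; congr (_ + _)%N; apply: eq_bigr => t _.
    by rewrite -[RHS](sc (inl t)) -sum1_count [RHS]big_mkcond; apply: eq_bigr => v _; case: eqP.
  by rewrite -[RHS](sc (inr t)) -sum1_count [RHS]big_mkcond; apply: eq_bigr => v _; case: eqP.
have {}sd : size s == d by apply/eqP.
exists [ffun k : 'I_d => tnth (Tuple sd) k].
  apply/forallP => t; rewrite -(sc t) -sum1_card -sum1_count.
  rewrite [X in _ == X](big_tuple _ _ (Tuple sd)) /=.
  by apply/eqP/eq_bigl => k; rewrite inE ffunE.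
rewrite [RHS](big_tuple _ _ (Tuple sd)).
by apply: eq_bigr => k _; rewrite ffunE.
Qed.

(** List the commuting variables with multiplicity, then the anticommuting ones in increasing order,
    so that no sign appears. *)
Lemma word_of_monomial (mu : 'X_{1..n * m}) (S : {set 'I_(n * m')}) :
  has_mdeg a b mu S -> exists2 w : word, word_ok w & spword w = spmon 'X_[mu] S.
Proof.
case/andP => /forallP muP /forallP SP.
have [dec decE decK] := mxvec_index_bij n m'.
pose s1 : seq var := flatten
  [seq nseq (mu (mxvec_index ij.1 ij.2)) (ij.1, inl ij.2) | ij <- enum {: 'I_n * 'I_m}].
pose s2 : seq var := [seq ((dec q).1, inr (dec q).2) | q <- enum S].
have [t|w wP wE] := @word_of_seq (s1 ++ s2).
  rewrite count_cat count_flatten sumnE big_map big_map big_enum /= count_map -sum1_count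
    big_enum_cond /=.
  under eq_bigr do rewrite count_nseq /=.
  rewrite -(pair_bigA _ (fun i j => (inl j == t) * mu (mxvec_index i j))%N) /=.
  case: t => j.
    rewrite [X in (_ + X)%N]big1 => [|q /andP[]] //; rewrite addn0 -[RHS](eqP (muP j)).
    apply: eq_bigr => i _; rewrite (bigD1 j) //= eqxx mul1n big1 ?addn0 // => j' /negPf ne.
    by rewrite -[inl j' == inl j]/(j' == j) ne.
  rewrite big1 => [|i _]; last by rewrite big1.
  rewrite add0n -[RHS](eqP (SP j)) big_mkcond /=.
  rewrite (reindex _ (onW_bij _ (mxvec_index_bij n m'))) /=.
  rewrite -(pair_bigA _ (fun i j' => if (mxvec_index i j' \in S) && (inr (dec (mxvec_index i
    j')).2 == inr j :> col) then 1 else 0)%N) /=.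
  apply: eq_bigr => i _; rewrite (bigD1 j) //= (decE (i, j)) eqxx andbT big1 ?addn0 => [|j'
    /negPf ne].
    by case: (_ \in S).
  by rewrite (decE (i, j')) -[inr _ == inr j]/(j' == j) ne andbF.
exists w => //; rewrite wE big_cat spmonE; congr (_ * _).
  rewrite big_flatten big_map mpolyXE_id.
  rewrite (eq_bigr (fun p => spC (n * m') ('X_(mxvec_index p.1 p.2) ^+ mu (mxvec_index p.1
    p.2)))); last first.
    by move=> p _; rewrite big_nseq iter_mulr_1 rmorphXn.
  rewrite -rmorph_prod; congr spC; rewrite big_enum /=.
  by rewrite [RHS](reindex _ (onW_bij _ (mxvec_index_bij n m))).
rewrite spmon_wprod /wprod big_map; apply: eq_bigr => q _.
by rewrite /spvar /= decK.
Qed.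

End Words.

(** * Monomial coordinates and the trace of the torus *)

Section StripPolyCoef.
Variables (K : comNzRingType) (n : nat) (x : nat -> K).

Lemma coef_strip_poly bd c : (strip_poly x bd n)`_c =
  \sum_(f : {ffun 'I_n -> 'I_bd.+1} | (\sum_i f i == c)%N) \prod_(i < n) x i ^+ f i.
Proof.
rewrite /strip_poly bigA_distr_bigA coef_sum [RHS]big_mkcond; apply: eq_bigr => f _ /=.
by rewrite scaler_prod -expr_sum coefZ coefXn eq_sym; case: eqP; rewrite ?mulr1 ?mulr0.
Qed.

Lemma coef_strip_poly1 c : (strip_poly x 1 n)`_c =
  \sum_(f : {ffun 'I_n -> bool} | (\sum_i f i == c)%N) \prod_(i < n) x i ^+ f i.
Proof.
rewrite /strip_poly (eq_bigr (fun i : 'I_n => \sum_(e : bool) (x i ^+ e) *: 'X^e)); last first.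
  by move=> i _; rewrite big_bool !big_ord_recl big_ord0 addr0 /= addrC.
rewrite bigA_distr_bigA coef_sum [RHS]big_mkcond; apply: eq_bigr => f _ /=.
by rewrite scaler_prod -expr_sum coefZ coefXn eq_sym; case: eqP; rewrite ?mulr1 ?mulr0.
Qed.

Lemma sum_columns (V : finType) k (c : 'I_k -> {ffun 'I_n -> V} -> K) :
  \sum_(g : {ffun 'I_(n * k) -> V}) \prod_(j < k) c j [ffun i => g (mxvec_index i j)] =
  \prod_(j < k) \sum_f c j f.
Proof.
rewrite bigA_distr_bigA; have [dec decE decK] := mxvec_index_bij n k.
rewrite (@big_bij _ _ _ _ _ xpredT xpredT
  (fun F : {ffun 'I_k -> {ffun 'I_n -> V}} => [ffun q => F (dec q).2 (dec q).1] : {ffun 'I_(n *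
    k) -> V})
  (fun g => [ffun j => [ffun i => g (mxvec_index i j)]])) //.
- apply: eq_bigr => F _; apply: eq_bigr => j _; congr (c j _); apply/ffunP => i.
  by rewrite !ffunE (decE (i, j)).
- by move=> F _; apply/ffunP => j; apply/ffunP => i; rewrite !ffunE (decE (i, j)).
- by move=> g _; apply/ffunP => q; rewrite !ffunE decK.
Qed.

End StripPolyCoef.

Section Coordinates.
Variables (C : numClosedFieldType) (n m m' d : nat).
Variables (a : 'I_m -> nat) (b : 'I_m' -> nat).
Hypothesis ab_d : (\sum_(i < m) a i + \sum_(j < m') b j = d)%N.
Local Notation E := (superpoly C (n * m) (n * m')).

Lemma monomial_expansion (f : E) :
  f = \sum_S \sum_(mu <- msupp (f S)) (f S)@_mu *: spmon 'X_[mu] S.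
Proof.
rewrite [LHS]spmon_sum; apply: eq_bigr => S _; rewrite [in LHS](mpolyE (f S)).
elim: (msupp _) => [|mu r IH]; first by rewrite !big_nil spmon0.
by rewrite !big_cons spmonD spmonZ IH.
Qed.

Lemma tensor_val_onto (f : E) : f \in spgrade a b ->
  exists u : 'rV[C]_#|{ffun 'I_d -> 'I_n * ('I_m + 'I_m')}|, tensor_val a b u = f.
Proof.
move=> /spgradeP fP; rewrite (monomial_expansion f).
apply: (big_ind (fun f => exists u, tensor_val a b u = f)) => [|f1 f2 [u1 <-] [u2 <-]|S _].
- by exists 0; rewrite linear0.
- by exists (u1 + u2); rewrite linearD.
rewrite big_seq.
apply: (big_ind (fun f => exists u, tensor_val a b u = f)) => [|f1 f2 [u1 <-] [u2 <-]|mu].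
- by exists 0; rewrite linear0.
- by exists (u1 + u2); rewrite linearD.
rewrite mcoeff_msupp => /fP/(word_of_monomial C ab_d)[w wP <-].
exists ((f S)@_mu *: delta_mx 0 (enum_rank w)); rewrite linearZ /=; congr (_ *: _).
rewrite /tensor_val (bigD1 (enum_rank w)) //= enum_rankK wP mxE !eqxx scale1r big1 ?addr0 //.
by move=> p /negPf ne; rewrite mxE ne andbF if_same scale0r.
Qed.

(** Exponents bounded by d suffice, the total degree of the piece being d; this makes the monomial
    basis a finite type. *)
Local Notation expo := ({ffun 'I_(n * m) -> 'I_d.+1} * {set 'I_(n * m')})%type.

Definition expo_mnm (nu : {ffun 'I_(n * m) -> 'I_d.+1}) : 'X_{1..n * m} :=
  [multinom (nu p : nat) | p < n * m].

Definition expo_set : {set expo} := [set x | has_mdeg a b (expo_mnm x.1) x.2].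

Definition sp_coord (f : E) : 'rV[C]_#|expo_set| :=
  \row_q (f (enum_val q).2)@_(expo_mnm (enum_val q).1).

Fact sp_coord_is_linear : linear sp_coord.
Proof. by move=> c f g; apply/rowP => q; rewrite !mxE !ffunE mcoeffD mcoeffZ. Qed.

HB.instance Definition _ := GRing.isLinear.Build C E 'rV[C]_#|expo_set| *:%R sp_coord
  sp_coord_is_linear.

Lemma has_mdeg_expo mu S : has_mdeg a b mu S ->
  exists2 x : expo, x \in expo_set & expo_mnm x.1 = mu /\ x.2 = S.
Proof.
move=> muS; have /andP[/forallP muP _] := muS.
have le p : (mu p <= d)%N.
  case/mxvec_indexP: p => i j; rewrite -ab_d (bigD1 j) //= -(eqP (muP j)) (bigD1 i) //=.
  by rewrite -!addnA leq_addr.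
pose nu : {ffun 'I_(n * m) -> 'I_d.+1} := [ffun p => inord (mu p)].
have nuE : expo_mnm nu = mu by apply/mnmP => p; rewrite mnmE ffunE inordK // ltnS.
by exists (nu, S); rewrite ?inE /= nuE.
Qed.

Lemma sp_coord_eq0 f : f \in spgrade a b -> sp_coord f = 0 -> f = 0.
Proof.
move=> /spgradeP fP f0; apply/ffunP => S; apply/mpolyP => mu; rewrite ffunE mcoeff0.
apply/eqP; apply/negPn/negP => nz; have [x xA [xmu xS]] := has_mdeg_expo (fP _ _ nz).
move/rowP/(_ (enum_rank_in xA x)): f0; rewrite !mxE enum_rankK_in // xmu xS => E.
by rewrite E eqxx in nz.
Qed.

Lemma sp_coord_monomial x q : x \in expo_set ->
  sp_coord (spmon 'X_[expo_mnm x.1] x.2) 0 q = (x == enum_val q)%:R.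
Proof.
move=> xA; rewrite mxE ffunE; case: (enum_val q) => nu S /=; case: x xA => nu' S' /= _.
rewrite xpair_eqE eq_sym andbC; case: eqP => _; last by rewrite mcoeff0.
rewrite mcoeffX; congr (nat_of_bool _)%:R; apply/eqP/eqP => [E|-> //].
by apply/ffunP => p; apply/val_inj; move/mnmP/(_ p): E; rewrite !mnmE.
Qed.

Lemma monomial_grade x : x \in expo_set -> spmon 'X_[expo_mnm x.1] x.2 \in spgrade (K := C) a b.
Proof.
rewrite inE => xP; apply/spgradeP => S mu; rewrite ffunE; case: (S =P _) => [->|_]; last first.
  by rewrite mcoeff0 eqxx.
by rewrite mcoeffX; case: (_ =P mu) => [<-|_] //; rewrite eqxx.
Qed.

Lemma sp_coord_onto v : exists2 f, f \in spgrade a b & sp_coord f = v.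
Proof.
exists (\sum_q v 0 q *: spmon 'X_[expo_mnm (enum_val q).1] (enum_val q).2).
  by apply: rpred_sum => q _; apply: rpredZ; apply: monomial_grade; apply: enum_valP.
rewrite linear_sum; apply/rowP => p; rewrite summxE (bigD1 p) //= linearZ mxE.
rewrite sp_coord_monomial ?enum_valP // eqxx mulr1 big1 ?addr0 // => q ne.
by rewrite linearZ mxE sp_coord_monomial ?enum_valP // (inj_eq enum_val_inj) (negPf ne) mulr0.
Qed.

Definition expo_weight (t : 'I_n -> C) (x : expo) : C :=
  (\prod_(p : 'I_n * 'I_m) t p.1 ^+ expo_mnm x.1 (mxvec_index p.1 p.2)) *
  \prod_(p : 'I_n * 'I_m') t p.1 ^+ (mxvec_index p.1 p.2 \in x.2).

Lemma sp_act_diag_monomial (t : 'rV[C]_n) x :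
  sp_act (diag_mx t) (spmon 'X_[expo_mnm x.1] x.2) =
  expo_weight (t 0) x *: spmon 'X_[expo_mnm x.1] x.2 :> E.
Proof.
have diagE (V : lmodType C) (z : 'I_n -> V) i : \sum_l diag_mx t l i *: z l = t 0 i *: z i.
  rewrite (bigD1 i) //= mxE eqxx mulr1n big1 ?addr0 // => l /negPf ne.
  by rewrite mxE ne mulr0n scale0r.
rewrite spmonE rmorphM /= /expo_weight [X in X *: _]mulrC -scalerA scalerAl scalerAr;
  congr (_ * _).
  rewrite mpolyXE_id (reindex _ (onW_bij _ (mxvec_index_bij n m))) /= !rmorph_prod -scaler_prod.
  apply: eq_bigr => p _; rewrite !rmorphXn -exprZn; congr (_ ^+ _).
  have H : sp_act (diag_mx t) (spX C (n * m') (mxvec_index p.1 p.2)) =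
      t 0 p.1 *: spX C (n * m') (mxvec_index p.1 p.2) by rewrite sp_act_X diagE.
  exact: H.
have [dec decE decK] := mxvec_index_bij n m'.
rewrite spmon_wprod /wprod rmorph_prod /=.
rewrite (eq_bigr (fun q => t 0 (dec q).1 *: spTheta C (n * m) q)); last first.
  by move=> q _; rewrite -{1}(decK q) sp_act_Theta diagE decK.
rewrite scaler_prod; congr (_ *: _); rewrite big_enum big_mkcond /=.
rewrite (reindex _ (onW_bij _ (mxvec_index_bij n m'))) /=; apply: eq_bigr => p _.
by rewrite decE; case: (_ \in _).
Qed.

Lemma sp_coord_diag (t : 'rV[C]_n) f : f \in spgrade a b ->
  sp_coord (sp_act (diag_mx t) f) =
  sp_coord f *m diag_mx (\row_q expo_weight (t 0) (enum_val q)).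
Proof.
move=> /spgradeP fP; rewrite (monomial_expansion f); set W := diag_mx (\row__ _).
pose Q f := sp_coord (sp_act (diag_mx t) f) = sp_coord f *m W.
have Q0 : Q 0 by rewrite /Q !linear0 mul0mx.
have QD f1 f2 : Q f1 -> Q f2 -> Q (f1 + f2) by move=> q1 q2; rewrite /Q !linearD mulmxDl /=;
  congr (_ + _).
rewrite -/(Q _); apply: big_ind => // S _; rewrite big_seq; apply: big_ind => // mu.
rewrite mcoeff_msupp => /fP/has_mdeg_expo[x xA [<- <-]]; rewrite /Q.
rewrite !linearZ /= sp_act_diag_monomial -scalemxAl linearZ /=; congr (_ *: _).
apply/rowP => q; rewrite mul_mx_diag [LHS]mxE [RHS]mxE [X in _ = _ * X]mxE sp_coord_monomial //.
by case: eqP => [<-|_]; rewrite ?mulr1 ?mul1r // mulr0 mul0r.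
Qed.

(** The multidegree constrains each column separately, so the sum factors over columns. Free
    exponents in a commuting column give h, exponents 0 or 1 in an anticommuting column give e. *)
Lemma sum_expo_weight (t : 'I_n -> C) :
  \sum_(x in expo_set) expo_weight t x =
  \prod_(i < m) (strip_poly (natext 0 t) d n)`_(a i) *
  \prod_(j < m') (strip_poly (natext 0 t) 1 n)`_(b j).
Proof.
pose c1 j (f : {ffun 'I_n -> 'I_d.+1}) : C :=
  if (\sum_i f i == a j)%N then \prod_(i < n) t i ^+ f i else 0.
pose c2 j (f : {ffun 'I_n -> bool}) : C :=
  if (\sum_i f i == b j)%N then \prod_(i < n) t i ^+ f i else 0.
pose F1 (nu : {ffun 'I_(n * m) -> 'I_d.+1}) := \prod_(j < m) c1 j [ffun i => nu (mxvec_index i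
  j)].
pose F2 (g : {ffun 'I_(n * m') -> bool}) := \prod_(j < m') c2 j [ffun i => g (mxvec_index i j)].
have natE (k : nat) (f : {ffun 'I_n -> 'I_k.+1}) :
  \prod_(i < n) natext 0 t i ^+ f i = \prod_i t i ^+ f i by apply: eq_bigr => i _;
    rewrite natext_ord.
transitivity (\sum_nu \sum_(S : {set 'I_(n * m')}) F1 nu * F2 [ffun q => q \in S]).
  rewrite pair_bigA big_mkcond; apply: eq_bigr => -[nu S] _; rewrite inE /has_mdeg /=.
  have mE p : expo_mnm nu p = nu p by rewrite mnmE.
  have F1E : F1 nu = if [forall j, (\sum_i expo_mnm nu (mxvec_index i j) == a j)%N] then
      \prod_(p : 'I_n * 'I_m) t p.1 ^+ expo_mnm nu (mxvec_index p.1 p.2) else 0.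
    case: ifPn => [/forallP H|]; last first.
      rewrite negb_forall => /existsP[j /negPf nj]; rewrite /F1 (bigD1 j) //= /c1.
      by under eq_bigr do rewrite ffunE -mE; rewrite nj mul0r.
    rewrite -(pair_bigA _ (fun i j => t i ^+ expo_mnm nu (mxvec_index i j))) exchange_big /=.
    apply: eq_bigr => j _; rewrite /c1; under eq_bigr do rewrite ffunE -mE; rewrite H.
    by apply: eq_bigr => i _; rewrite ffunE -mE.
  have F2E : F2 [ffun q => q \in S] = if [forall j, (\sum_i (mxvec_index i j \in S) == b j)%N]
    then
      \prod_(p : 'I_n * 'I_m') t p.1 ^+ (mxvec_index p.1 p.2 \in S) else 0.
    case: ifPn => [/forallP H|]; last first.
      rewrite negb_forall => /existsP[j /negPf nj]; rewrite /F2 (bigD1 j) //= /c2.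
      by under eq_bigr do rewrite !ffunE; rewrite nj mul0r.
    rewrite -(pair_bigA _ (fun i j => t i ^+ (mxvec_index i j \in S))) exchange_big /=.
    apply: eq_bigr => j _; rewrite /c2; under eq_bigr do rewrite !ffunE; rewrite H.
    by apply: eq_bigr => i _; rewrite !ffunE.
  rewrite F1E F2E.
  by case: [forall j, (\sum_i expo_mnm nu _ == _)%N]; rewrite /= ?mul0r //;
    case: [forall j, _]; rewrite ?mulr0.
rewrite -big_distrlr /=; congr (_ * _).
  rewrite /F1 sum_columns; apply: eq_bigr => j _; rewrite coef_strip_poly [RHS]big_mkcond.
  by apply: eq_bigr => f _; rewrite /c1 natE.
rewrite (@big_bij _ _ _ _ _ xpredT xpredT (fun g : {ffun 'I_(n * m') -> bool} => [set q | g q])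
  (fun S => [ffun q => q \in S])) //.
- rewrite (eq_bigr F2) => [|g _]; last by congr F2; apply/ffunP => q; rewrite ffunE inE.
  rewrite /F2 sum_columns; apply: eq_bigr => j _; rewrite coef_strip_poly1 [RHS]big_mkcond.
  by apply: eq_bigr => f _; rewrite /c2; case: ifP => // _; apply: eq_bigr => i _;
    rewrite natext_ord.
- by move=> g _; apply/ffunP => q; rewrite ffunE inE.
- by move=> S _; apply/setP => q; rewrite inE ffunE.
Qed.

End Coordinates.

Import passmx.

(** * Traces of the representations involved, along lines *)

Section LinePolyMore.
Variables (C : numClosedFieldType) (n : nat).

Lemma line_poly_ext (f f' : 'M[C]_n -> C) :
  (forall g, g \in unitmx -> f g = f' g) -> line_poly f' -> line_poly f.
Proof.
by move=> E f'P A B; have [Q QE] := f'P A B; exists Q => e eU; rewrite E ?QE.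
Qed.

Lemma line_polyX (f : 'M[C]_n -> C) k : line_poly f -> line_poly (fun g => f g ^+ k).
Proof.
move=> fP; elim: k => [|k IH].
  by apply: (@line_poly_ext _ (fun=> 1)) => [g _|]; [rewrite expr0 | apply: line_poly_const].
apply: (@line_poly_ext _ (fun g => f g * f g ^+ k)) => [g _|]; first by rewrite exprS.
exact: line_polyM.
Qed.

Lemma line_poly_meval (p : {mpoly C[n * n]}) :
  line_poly (fun g : 'M[C]_n => p.@[fun q => mxvec g 0 q]).
Proof.
apply: (@line_poly_ext _ (fun g => \sum_(mu <- msupp p) p@_mu * \prod_i mxvec g 0 i ^+ mu i)).
  by move=> g _; rewrite mevalE.
apply: line_poly_sum => mu _; apply: line_polyM; first exact: line_poly_const.
apply: line_poly_prod => q _; apply: line_polyX; case/mxvec_indexP: q => i j.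
by apply: line_poly_ext (line_poly_entry i j) => g _; rewrite mxvecE.
Qed.

End LinePolyMore.

Section SimpleGL.
Variables (C : numClosedFieldType) (n : nat) (V : glrep C n).
Let e := vbasis {:V}.
Let e_basis : basis_of {:V} e := vbasisP _.

Lemma glrep_mxrep : is_mxrep (glrep_mx V).
Proof.
split=> [|g h gU hU]; rewrite /glrep_mx.
  by rewrite glrep_act1 mxof1 // (basis_free e_basis).
by rewrite glrep_actM // (@mxof_comp _ _ _ _ e e e e_basis).
Qed.

Lemma glrep_mxsimple : gl_simple V -> is_mxsimple (glrep_mx V).
Proof.
move=> [dV Vs]; split=> // U Uinv; have [|H|H] := Vs (vsof e U).
- move=> g gU; apply/subvP => _ /memv_imgP[v vU ->].
  rewrite -(rVof_sub e_basis) (@rVof_app _ _ _ e e e_basis).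
  by apply: submx_trans (Uinv g gU); rewrite submxMr // rVof_sub.
- by left; apply/eqP; rewrite -(vsof_eq0 e_basis) H.
right; rewrite -sub1mx; apply/row_subP => i.
by rewrite -[row i _](vecofK e_basis) (rVof_sub e_basis) H memvf.
Qed.

Lemma glrep_trace_line_poly : gl_polynomial V -> line_poly (fun g => \tr (glrep_mx V g)).
Proof.
case=> P PE; apply: (@line_poly_ext _ _ _ (fun g => \sum_i (P i i).@[fun q => mxvec g 0 q])).
  by move=> g gU; apply: eq_bigr => i _; apply: PE.
by apply: line_poly_sum => i _; apply: line_poly_meval.
Qed.

End SimpleGL.

Lemma mxrep_trace_conj (C : numClosedFieldType) n N (rho : 'M[C]_n -> 'M[C]_N) g p :
  is_mxrep rho -> g \in unitmx -> p \in unitmx ->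
  \tr (rho (p *m g *m invmx p)) = \tr (rho g).
Proof.
move=> [rho1 rhoM] gU pU; rewrite !rhoM ?unitmx_mul ?pU ?gU ?unitmx_inv //.
by rewrite mulmxA mxtrace_mulC mulmxA -rhoM ?unitmx_inv // mulVmx // rho1 mul1mx.
Qed.

Section TensorTrace.
Variables (C : numClosedFieldType) (n m m' d : nat).

Lemma tensor_rep_line_poly k (A : 'M_(k, _)) (B : 'M_(_, k)) :
  line_poly (fun g : 'M[C]_n => \tr (A *m tensor_rep m m' d g *m B)).
Proof.
apply: (@line_poly_ext _ _ _ (fun g => \sum_i \sum_j (\sum_l A i l * tensor_rep m m' d g l j) *
  B j i)).
  by move=> g _; apply: eq_bigr => i _; rewrite mxE; apply: eq_bigr => j _; rewrite mxE.
apply: line_poly_sum => i _; apply: line_poly_sum => j _.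
apply: line_polyM; last exact: line_poly_const.
apply: line_poly_sum => l _; apply: line_polyM; first exact: line_poly_const.
apply: (@line_poly_ext _ _ _ (fun g => \prod_q (g (enum_val j q).1 (enum_val l q).1 *
    ((enum_val j q).2 == (enum_val l q).2)%:R))).
  by move=> g _; rewrite mxE; apply: eq_bigr => q _; rewrite mulr_natr.
apply: line_poly_prod => q _; apply: line_polyM; last exact: line_poly_const.
exact: line_poly_entry.
Qed.

End TensorTrace.

(** * The graded piece as a sum of simple modules *)

Section Decomposition.
Variables (C : numClosedFieldType) (n m m' d : nat) (a : 'I_m -> nat) (b : 'I_m' -> nat).
Hypothesis ab_d : (\sum_(i < m) a i + \sum_(j < m') b j = d)%N.
Local Notation word := {ffun 'I_d -> 'I_n * ('I_m + 'I_m')}.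
Local Notation J := #|expo_set n d a b|.

Definition coord_mx : 'M[C]_(#|word|, J) :=
  lin1_mx (sp_coord d a b \o tensor_val a b).

Lemma mul_coord_mx u : u *m coord_mx = sp_coord d a b (tensor_val a b u).
Proof. by rewrite mul_rV_lin1. Qed.

Lemma sp_coord_inj (f h : superpoly C (n * m) (n * m')) :
  f \in spgrade a b -> h \in spgrade a b ->
  sp_coord d a b f = sp_coord d a b h -> f = h.
Proof.
move=> fP hP E; apply/eqP; rewrite -subr_eq0; apply/eqP.
by apply: (sp_coord_eq0 ab_d); rewrite ?rpredB // linearB /= E subrr.
Qed.

Lemma coord_mx_full : row_full coord_mx.
Proof.
rewrite -sub1mx; apply/row_subP => i.
have [f fP <-] := sp_coord_onto (C := C) (n := n) (d := d) (a := a) (b := b) (row i 1%:M).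
by have [u <-] := tensor_val_onto ab_d fP; rewrite -mul_coord_mx submxMl.
Qed.

Lemma coord_mx_act g u :
  u *m tensor_rep m m' d g *m coord_mx = sp_coord d a b (sp_act g (tensor_val a b u)).
Proof. by rewrite mul_coord_mx tensor_valM. Qed.

Lemma coord_mx_inv g (u : 'rV[C]_#|word|) : g \in unitmx -> u *m coord_mx = 0 ->
  u *m tensor_rep m m' d g *m coord_mx = 0.
Proof.
move=> _; rewrite mul_coord_mx coord_mx_act => u0.
by rewrite (sp_coord_eq0 ab_d (tensor_val_grade _ _ _) u0) !linear0.
Qed.

Lemma coord_mx_diag k (A : 'M_(k, #|word|)) (t : 'rV[C]_n) :
  A *m tensor_rep m m' d (diag_mx t) *m coord_mx =
  A *m coord_mx *m diag_mx (\row_q expo_weight (t 0) (enum_val q)).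
Proof.
apply/row_matrixP => i; rewrite !row_mul coord_mx_act mul_coord_mx.
by apply: (sp_coord_diag ab_d); apply: tensor_val_grade.
Qed.

Variable V : intpart d -> glrep C n.
Hypotheses (n_gt0 : (0 < n)%N) (VP : forall lam : intpart d, (size (parts lam) <= n)%N ->
  is_GL_lambda (parts lam) (V lam)).

Local Notation Lam := {lam : intpart d | (size (parts lam) <= n)%N}.
Local Notation mult lam := #|SSMT' (parts (val lam)) a b|.
Local Notation I := {lam : Lam & 'I_(mult lam)}.

Let dimV (x : I) := \dim {: V (val (tag x))}.
(** One index for each copy of a simple module, so multiplicities need no separate treatment in
    [starrep_decomposition]. *)
Let sigma (x : I) (g : 'M[C]_n) : 'M[C]_(dimV x) := glrep_mx (V (val (tag x))) g.

(** The difference of the two sides is a class function, polynomial along lines. On the torus [R] is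
    conjugate, through [B *m coord_mx], to the diagonal matrix of the monomial weights, and
    [sum_SSMT'_schur] concludes. *)
Lemma piece_trace k (B : 'M_(k, #|word|)) (X : 'M_(J, k)) g :
  let R g := B *m tensor_rep m m' d g *m B ^t* in
  is_mxrep R -> X *m (B *m coord_mx) = 1%:M -> (B *m coord_mx) *m X = 1%:M ->
  (forall g, g \in unitmx -> R g *m (B *m coord_mx) = B *m tensor_rep m m' d g *m coord_mx) ->
  g \in unitmx -> \tr (R g) = \sum_(x in [set: I]) \tr (sigma x g).
Proof.
move=> R RP XT TX RE gU; apply/eqP; rewrite -subr_eq0; apply/eqP; move: g gU.
have lamP (lam : Lam) : is_GL_lambda (parts (val lam)) (V (val lam)) by apply: VP;
  exact: (valP lam).
move=> g; apply: (@class_fun_unit_eq0 _ _ (fun g => \tr (R g) - \sum_(x in [set: I]) \tr (sigma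
  x g))) => //.
- apply: (@line_poly_ext _ _ _ (fun g => \tr (R g) + (-1) * \sum_(x in [set: I]) \tr (sigma x
  g))).
    by move=> g' _; rewrite mulN1r.
  apply: line_polyD; first exact: tensor_rep_line_poly.
  apply: line_polyM; first exact: line_poly_const.
  by apply: line_poly_sum => x _; have [Vpol _ _] := lamP (tag x); apply: glrep_trace_line_poly.
- move=> g' p gU' pU; rewrite mxrep_trace_conj //; congr (_ - _); apply: eq_bigr => x _.
  by rewrite mxrep_trace_conj //; apply: glrep_mxrep.
move=> t t0.
have tU : diag_mx t \in unitmx.
  by rewrite unitmxE det_diag unitfE; apply/prodf_neq0 => i _.
have -> : R (diag_mx t) =
    (B *m coord_mx) *m diag_mx (\row_q expo_weight (t 0) (enum_val q)) *m X.
  by rewrite -coord_mx_diag -RE // -mulmxA TX mulmx1.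
rewrite mxtrace_mulC mulmxA XT mul1mx mxtrace_diag; under eq_bigr do rewrite mxE.
apply/eqP; rewrite subr_eq0; apply/eqP.
transitivity (\sum_(x in expo_set n d a b) expo_weight (t 0) x).
  by rewrite [RHS](big_enum_val (A := mem (expo_set n d a b)) (expo_weight (t 0)));
    apply: eq_bigr.
rewrite sum_expo_weight -(sum_SSMT'_schur _ ab_d) big_sub.
transitivity (\sum_(lam : Lam) \sum_(j < mult lam) \tr (glrep_mx (V (val lam)) (diag_mx t))).
  apply: eq_bigr => lam _; rewrite sumr_const card_ord -[RHS]mulr_natl; congr (_ * _).
  by have [_ _ ->] := lamP lam.
by rewrite sig_big_dep; apply: eq_bigl => x; rewrite inE.
Qed.

(** The isomorphism takes monomial coordinates, passes by [X] to the complement of the kernel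
    carrying [R], and projects by [pi] to each simple copy; its inverse sums the [iota] and
    multiplies out the resulting tensor. *)
Theorem sppiece_decomposition :
  gl_iso (sppiece_glmod C n a b)
    (glsum (fun lam : Lam => glsum (fun _ : 'I_(mult lam) => V (val lam) : glmod C n))).
Proof.
have [k [B [X]]] := starrep_quotient (@tensor_rep_mxrep _ _ _ _ _) (@tensor_rep_star _ _ _ _ _)
  coord_mx_full coord_mx_inv.
set R := fun g : 'M[C]_n => B *m tensor_rep m m' d g *m B ^t*.
move=> /= [RP RS TX XT RE].
have lamP (lam : Lam) : is_GL_lambda (parts (val lam)) (V (val lam)) by apply: VP;
  exact: (valP lam).
have trE g : g \in unitmx -> \tr (R g) = \sum_(x in [set: I]) \tr (sigma x g) by move=> gU;
  exact: (piece_trace RP XT TX RE gU).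
have [||pi [iota [piE iotapi iotapi0 piiota]]] := starrep_decomposition _ _ RP RS trE.
- by move=> x _; apply: glrep_mxrep.
- by move=> x _; apply: glrep_mxsimple; have [] := lamP (tag x).
have inT (x : I) : x \in [set: I] by rewrite inE.
pose Wd := glsum (fun lam : Lam => glsum (fun _ : 'I_(mult lam) => V (val lam) : glmod C n)).
pose bs (lam : Lam) := vbasis {: V (val lam)}.
have bsP lam : basis_of {: V (val lam)} (bs lam) by apply: vbasisP.
pose tg (lam : Lam) (j : 'I_(mult lam)) : I := Tagged (fun lam : Lam => 'I_(mult lam)) j.
pose crd (v : sppiece_glmod C n a b) := sp_coord d a b (sppiece_val v).
pose F (v : sppiece_glmod C n a b) : Wd :=
  [ffun lam : Lam => [ffun j : 'I_(mult lam) =>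
     vecof (bs lam) (crd v *m X *m pi (tg lam j))]].
have F_lin : linear F.
  move=> c u v; apply/ffunP => lam; apply/ffunP => j; rewrite !ffunE.
  by rewrite /crd /= linearP /= !mulmxDl -!scalemxAl linearP.
pose FL : {linear sppiece_glmod C n a b -> Wd} :=
  HB.pack F (GRing.isLinear.Build C _ _ *:%R F F_lin).
pose tv (y : 'rV[C]_k) : sppiece_glmod C n a b := Sppiece (tensor_val_grade a b (y *m B)).
have crd_tv y : crd (tv y) = y *m (B *m coord_mx).
  by rewrite /crd /= -mul_coord_mx mulmxA.
have crd_inj u v : crd u = crd v -> u = v.
  by move=> E; apply/val_inj; apply: sp_coord_inj E; apply: sppieceP.
have tvK v : tv (crd v *m X) = v.
  by apply: crd_inj; rewrite crd_tv -mulmxA XT mulmx1.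
exists FL; split.
  pose rv (u : Wd) (x : I) := rVof (bs (tag x)) (u (tag x) (tagged x)).
  exists (fun u : Wd => tv (\sum_x rv u x *m iota x)) => [v|u].
    rewrite -[RHS]tvK; congr tv.
    rewrite (eq_bigr (fun x => crd v *m X *m (pi x *m iota x))) => [|[lam j] _]; last first.
      by rewrite /rv /= !ffunE (vecofK (bsP lam)) mulmxA.
    rewrite -mulmx_sumr -[RHS]mulmx1 -piiota; congr (_ *m _).
    by apply: eq_bigl => x; rewrite inE.
  apply/ffunP => lam; apply/ffunP => j; rewrite !ffunE crd_tv.
  rewrite -(mulmxA _ (B *m coord_mx) X) TX mulmx1 mulmx_suml (bigD1 (tg lam j)) //=.
  rewrite big1 ?addr0 => [|x ne]; last by rewrite -mulmxA iotapi0 ?mulmx0.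
  rewrite -mulmxA (iotapi (tg lam j) (inT _)) mulmx1 /rv /=. exact: (rVofK (bsP lam)).
move=> g gU v; apply/ffunP => lam; apply/ffunP => j; rewrite /= !ffunE /=.
have crdR : crd (glact g v) *m X = crd v *m X *m R g.
  rewrite -[in LHS](tvK v) [crd (glact _ _)]/crd /= -tensor_valM -mul_coord_mx.
  have -> : crd v *m X *m B *m tensor_rep m m' d g *m coord_mx =
      crd v *m X *m (B *m tensor_rep m m' d g *m coord_mx) by rewrite !mulmxA.
  by rewrite -RE // -(mulmxA _ _ X) -(mulmxA (R g)) TX mulmx1.
by rewrite crdR -mulmxA piE // mulmxA (@hom_vecof _ _ _ (bs lam) (bs lam) (bsP lam)).
Qed.
End Decomposition.

Theorem corollary6p5 (R : realType) (n m m' r s : nat)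
    (a : m.-tuple nat) (b : m'.-tuple nat)
    (GLlam : intpart (r + s) -> glrep R[i] n)
    (n_ge1 : (1 <= n)%N) (a_sum : sumn a = r) (b_sum : sumn b = s)
    (GLlamP : forall lam : intpart (r + s), (size (parts lam) <= n)%N ->
       is_GL_lambda (parts lam) (GLlam lam)) :
  gl_iso
    (sppiece_glmod R[i] n (tnth a) (tnth b))
    (glsum (fun lam : {lam : intpart (r + s) | (size (parts lam) <= n)%N} =>
       glsum (fun _ : 'I_#|SSMT' (parts (val lam)) (tnth a) (tnth b)| =>
         GLlam (val lam) : glmod R[i] n))).
Proof.
apply: (@sppiece_decomposition R[i] n m m' (r + s) (tnth a) (tnth b)) => //.
by rewrite -a_sum -b_sum !sumnE !big_tuple.
Qed.
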